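(* Let $\mu$ be a probability measure on $\mathbb R$ with median $m$. Let $\nu$ be a positive measure on $\mathbb R$, absolutely continuous with respect to the Lebesgue measure, with density $n$. Let $C_P\in(0,+\infty]$ be the optimal constant such that every locally Lipschitz $f:\mathbb R\to\mathbb R$ satisfies $\mathbf{Var}_\mu(f)\le C_P\int (f')^2\,d\nu$. Fix $q\ge 2$, let $H_q(x)=\max(x^2,|x|^q)$, and define $$B_q^+:=\sup_{x>m}\mu([x,\infty))\log\frac{1}{\mu([x,\infty))}\left(\int_m^x n^{\frac{-1}{q-1}}\right)^{q-1},\qquad B_q^-:=\sup_{x<m}\mu((-\infty,x])\log\frac{1}{\mu((-\infty,x])}\left(\int_x^m n^{\frac{-1}{q-1}}\right)^{q-1}.$$ Let $\kappa_q\in(0,+\infty]$ be the best constant such that every locally Lipschitz $f:\mathbb R\to\mathbb R$ satisfies $$\mathbf{Ent}_\mu(f^2)\le \kappa_q\int H_q\left(\frac{f'}{f}\right)f^2\,d\nu.$$ Then $$\kappa_q\le 235\,C_P+2^{q+1}\max(B_q^+,B_q^-).$$ If moreover there exists $\varepsilon>0$ such that for all $x\ne m$, $$(q-1)\,n(x)^{\frac{-1}{q-1}}\ge \varepsilon\int_{\min(x,m)}^{\max(x,m)}n^{\frac{-1}{q-1}},$$ then it is also true that $$\kappa_q\ge\max\left(2C_P,\ \frac{3\min(\varepsilon^{q-2},1)}{4(q-1)^{q-1}}\max(B_q^+,B_q^-)\right).$$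
   Context: $\mathbf{Ent}_\mu(g)=\int g\log g\,d\mu-\left(\int g\,d\mu\right)\log\left(\int g\,d\mu\right)$ and $\mathbf{Var}_\mu(f)=\int f^2d\mu-(\int f\,d\mu)^2$. For a locally Lipschitz $f$, $|f'|(x)=\lim_{r\to0^+}\sup_{|x-y|\le r}\frac{|f(x)-f(y)|}{|x-y|}$, which equals the absolute value of the usual derivative Lebesgue-almost everywhere; only $|f'|$ matters since $H_q$ is even. The integrand $H_q(f'/f)f^2$ is read as $0$ at points where $f=0$ (where $f'=0$ almost everywhere). Conventions: $n^{-1/(q-1)}=+\infty$ where $n=0$; $0\log(1/0)=0$; $0\cdot\infty=0$. *)

(* Defs.v *)
From HB Require Import structures.
From mathcomp Require Import all_boot all_order all_algebra.
From mathcomp Require Import all_classical all_reals all_analysis.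

Set Implicit Arguments.
Unset Strict Implicit.
Unset Printing Implicit Defensive.

Import Order.TTheory GRing.Theory Num.Theory.
Import numFieldNormedType.Exports.

Local Open Scope classical_set_scope.
Local Open Scope ring_scope.
Local Open Scope ereal_scope.

Definition is_median (R : realType) (mu : probability (measurableTypeR R) R)
    (m : R) : Prop :=
  (2^-1)%:E <= mu `]-oo, m]%classic /\ (2^-1)%:E <= mu `[m, +oo[%classic.

Definition is_density (R : realType)
    (nu : {measure set (measurableTypeR R) -> \bar R}) (n : R -> R) : Prop :=
  [/\ measurable_fun [set: measurableTypeR R] n,
      forall x, (0 <= n x)%R
    & forall A : set (measurableTypeR R), measurable A ->
        nu A = \int[lebesgue_measure]_(x in A) (n x)%:E].

(* The library asks for a Lipschitz bound near each pair (x, y); for x != y it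
   follows from the Lipschitz bounds near x and near y. *)
Definition locally_lipschitz (R : realType) (f : R -> R) : Prop :=
  [locally [lipschitz f x | x in [set: R]]].

(* The function |f'|; the limit is finite when f is locally Lipschitz. *)
Definition local_slope (R : realType) (f : R -> R) (x : R) : R :=
  fine (lim (ereal_sup [set (`|f x - f y| / `|x - y|)%:E
                       | y in [set y | (0 < `|x - y| <= r)%R]]
             @[r --> (0 : R)^'+])).

Definition Hq (R : realType) (q x : R) : R := (Num.max (x ^+ 2) (`|x| `^ q))%R.

(* For g >= 0. The value is +oo when g is not integrable; since ln 0 = 0, the
   integrand g log g vanishes where g does. *)
Definition entropy (R : realType) (mu : probability (measurableTypeR R) R)
    (g : R -> R) : \bar R :=
  if \int[mu]_x (g x)%:E is c%:E
  then \int[mu]_x (g x * ln (g x))%:E - (c * ln c)%:E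
  else +oo.

(* The infimum is +oo when no finite constant is admissible. *)
Definition best_constant (R : realType) (P : R -> Prop) : \bar R :=
  ereal_inf [set C%:E | C in [set C : R | (0 < C)%R /\ P C]].

(* The library's variance is E[(f - E f)^2]: it equals E[f^2] - (E f)^2 when f
   is square integrable (varianceE) and +oo for the other measurable f. *)
Definition poincare_constant (R : realType)
    (mu : probability (measurableTypeR R) R)
    (nu : {measure set (measurableTypeR R) -> \bar R}) : \bar R :=
  best_constant (fun C : R => forall f : R -> R, locally_lipschitz f ->
    'V_mu[f] <= C%:E * \int[nu]_x (local_slope f x ^+ 2)%:E).

(* Where f x = 0 the integrand is 0, because of the factor f x ^+ 2. *)
Definition modified_logsob_constant (R : realType) (q : R)
    (mu : probability (measurableTypeR R) R)
    (nu : {measure set (measurableTypeR R) -> \bar R}) : \bar R :=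
  best_constant (fun K : R => forall f : R -> R, locally_lipschitz f ->
    entropy mu (fun x => f x ^+ 2)%R <=
      K%:E * \int[nu]_x (Hq q (local_slope f x / f x) * f x ^+ 2)%:E).

(* n^(-1/(q-1)); the case distinction is needed because 0 `^ p = 0 for every
   p != 0, including p < 0. *)
Definition density_pow (R : realType) (q : R) (n : R -> R) (x : R) : \bar R :=
  if n x == 0%R then +oo else (n x `^ (- (q - 1)^-1))%:E.

(* p log (1/p) for p = mu A; it is 0 when p = 0. *)
Definition mass_log (R : realType) (mu : probability (measurableTypeR R) R)
    (A : set R) : \bar R :=
  (fine (mu A) * ln (fine (mu A))^-1)%:E.

Definition B_plus (R : realType) (q : R)
    (mu : probability (measurableTypeR R) R) (n : R -> R) (m : R) : \bar R :=
  ereal_sup [set mass_log mu `[x, +oo[%classic *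
      (\int[lebesgue_measure]_(t in `[m, x]) density_pow q n t) `^ (q - 1)
    | x in `]m, +oo[].

Definition B_minus (R : realType) (q : R)
    (mu : probability (measurableTypeR R) R) (n : R -> R) (m : R) : \bar R :=
  ereal_sup [set mass_log mu `]-oo, x]%classic *
      (\int[lebesgue_measure]_(t in `[x, m]) density_pow q n t) `^ (q - 1)
    | x in `]-oo, m[].

(* Main.v *)
(* With w = n^(-1/(q-1)), W(x) the integral of w between m and x, and
   I = \int H_q(f'/f) f^2 dnu, Hoelder's inequality gives
   (f b - f a)^q <= (\int_a^b w)^(q-1) \int_a^b |f'|^q dnu, so that W^(1-q) acts as
   a capacity.

   Upper bound. One may assume f >= 0 and \int f^2 dmu = 1. Poincare applied to
   max(f, e), e -> 0, controls \int (f - 1)^2 dmu and f(m) by C_P I, hence the part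
   of the entropy where f is at most T = (27/8) max(f(m), 4). Above T, follow the
   levels t_k = t_0 (3/2)^k and their first hitting points x_k to the right of m:
   the entropy carried by {f >= t_k} is at most t_k^2 p_k log(1/p_k) with
   p_k = mu([x_k, oo)), hence at most B t_k^2 W(x_k)^(1-q), and a discrete Hardy
   inequality sums these terms against the energies spent between consecutive levels,
   because W(x_k) dominates W(x_{k-1}) plus the weight of the last excursion before x_k.
   The left half-line is the right one for the reflected measure.

   Lower bounds. Linearising the inequality at f = 1 + e g, g bounded with bounded slope,
   gives 2 C_P <= kappa. For B, take f = V^(q-1) with V the integral of min(w, k) from m,
   frozen after a point x_1 <= x_0: the assumption on w gives eps V <= (q - 1) min(w, k)
   there, so that H_q(f'/f) is comparable with |f'/f|^q and the energy is at most a
   multiple of V(x_1)^(q-1), while the dual formula for the entropy bounds Ent(f^2)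
   from below. *)
Require Import Defs.
From HB Require Import structures.
From mathcomp Require Import all_boot all_order all_algebra.
From mathcomp Require Import all_classical all_reals all_analysis.
From mathcomp Require Import measurable_realfun.
From mathcomp Require Import ring lra.

Set Implicit Arguments.
Unset Strict Implicit.
Unset Printing Implicit Defensive.

Import Order.TTheory GRing.Theory Num.Theory.
Import numFieldNormedType.Exports.

Local Open Scope classical_set_scope.
Local Open Scope ring_scope.

(** * Locally Lipschitz functions and their slopes *)

(** The density may vanish, so w and W can be infinite, while W vanishes at m. A real-valued
    capacity is rightly 0 at W = +oo, but the power convention also makes it 0 at W = 0, where it
    should be infinite. Hence the recursion along the levels starts only after an excursion has made
    W positive, and the levels below t_0 (3/2)^3 are given up: this is the 27/8 in T.

    The ratio 3/2 multiplies t^2 by 9/4. Splitting the capacity with ratio 4/9 multiplies it by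
    (4/9)^q <= (4/9)^2, because q >= 2; so t^2 W^(1-q) contracts by 4/9 and the geometric series has
    sum 9/5. In the end 2^(q+1) majorises 27/10 (5/3)^q.

    In the lower bound w is truncated to make V Lipschitz. The comparison eps V <= (q - 1) min(w, k)
    can then fail only when V exceeds k (q - 1) / eps; freezing f before that is the purpose of
    x_1. *)

Lemma locally_lipschitzP (R : realType) (f : R -> R) :
  locally_lipschitz f <-> forall a b : R, exists2 L, 0 <= L &
    forall x y, a <= x <= b -> a <= y <= b -> `|f x - f y| <= L * `|x - y|.
Proof.
split=> [lf a b|lf [x y] _].
(* Covering the square, not the segment, gives one constant that also serves the pairs far from the
   diagonal. *)
- have cab : compact (`[a, b]%classic `*` `[a, b]%classic).
    by apply: compact_setX; exact: segment_compact.
  pose P (M : R) (p : R * R) := `|f p.1 - f p.2| <= M * `|p.1 - p.2|.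
  have : \forall M \near +oo, (`[a, b]%classic `*` `[a, b]%classic) `<=` P M.
    move/compact_near_coveringP : cab; apply=> -[x y] _.
    have := lf (x, y) (conj I I) => H.
    near (pinfty_nbhs R) => M0.
    have HM0 : M0.-lipschitz_on f (within (setT `*` setT) (nbhs (x, y))) by near: M0.
    have : \forall p \near nbhs (x, y), P M0 p.
      by move: HM0; rewrite /dominated_by /within /=; apply: filterS => p; apply; split.
    move=> HM1; exists ((fun p => P M0 p : Prop), [set M | M0 <= M]).
      by split => //=; exact: nbhs_pinfty_ge.
    move=> [p M] /= [] HM MM0; apply: le_trans HM _.
    by rewrite ler_wpM2r.
  move=> HP; near (pinfty_nbhs R) => M; exists M; first by near: M; exact: nbhs_pinfty_ge.
  move=> x y xab yab.
  have := near HP M; rewrite /P => H.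
  by apply: (H _ (x, y)) => //; split => /=; rewrite in_itv.
- pose a := Num.min x y - 1; pose b := Num.max x y + 1.
  have [L L0 HL] := lf a b.
  have nb (z : R) : a < z -> z < b -> \forall u \near nbhs z, a <= u <= b.
    move=> az zb; have : z \in `]a, b[ by rewrite in_itv/= az.
    move=> /near_in_itvoo; apply: filterS => u.
    by rewrite in_itv/= => /andP[au ub]; rewrite !ltW.
  have hx : \forall u \near nbhs x, a <= u <= b.
    apply: nb; rewrite /a /b.
      by rewrite ltrBlDr ltr_pwDr// ge_min lexx.
    by rewrite ltr_pwDr// le_max lexx.
  have hy : \forall u \near nbhs y, a <= u <= b.
    apply: nb; rewrite /a /b.
      by rewrite ltrBlDr ltr_pwDr// ge_min lexx orbT.
    by rewrite ltr_pwDr// le_max lexx orbT.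
  rewrite /lipschitz_on; near=> M; rewrite /dominated_by /within /self_sub /=; near=> p => _.
  apply: (@le_trans _ _ (L * `|p.1 - p.2|)); last first.
    by rewrite ler_wpM2r//; near: M; exact: nbhs_pinfty_ge.
  apply: HL.
    by near: p; exact: (@cvg_fst _ _ (nbhs x) (nbhs y) _ _ hx).
  by near: p; exact: (@cvg_snd _ _ (nbhs x) (nbhs y) _ _ hy).
Unshelve. all: by end_near. Qed.

Lemma locally_lipschitz_continuous (R : realType) (f : R -> R) :
  locally_lipschitz f -> continuous f.
Proof.
move=> /locally_lipschitzP lf x.
have [L L0 HL] := lf (x - 1) (x + 1).
apply/cvgrPdist_le => e e0; near=> y.
apply: le_trans (HL x y _ _) _.
- by rewrite gerBl ler01 lerDl ler01.
- have : `|x - y| <= 1 by near: y; apply: cvgr_dist_le.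
  by rewrite ler_distlC addrC => /andP[? ?]; apply/andP; split => //; lra.
- have : `|x - y| <= e / (L + 1).
    by near: y; apply: cvgr_dist_le => //; rewrite divr_gt0// ltr_wpDl.
  move=> /(ler_wpM2l L0) /le_trans; apply.
  by rewrite mulrCA ler_piMr ?(ltW e0)// ler_pdivrMr ?ltr_wpDl// mul1r lerDl.
Unshelve. all: by end_near. Qed.

Lemma measurable_locally_lipschitz (R : realType) (f : R -> R) :
  locally_lipschitz f -> measurable_fun [set: measurableTypeR R] f.
Proof.
by move=> lf; exact: continuous_measurable_fun (locally_lipschitz_continuous lf).
Qed.

(** The supremum is monotone in the radius, so it has a limit at 0, and a Lipschitz constant near x
    bounds it. This makes the [lim] and the [fine] of [local_slope] genuine. *)
Lemma local_slope_cvg (R : realType) (f : R -> R) (x : R) :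
  locally_lipschitz f -> exists2 s : R, 0 <= s & local_slope f x = s /\
   (ereal_sup [set (`|f x - f y| / `|x - y|)%:E
                       | y in [set y | (0 < `|x - y| <= r)%R]]
             @[r --> (0 : R)^'+] --> s%:E).
Proof.
move=> /locally_lipschitzP lf.
set F := fun r => ereal_sup _.
have Fnd : {in `]0, 1[ &, nondecreasing_fun F}.
  move=> r s _ _ rs; apply: ge_ereal_sup => _ [y /andP[y0 yr] <-].
  by apply: ereal_sup_ubound; exists y => //=; rewrite y0 (le_trans yr rs).
have h01 : (BRight (0 : R) < BLeft 1)%O by rewrite bnd_simp.
have /= Fc := @nondecreasing_at_right_cvge R F 0 (BLeft 1) h01 Fnd.
have [L L0 HL] := lf (x - 1) (x + 1).
have F0 r : 0 < r -> (0%:E <= F r)%E.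
  move=> r0; apply: (@le_trans _ _ (`|f x - f (x + r)| / `|x - (x + r)|)%:E).
    by rewrite lee_fin divr_ge0.
  apply: ereal_sup_ubound; exists (x + r) => //=.
  by rewrite opprD addNKr normrN gtr0_norm// r0 lexx.
have FL r : 0 < r < 1 -> (F r <= L%:E)%E.
  move=> /andP[r0 r1]; apply: ge_ereal_sup => _ [y /andP[y0 yr] <-].
  rewrite lee_fin ler_pdivrMr//; apply: HL.
    by rewrite gerBl ler01 lerDl ler01.
  have : `|x - y| <= 1 by rewrite (le_trans yr)// ltW.
  by rewrite ler_distlC addrC => /andP[? ?]; apply/andP; split => //; lra.
set l := ereal_inf _ in Fc.
have l0 : (0%:E <= l)%E.
  apply: le_ereal_inf_tmp => _ [r /=] + <-.
  by rewrite in_itv/= => /andP[r0 _]; exact: F0.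
have lL : (l <= L%:E)%E.
  have h : 0 < (2^-1 : R) < 1 by apply/andP; split; lra.
  apply: le_trans (FL _ h); apply: ereal_inf_lbound; exists 2^-1 => //=.
have lfin : l \is a fin_num.
  by rewrite ge0_fin_numE// (le_lt_trans lL)// ltry.
exists (fine l); first exact: fine_ge0.
split; last by rewrite fineK.
by rewrite /local_slope; congr fine; exact/cvg_lim.
Qed.

Lemma local_slope_ge0 (R : realType) (f : R -> R) (x : R) :
  locally_lipschitz f -> 0 <= local_slope f x.
Proof. by move=> lf; have [s s0 [-> _]] := local_slope_cvg x lf. Qed.

Lemma local_slope_near (R : realType) (f : R -> R) (x c : R) :
  locally_lipschitz f -> local_slope f x < c ->
  exists2 r, 0 < r & forall y, `|x - y| <= r -> `|f x - f y| <= c * `|x - y|.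
Proof.
move=> lf; have [s s0 [-> Fs]] := local_slope_cvg x lf => sc.
have : \forall r \near 0^'+, (ereal_sup [set (`|f x - f y| / `|x - y|)%:E
                       | y in [set y | (0 < `|x - y| <= r)%R]] < c%:E)%E.
  have h : nbhs s%:E [set y | (y < c%:E)%E].
    by apply: open_nbhs_nbhs; split; [exact: open_ereal_lt_ereal|rewrite /= lte_fin].
  exact: (Fs _ h).
move=> H; near (0 : R)^'+ => r; exists r => //.
move=> y; have [->|yx] := eqVneq x y; first by rewrite !subrr normr0 mulr0.
have xy0 : 0 < `|x - y| by rewrite normr_gt0 subr_eq0.
move=> xyr; rewrite -ler_pdivrMr// -lee_fin.
have /ltW : (ereal_sup [set (`|f x - f y| / `|x - y|)%:E
                       | y in [set y | (0 < `|x - y| <= r)%R]] < c%:E)%E.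
  by near: r; exact: H.
apply: le_trans.
by apply: ereal_sup_ubound; exists y => //=; rewrite xy0.
Unshelve. all: by end_near. Qed.

Lemma local_slope_le (R : realType) (f : R -> R) (x c r : R) :
  locally_lipschitz f -> 0 < r ->
  (forall y, 0 < `|x - y| <= r -> `|f x - f y| <= c * `|x - y|) ->
  local_slope f x <= c.
Proof.
move=> lf r0 H; have [s s0 [-> Fs]] := local_slope_cvg x lf.
rewrite -lee_fin; apply: (cvge_le _ Fs); near=> t.
apply: ge_ereal_sup => _ [y /andP[y0 yr] <-].
rewrite lee_fin ler_pdivrMr//; apply: H; rewrite y0 (le_trans yr)//.
by near: t; exact: nbhs_right_le.
Unshelve. all: by end_near. Qed.

(** Increments of [g] at [x] are compared with those of [f] at another point [x']. This single form
    yields the slopes of contractions of [f], of [f] composed with a clamp, and of the reflection of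
    [f]. *)
Lemma local_slope_le_transfer (R : realType) (f g : R -> R) (x x' c r : R) :
  locally_lipschitz f -> locally_lipschitz g -> 0 <= c -> 0 < r ->
  (forall y, `|x - y| <= r -> exists2 z, `|x' - z| <= `|x - y| &
     `|g x - g y| <= c * `|f x' - f z|) ->
  local_slope g x <= c * local_slope f x'.
Proof.
move=> lf lg c0 r0 H; apply/ler_addgt0Pr => e e0.
pose d := e / (c + 1).
have d0 : 0 < d by rewrite divr_gt0// ltr_wpDl.
have [t t0 Ht] := local_slope_near lf (ltr_pwDr d0 (lexx (local_slope f x'))).
apply: (@le_trans _ _ (c * (local_slope f x' + d))); last first.
  rewrite mulrDr lerD2l /d mulrA ler_pdivrMr ?ltr_wpDl//.
  by rewrite mulrC ler_wpM2l ?(ltW e0)// lerDl.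
apply: (@local_slope_le _ _ _ _ (Num.min r t)) => //.
  by rewrite lt_min r0.
move=> y /andP[y0]; rewrite le_min => /andP[yr yt].
have [z xz gz] := H _ yr.
apply: (le_trans gz); rewrite -mulrA ler_wpM2l//.
apply: (le_trans (Ht _ (le_trans xz yt))).
by rewrite ler_wpM2l// addr_ge0 ?(ltW d0)//; exact: local_slope_ge0.
Qed.

Lemma locally_lipschitz_transfer (R : realType) (f g h : R -> R) (c : R) :
  locally_lipschitz f -> 0 <= c ->
  (forall a b, exists a' b', forall x, a <= x <= b -> a' <= h x <= b') ->
  (forall x y, `|h x - h y| <= `|x - y|) ->
  (forall x y, `|g x - g y| <= c * `|f (h x) - f (h y)|) ->
  locally_lipschitz g.
Proof.
move=> /locally_lipschitzP lf c0 hab h1 gf; apply/locally_lipschitzP => a b.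
have [a' [b' ab']] := hab a b; have [L L0 HL] := lf a' b'.
exists (c * L); first exact: mulr_ge0.
move=> x y xab yab; apply: (le_trans (gf _ _)); rewrite -mulrA ler_wpM2l//.
apply: (le_trans (HL _ _ (ab' _ xab) (ab' _ yab))).
by rewrite ler_wpM2l.
Qed.

Lemma locally_lipschitz_dominated (R : realType) (f g : R -> R) (c : R) :
  locally_lipschitz f -> 0 <= c ->
  (forall x y, `|g x - g y| <= c * `|f x - f y|) -> locally_lipschitz g.
Proof.
move=> lf c0 gf; apply: (locally_lipschitz_transfer (h := id) lf c0) => //.
by move=> a b; exists a, b.
Qed.

Lemma local_slope_dominated (R : realType) (f g : R -> R) (c : R) (x : R) :
  locally_lipschitz f -> 0 <= c ->
  (forall x y, `|g x - g y| <= c * `|f x - f y|) ->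
  local_slope g x <= c * local_slope f x.
Proof.
move=> lf c0 gf; apply: (@local_slope_le_transfer _ _ _ _ _ _ 1) => //.
  exact: locally_lipschitz_dominated lf c0 gf.
by move=> y _; exists y.
Qed.

Lemma local_slope_near_cst (R : realType) (g : R -> R) (x r : R) :
  locally_lipschitz g -> 0 < r -> (forall y, `|x - y| <= r -> g y = g x) ->
  local_slope g x = 0.
Proof.
move=> lg r0 H; apply/eqP; rewrite eq_le local_slope_ge0// andbT.
rewrite -(mul0r (local_slope g x)).
apply: (@local_slope_le_transfer _ _ _ _ _ _ r) => // y yr.
by exists y => //; rewrite (H _ yr) subrr normr0 mul0r.
Qed.

Lemma locally_lipschitzN (R : realType) (f : R -> R) :
  locally_lipschitz f -> locally_lipschitz (fun x => f (- x)).
Proof.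
move=> lf; apply: (locally_lipschitz_transfer (h := -%R) lf ler01).
- by move=> a b; exists (- b), (- a) => x /andP[ax xb]; rewrite !lerN2 ax xb.
- by move=> x y; rewrite -opprD normrN.
- by move=> x y; rewrite mul1r.
Qed.

Lemma local_slopeN (R : realType) (f : R -> R) (x : R) :
  locally_lipschitz f -> local_slope (fun x => f (- x)) x = local_slope f (- x).
Proof.
move=> lf; have lg := locally_lipschitzN lf.
apply/eqP; rewrite eq_le; apply/andP; split.
- rewrite -[leRHS]mul1r; apply: (@local_slope_le_transfer _ _ _ _ _ _ 1) => // y _.
  by exists (- y); rewrite ?mul1r// -opprD normrN.
- rewrite -[leRHS]mul1r; apply: (@local_slope_le_transfer _ _ _ _ _ _ 1) => // y _.
  by exists (- y); rewrite ?mul1r ?opprK// -opprD normrN.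
Qed.

(** * Clamped functions and measurability of the slope *)

Definition clamp (R : realType) (a b x : R) : R := Num.max a (Num.min x b).

Lemma clamp_itv (R : realType) (a b x : R) : a <= b -> a <= clamp a b x <= b.
Proof.
by move=> ab; rewrite /clamp le_max lexx ge_max ab ge_min lexx orbT.
Qed.

Lemma clamp_id (R : realType) (a b x : R) : a <= x <= b -> clamp a b x = x.
Proof. by move=> /andP[ax xb]; rewrite /clamp min_l// max_r. Qed.

Lemma clamp_lo (R : realType) (a b x : R) : x <= a -> clamp a b x = a.
Proof. by move=> xa; rewrite /clamp max_l// ge_min xa. Qed.

Lemma clamp_hi (R : realType) (a b x : R) : a <= b -> b <= x -> clamp a b x = b.
Proof. by move=> ab bx; rewrite /clamp min_r// max_r. Qed.

Lemma clamp_contr (R : realType) (a b x y : R) :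
  `|clamp a b x - clamp a b y| <= `|x - y|.
Proof.
wlog xy : x y / x <= y.
  by move=> H; case: (leP x y) => [/H//|/ltW/H]; rewrite distrC (distrC y).
rewrite [leRHS]distrC (@ger0_norm _ (y - x)) ?subr_ge0//.
rewrite distrC /clamp ger0_norm; last first.
  rewrite subr_ge0 ge_max !le_max lexx /=; apply/orP; right.
  by rewrite le_min !ge_min xy lexx orbT.
by rewrite /Order.max /Order.min; repeat case: ifP; lra.
Qed.

Lemma locally_lipschitz_clamp (R : realType) (f : R -> R) (a b : R) : a <= b ->
  locally_lipschitz f -> locally_lipschitz (f \o clamp a b).
Proof.
move=> ab lf; apply: (locally_lipschitz_transfer (h := clamp a b) lf ler01).
- by move=> u v; exists a, b => x _; exact: clamp_itv.
- by move=> x y; exact: clamp_contr.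
- by move=> x y; rewrite mul1r.
Qed.

Lemma local_slope_clamp_le (R : realType) (f : R -> R) (a b x : R) : a <= b ->
  locally_lipschitz f -> a <= x <= b ->
  local_slope (f \o clamp a b) x <= local_slope f x.
Proof.
move=> ab lf xab; rewrite -[leRHS]mul1r.
apply: (@local_slope_le_transfer _ _ _ _ _ _ 1) => //.
  exact: locally_lipschitz_clamp.
move=> y _; exists (clamp a b y); rewrite ?mul1r /= ?(clamp_id xab)//.
by rewrite -{1}(clamp_id xab); exact: clamp_contr.
Qed.

Lemma local_slope_clamp_out (R : realType) (f : R -> R) (a b x : R) : a <= b ->
  locally_lipschitz (f \o clamp a b) -> ~~ (a <= x <= b) ->
  local_slope (f \o clamp a b) x = 0.
Proof.
move=> ab lg; rewrite negb_and -!ltNge => /orP[xa|bx].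
- apply: (@local_slope_near_cst _ _ _ ((a - x) / 2)) => //.
    by rewrite divr_gt0// subr_gt0.
  move=> y; rewrite ler_distlC => /andP[_ yx] /=.
  by rewrite !clamp_lo//; lra.
- apply: (@local_slope_near_cst _ _ _ ((x - b) / 2)) => //.
    by rewrite divr_gt0// subr_gt0.
  move=> y; rewrite ler_distlC => /andP[xy _] /=.
  by rewrite !clamp_hi//; lra.
Qed.

(** The slope is below [c] exactly when, for some n and k, all increments by [h] with |h| <= 1/(k+1)
    are at most (c - 1/(n+1)) |h|. The intersection over [h] is uncountable, so continuity of [f] is
    used to make it closed. *)
Lemma measurable_local_slope (R : realType) (f : R -> R) :
  locally_lipschitz f ->
  measurable_fun [set: measurableTypeR R] (local_slope f : _ -> measurableTypeR R).
Proof.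
move=> lf; have cf := locally_lipschitz_continuous lf.
move=> mD; apply: (measurability _ (RGenInftyO.measurableE R)) => //.
move=> /= _ [_ [c ->]] <-; apply: measurableI => //.
pose E (n k : nat) := \bigcap_(h in [set h : R | `|h| <= k.+1%:R^-1])
  [set x | `|f x - f (x + h)| <= (c - n.+1%:R^-1) * `|h|].
rewrite (_ : _ @^-1` _ = \bigcup_n \bigcup_k E n k).
  apply: bigcup_measurable => n _; apply: bigcup_measurable => k _.
  apply: closed_measurable; apply: closed_bigI => h _.
  have cfh : continuous (fun x => `|f x - f (x + h)|).
    move=> x; apply: (@continuous_comp _ _ _ (fun x => f x - f (x + h)) Num.norm); last exact: norm_continuous.
    apply: continuousB; first exact: cf.
    apply: (continuous_comp (f := fun x => x + h)); last exact: cf.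
    by apply: continuousD => //; exact: cst_continuous.
  apply: (@preimage_closed _ _ (fun x => `|f x - f (x + h)|) [set t | t <= _]); last exact: closed_le.
  by move=> x _; exact: cfh.
apply/seteqP; split=> x /=; rewrite in_itv/=.
  move=> sc.
  have d0 : 0 < (c - local_slope f x) / 2 by rewrite divr_gt0// subr_gt0.
  near \oo => n.
  have nd : n.+1%:R^-1 < (c - local_slope f x) / 2.
    by near: n; exact: (near_infty_natSinv_lt (PosNum d0)).
  have [r r0 Hr] : exists2 r, 0 < r & forall y, `|x - y| <= r -> `|f x - f y| <= (c - n.+1%:R^-1) * `|x - y|.
    apply: local_slope_near => //; move: nd sc; set i := _^-1; set t := local_slope f x; lra.
  near \oo => k.
  exists n => //; exists k => // h /= hk.
  have := Hr (x + h); rewrite opprD addNKr normrN; apply.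
  apply: (le_trans hk); apply: ltW; near: k.
  exact: (near_infty_natSinv_lt (PosNum r0)).
move=> [n _ [k _ Ex]].
apply: (@le_lt_trans _ _ (c - n.+1%:R^-1)); last first.
  by rewrite ltrBlDr ltrDl invr_gt0.
apply: (@local_slope_le _ _ _ _ k.+1%:R^-1) => //.
move=> y /andP[_ yk]; have := Ex (y - x).
by rewrite /= (addrC x) subrK (distrC y x); exact.
Unshelve. all: by end_near. Qed.

(** * Integrals of increments and of the slope *)

Lemma continuous_increment (R : realType) (g : R -> R) (h : R) :
  continuous g -> continuous (fun x => g (x + h) - g x).
Proof.
move=> cg x; apply: continuousB; last exact: cg.
apply: (continuous_comp (f := fun x => x + h)); last exact: cg.
by apply: continuousD => //; exact: cst_continuous.
Qed.

Lemma preimage_shift_itv (R : realType) (h : R) (b1 b2 : bool) (a b : R) :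
  (fun x : R => x + h) @^-1` [set` Interval (BSide b1 (a + h)) (BSide b2 (b + h))]
   = [set` Interval (BSide b1 a) (BSide b2 b)].
Proof.
by apply/seteqP; split => x /=; case: b1; case: b2; rewrite !in_itv/= ?lerD2r ?ltrD2r.
Qed.

Lemma lebesgue_measure_shift (R : realType) (h : R) (A : set R) : measurable A ->
  pushforward lebesgue_measure (fun x : R => (x + h : measurableTypeR R)) A = lebesgue_measure A.
Proof.
have mh : measurable_fun [set: R] (fun x : R => (x + h : measurableTypeR R)).
  exact: measurable_funD.
move=> mA; apply/esym/lebesgue_measure_unique => //= _ [[a b]] _ <-.
have := preimage_shift_itv h false false (a - h) (b - h); rewrite !subrK => H.
rewrite /pushforward /= H.
rewrite !lebesgue_measure_itv/= !lte_fin ltrD2r -EFinB.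
by congr (if _ then _ else _); rewrite -EFinD; congr EFin; ring.
Qed.

Lemma continuous_itv_integrable (R : realType) (g : R -> R) (a b : R) (b1 b2 : bool) :
  continuous g -> lebesgue_measure.-integrable [set` Interval (BSide b1 a) (BSide b2 b)] (EFin \o g).
Proof.
move=> cg; have : lebesgue_measure.-integrable `[a, b] (EFin \o g); last first.
  apply: integrableS => //.
  by apply: subset_itv; rewrite bnd_simp; case: b1; case: b2.
apply: continuous_compact_integrable; first exact: segment_compact.
exact: continuous_subspaceT.
Qed.

Lemma Rintegral_shift (R : realType) (g : R -> R) (a b h : R) : continuous g ->
  (\int[lebesgue_measure]_(x in `[a, b]) g (x + h) =
  \int[lebesgue_measure]_(x in `[a + h, b + h]) g x)%R.
Proof.
move=> cg; rewrite /Rintegral; congr fine.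
have mh : measurable_fun [set: R] (fun x : R => (x + h : measurableTypeR R)).
  exact: measurable_funD.
transitivity (\int[pushforward lebesgue_measure (fun x : R => (x + h : measurableTypeR R)%R)]_(x in `[(a + h)%R, (b + h)%R]) (g x)%:E)%E.
  rewrite integral_pushforward//=.
  - by rewrite preimage_shift_itv.
  - by apply/measurable_EFinP; exact: continuous_measurable_fun.
  - rewrite preimage_shift_itv.
    apply: (continuous_itv_integrable (g := g \o (fun x => x + h)) a b true false).
    move=> x; apply: continuous_comp; last exact: cg.
    by apply: continuousD => //; exact: cst_continuous.
by apply: eq_measure_integral => //= A mA _; exact: lebesgue_measure_shift.
Qed.

Lemma Rintegral_increment (R : realType) (g : R -> R) (a b h : R) :
  continuous g -> a <= b -> 0 <= h ->
  (\int[lebesgue_measure]_(x in `[a, b]) (g (x + h) - g x) =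
  \int[lebesgue_measure]_(x in `[b, b + h]) g x -
  \int[lebesgue_measure]_(x in `[a, a + h]) g x)%R.
Proof.
move=> cg ab h0.
have ig u v b1 b2 := continuous_itv_integrable u v b1 b2 cg.
have ish : lebesgue_measure.-integrable `[a, b] (EFin \o (fun x => g (x + h))).
  apply: (continuous_itv_integrable (g := g \o (fun x => x + h)) a b true false).
  move=> x; apply: continuous_comp; last exact: cg.
  by apply: continuousD => //; exact: cst_continuous.
rewrite RintegralB//.
rewrite Rintegral_shift//.
have H1 := @Rintegral_itvB R g (BLeft a) (BRight (b + h)) (a + h) (ig _ _ _ _).
have H2 := @Rintegral_itvB R g (BLeft a) (BRight (b + h)) b (ig _ _ _ _).
rewrite (Rintegral_itv_obnd_cbnd (ig _ _ false false)) in H1.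
rewrite (Rintegral_itv_obnd_cbnd (ig _ _ false false)) in H2.
rewrite -H1 -?H2 ?bnd_simp ?lerD2r ?lerDl ?ler_wpDr//.
by ring.
Qed.

Lemma Rintegral_increment_ge (R : realType) (g : R -> R) (a b h c d : R) :
  continuous g -> a <= b -> 0 <= h ->
  (forall x, b <= x <= b + h -> c <= g x) -> (forall x, a <= x <= a + h -> g x <= d) ->
  (h * (c - d) <= \int[lebesgue_measure]_(x in `[a, b]) (g (x + h) - g x))%R.
Proof.
move=> cg ab h0 gc gd; rewrite Rintegral_increment//.
have ig u v := continuous_itv_integrable u v true false cg.
have ic u v (e : R) := continuous_itv_integrable u v true false (@cst_continuous R R e).
have lh u (e : R) : (\int[lebesgue_measure]_(x in `[u, (u + h)%R]) e)%R = e * h.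
  rewrite Rintegral_cst//=. rewrite lebesgue_measure_itv/= lte_fin ltrDl.
  case: ltgtP h0 => //= [h0 _|<- _]; first by rewrite /= addrC addKr.
  by rewrite mulr0.
rewrite mulrBr lerB//.
- rewrite mulrC -(lh b c); apply: le_Rintegral => //.
- rewrite mulrC -(lh a d); apply: le_Rintegral => //.
Qed.

Lemma Rintegral_increment_le (R : realType) (g : R -> R) (a b h c d : R) :
  continuous g -> a <= b -> 0 <= h ->
  (forall x, b <= x <= b + h -> g x <= c) -> (forall x, a <= x <= a + h -> d <= g x) ->
  (\int[lebesgue_measure]_(x in `[a, b]) (g (x + h) - g x) <= h * (c - d))%R.
Proof.
move=> cg ab h0 gc gd.
have cNg : continuous (fun x => - g x).
  by move=> x; apply: continuousN; exact: cg.
have := @Rintegral_increment_ge R (fun x => - g x) a b h (- c) (- d) cNg ab h0.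
rewrite (_ : (\int[lebesgue_measure]_(x in `[a, b]) (- g (x + h) - - g x))%R =
  - (\int[lebesgue_measure]_(x in `[a, b]) (g (x + h) - g x))%R); last first.
  rewrite -[RHS]mulN1r -RintegralZl//.
    by apply: eq_Rintegral => x _; ring.
  exact: (continuous_itv_integrable (g := fun x => g (x + h) - g x) a b true false (@continuous_increment R g h cg)).
move=> H; rewrite -lerN2 -mulrN opprB; apply: le_trans (H _ _).
- by rewrite opprK addrC.
- by move=> x /gc; rewrite lerN2.
- by move=> x /gd; rewrite lerN2.
Qed.

Lemma bounded_itv_integrable (R : realType) (g : R -> R) (a b M : R) :
  measurable_fun (`[a, b]%classic : set (measurableTypeR R)) (g : _ -> measurableTypeR R) ->
  (forall x, a <= x <= b -> `|g x| <= M) ->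
  lebesgue_measure.-integrable `[a, b] (EFin \o g).
Proof.
move=> mg gM.
have [ab|ba] := leP a b; last first.
  by rewrite set_itv_ge ?bnd_simp -?ltNge//; exact: integrable_set0.
have iM := continuous_itv_integrable a b true false (@cst_continuous R R M).
apply: le_integrable iM => //; first exact/measurable_EFinP.
move=> x /=; rewrite in_itv/= => /gM; rewrite lee_fin => /le_trans; apply.
exact: ler_norm.
Qed.

Lemma local_slope_bounded (R : realType) (f : R -> R) (a b : R) :
  locally_lipschitz f -> exists2 L, 0 <= L &
    (forall x y, a <= x <= b -> a <= y <= b -> `|f x - f y| <= L * `|x - y|) /\
    (forall x, a <= x <= b -> local_slope f x <= L).
Proof.
move=> lf; have [L L0 HL] := (locally_lipschitzP f).1 lf (a - 1) (b + 1).
exists L => //; split=> [x y /andP[ax xb] /andP[ay yb]|x /andP[ax xb]].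
  by apply: HL; apply/andP; split; lra.
apply: (@local_slope_le _ _ _ _ 1) => // y /andP[_].
rewrite ler_distlC => /andP[xy yx].
by apply: HL; apply/andP; split; lra.
Qed.

(** The integral of a difference quotient telescopes to averages of [f] near the two endpoints,
    while the excess of the quotient over the slope tends to 0 boundedly. Dominated convergence then
    replaces the fundamental theorem of calculus. *)
Lemma ge0_integral_le_slope (R : realType) (f : R -> R) (a b : R) :
  locally_lipschitz f -> a <= b ->
  ((f b - f a)%:E <= \int[lebesgue_measure]_(x in `[a, b]) (local_slope f x)%:E)%E.
Proof.
move=> lf ab.
(* To the right of [b] the clamped function is constant, so the average over [b, b + h] is exactly
   [f b]; only the average at [a] costs an error, at most L h. *)
pose g := f \o clamp a b.
have lg : locally_lipschitz g by exact: locally_lipschitz_clamp.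
have cg := locally_lipschitz_continuous lg.
have [L L0 [HL sL]] := local_slope_bounded a (b + 1) lg.
have sgL x : a <= x <= b -> local_slope g x <= L.
  by move=> /andP[ax xb]; apply: sL; apply/andP; split; lra.
have mab : measurable (`[a, b]%classic : set (measurableTypeR R)) by [].
have msg : measurable_fun `[a, b] (local_slope g : _ -> measurableTypeR R).
  by apply: measurable_funTS; exact: measurable_local_slope.
have isg : lebesgue_measure.-integrable `[a, b] (EFin \o (local_slope g)).
  apply: (@bounded_itv_integrable _ _ _ _ L) => // x xab.
  by rewrite ger0_norm ?local_slope_ge0// sgL.
pose F n x := n.+1%:R * (g (x + n.+1%:R^-1) - g x).
(* The quotients [F n] need not converge; only their positive excess over the slope is known to
   vanish in the limit. *)
pose e n x := Num.max 0 (F n x - local_slope g x).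
have cd n := @continuous_increment R g n.+1%:R^-1 cg.
have cF n : continuous (F n).
  by move=> x; apply: cvgM; [exact: cvg_cst|exact: cd].
have me n : measurable_fun `[a, b] (e n : measurableTypeR R -> measurableTypeR R).
  apply: measurable_maxr; first exact: measurable_cst.
  apply: measurable_funB => //.
  by apply: measurable_funTS; exact: continuous_measurable_fun.
have FL n x : a <= x <= b -> `|F n x| <= L.
  move=> /andP[ax xb]; rewrite /F normrM ger0_norm//.
  have h0 : 0 < (n.+1%:R^-1 : R) by rewrite invr_gt0.
  have h1 : (n.+1%:R^-1 : R) <= 1 by rewrite invf_le1// ler1n.
  rewrite mulrC -ler_pdivlMr//; move: h0 h1; set h := _^-1 => h0 h1.
  apply: (le_trans (HL _ _ _ _)).
  - by apply/andP; split; lra.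
  - by apply/andP; split; lra.
  - by rewrite addrAC subrr add0r gtr0_norm.
have e0 x : a <= x <= b -> e n x @[n --> \oo] --> 0.
  move=> xab; apply/cvgrPdist_le => d d0.
  have [r r0 Hr] := local_slope_near lg (ltr_pwDr d0 (lexx (local_slope g x))).
  near=> n; rewrite sub0r normrN ger0_norm ?le_max ?lexx//.
  rewrite ge_max (ltW d0)/= lerBlDr addrC.
  have h0 : 0 < (n.+1%:R^-1 : R) by rewrite invr_gt0.
  have := Hr (x + n.+1%:R^-1); rewrite opprD addNKr normrN gtr0_norm//.
  have nr : n.+1%:R^-1 <= r.
    by apply: ltW; near: n; exact: (near_infty_natSinv_lt (PosNum r0)).
  move=> /(_ nr); rewrite -ler_pdivrMr// invrK mulrC; apply: le_trans.
  by rewrite /F ler_wpM2l// distrC ler_norm.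
have eL n x : a <= x <= b -> `|e n x| <= L.
  move=> xab; rewrite ger0_norm ?le_max ?lexx// ge_max L0/=.
  rewrite lerBlDr (le_trans (ler_norm _))// (le_trans (FL n _ xab))// lerDl.
  exact: local_slope_ge0.
have ie n : lebesgue_measure.-integrable `[a, b] (EFin \o e n).
  by apply: (@bounded_itv_integrable _ _ _ _ L); [exact: me|exact: eL].
have iF n : lebesgue_measure.-integrable `[a, b] (EFin \o F n).
  exact: (continuous_itv_integrable a b true false (cF n)).
have ce : ((\int[lebesgue_measure]_(x in `[a, b]) e n x)%R @[n --> \oo] --> 0).
  have := @dominated_convergence _ _ _ lebesgue_measure _ mab (fun n x => (e n x)%:E) (cst 0%E) (cst L%:E).
  case.
  - by move=> n; apply/measurable_EFinP; exact: me.
  - exact: measurable_cst.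
  - apply: aeW => x /=; rewrite in_itv/= => xab.
    by apply: cvg_EFin; [exact: nearW|exact: e0].
  - exact: (continuous_itv_integrable a b true false (@cst_continuous R R L)).
  - by apply: aeW => x n /=; rewrite in_itv/= => xab; rewrite lee_fin eL.
  - move=> _ _; rewrite integral0 => /fine_cvg; exact.
have main n : f b - f a - L * n.+1%:R^-1 <=
    (\int[lebesgue_measure]_(x in `[a, b]) local_slope g x)%R +
    (\int[lebesgue_measure]_(x in `[a, b]) e n x)%R.
  rewrite -RintegralD//.
  apply: (@le_trans _ _ (\int[lebesgue_measure]_(x in `[a, b]) F n x)%R); last first.
    apply: le_Rintegral => //.
      by rewrite (_ : EFin \o _ = (EFin \o local_slope g) \+ (EFin \o e n))%E//; exact: integrableD.
    by move=> x _; rewrite addrC -lerBlDr /e le_max lexx orbT.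
  rewrite RintegralZl//; last exact: (continuous_itv_integrable a b true false (cd n)).
  have h0 : 0 < (n.+1%:R^-1 : R) by rewrite invr_gt0.
  have h1 : (n.+1%:R^-1 : R) <= 1 by rewrite invf_le1// ler1n.
  rewrite -ler_pdivrMl//.
  have -> : f b - f a - L * n.+1%:R^-1 = f b - (f a + L * n.+1%:R^-1) by ring.
  move: h0 h1; set h := _^-1 => h0 h1; apply: Rintegral_increment_ge => //; first exact: ltW.
    by move=> x /andP[bx _]; rewrite /g /= clamp_hi.
  move=> x /andP[ax xa]; have := HL x a.
  rewrite ax lexx/= => /(_ _ _)/(le_trans (ler_norm _)).
  rewrite {2}/g /= clamp_lo// lerBlDl => H; apply: (le_trans (H _ _)); [lra|lra|].
  by rewrite lerD2l ler_wpM2l// ger0_norm; lra.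
have fs : f b - f a <= (\int[lebesgue_measure]_(x in `[a, b]) local_slope g x)%R.
  apply/ler_addgt0Pr => d d0.
  have d3 : 0 < d / 2 / (L + 1) by rewrite !divr_gt0// ltr_wpDl.
  near \oo => n.
  have H1 : `|\int[lebesgue_measure]_(x in `[a, b]) e n x|%R <= d / 2.
    rewrite -normrN -sub0r; near: n; move/cvgrPdist_le : ce; apply; exact: divr_gt0.
  have H2 : n.+1%:R^-1 < d / 2 / (L + 1).
    by near: n; exact: (near_infty_natSinv_lt (PosNum d3)).
  have H3 : L * n.+1%:R^-1 <= d / 2.
    move: H2; rewrite ltr_pdivlMr ?ltr_wpDl// => /ltW; apply: le_trans.
    by rewrite mulrC ler_wpM2l// lerDl.
  move: (main n) (ler_normlW H1) H3.
  by set u := L * _; set v := Rintegral _ _ _; set w := Rintegral _ _ _; lra.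
apply: (@le_trans _ _ (\int[lebesgue_measure]_(x in `[a, b]) (local_slope g x)%:E)%E); last first.
  apply: ge0_le_integral => //=.
  - by move=> x _; rewrite lee_fin local_slope_ge0.
  - exact/measurable_EFinP.
  - by apply/measurable_EFinP/measurable_funTS; exact: measurable_local_slope.
  - by move=> x; rewrite in_itv/= => xab; rewrite lee_fin; exact: local_slope_clamp_le.
rewrite -lee_fin in fs; apply: (le_trans fs).
by rewrite /Rintegral fineK//; exact: integrable_fin_num.
Unshelve. all: by end_near. Qed.

(** * Capacities *)

Lemma ln_le_sub1 (R : realType) (x : R) : 0 < x -> ln x <= x - 1.
Proof.
move=> x0; have := @le_ln1Dx R (x - 1); rewrite [1 + _]addrC subrK; apply; lra.
Qed.

Lemma powR_expR (R : realType) (x p : R) : 0 < x -> x `^ p = expR (p * ln x).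
Proof. by move=> x0; rewrite /powR gt_eqF. Qed.

Lemma powR_tangent (R : realType) (p z : R) : 0 <= p -> 0 < z ->
  1 + p - p * z <= z `^ (- p).
Proof.
move=> p0 z0; rewrite powR_expR//.
apply: le_trans (expR_ge1Dx _); rewrite -addrA lerD2l mulNr -[leLHS]opprK lerN2.
have -> : - (p - p * z) = p * (z - 1) by ring.
by rewrite ler_wpM2l//; exact: ln_le_sub1.
Qed.

(** Convexity of z^(1-q) at the combination x + y = r (x/r) + (1 - r) (y/(1 - r)). Each term is
    bounded below by the tangent line at x + y, and the two linear parts add up to q - (q - 1) =
    1. *)
Lemma powR_convex_split (R : realType) (q r x y : R) :
  1 <= q -> 0 < r < 1 -> 0 < x -> 0 < y ->
  (x + y) `^ (1 - q) <= r `^ q * x `^ (1 - q) + (1 - r) `^ q * y `^ (1 - q).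
Proof.
move=> q1 /andP[r0 r1] x0 y0.
have s0 : 0 < x + y by rewrite addr_gt0.
have r10 : 0 < 1 - r by rewrite subr_gt0.
have key u z : 0 < u -> 0 < z ->
    u `^ q * z `^ (1 - q) >= (x + y) `^ (1 - q) * (u * (1 + (q - 1)) - (q - 1) * (z / (x + y))).
  move=> u0 z0; pose v := z / (u * (x + y)).
  have v0 : 0 < v by rewrite divr_gt0// mulr_gt0.
  have -> : z = v * (u * (x + y)) by rewrite /v mulfVK// gt_eqF// mulr_gt0.
  have h : u * (x + y) != 0 by rewrite gt_eqF// mulr_gt0.
  have u0' := ltW u0; have v0' := ltW v0; have s0' := ltW s0.
  rewrite (powRM _ v0' (mulr_ge0 u0' s0')) (powRM _ u0' s0').
  have -> : u `^ q * (v `^ (1 - q) * (u `^ (1 - q) * (x + y) `^ (1 - q))) =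
     (x + y) `^ (1 - q) * (u * v `^ (1 - q)).
    transitivity ((x + y) `^ (1 - q) * ((u `^ q * u `^ (1 - q)) * v `^ (1 - q))).
      by ring.
    rewrite -powRD ?(gt_eqF u0) ?implybT//.
    by rewrite (_ : q + (1 - q) = 1) ?powRr1//; ring.
  rewrite ler_wpM2l ?powR_ge0//.
  have -> : v * (u * (x + y)) / (x + y) = u * v by field; rewrite gt_eqF.
  have := @powR_tangent R (q - 1) v; rewrite opprB subr_ge0 => /(_ q1 v0).
  by move=> /(ler_wpM2l (ltW u0)); apply: le_trans; rewrite le_eqVlt; apply/orP; left; apply/eqP; ring.
apply: le_trans (lerD (key r x r0 x0) (key (1 - r) y r10 y0)).
rewrite -mulrDr -{1}(mulr1 ((x + y) `^ (1 - q))) ler_wpM2l ?powR_ge0//.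
have -> : r * (1 + (q - 1)) - (q - 1) * (x / (x + y)) +
   ((1 - r) * (1 + (q - 1)) - (q - 1) * (y / (x + y))) = 1; last by [].
by field; rewrite gt_eqF.
Qed.

Lemma powR_young1 (R : realType) (q z : R) : 1 < q -> 0 <= z ->
  z <= z `^ q / q + (q - 1) / q.
Proof.
move=> q1 z0; have q0 : 0 < q by rewrite (lt_trans ltr01).
have := @conjugate_powR R z 1 q (q / (q - 1)) z0 ler01 q0.
rewrite divr_gt0// ?subr_gt0// mulr1 powR1 div1r invf_div; apply => //.
by field; rewrite gt_eqF.
Qed.

Lemma density_pow_gt0 (R : realType) (q : R) (n : R -> R) x :
  0 <= n x -> (0%:E < density_pow q n x)%E.
Proof.
move=> n0; rewrite /density_pow; case: eqP => [nx|/eqP nx]; first by rewrite ltry.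
by rewrite lte_fin powR_gt0// lt_def nx.
Qed.

Lemma measurable_density_pow (R : realType) (q : R) (n : R -> R) :
  measurable_fun [set: measurableTypeR R] n ->
  measurable_fun [set: measurableTypeR R] (density_pow q n).
Proof.
move=> mn; rewrite /density_pow.
apply: measurable_fun_ifT => //.
- by apply: measurable_fun_eqr => //; exact: measurable_cst.
- apply/measurable_EFinP; apply: (measurableT_comp (f := fun x => x `^ (- (q - 1)^-1))) => //.
Qed.

(* Young's inequality, with the weight arranged so that optimising [tau] gives
   Hoelder's inequality for the pair n, n^(-1/(q-1)). *)
Lemma young_density (R : realType) (q tau s : R) (n : R -> R) (x : R) :
  1 < q -> 0 < tau -> 0 <= s -> 0 <= n x ->
  (s%:E <= (tau `^ (q - 1) / q)%:E * (s `^ q * n x)%:E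
    + ((q - 1) / (q * tau))%:E * density_pow q n x)%E.
Proof.
move=> q1 tau0 s0 n0; have q0 : 0 < q by rewrite (lt_trans ltr01).
have q10 : 0 < q - 1 by rewrite subr_gt0.
rewrite /density_pow; case: eqP => [nx|/eqP nx].
  rewrite gt0_muley ?lte_fin ?divr_gt0 ?mulr_gt0// nx mulr0 mule0 add0e.
  by rewrite leey.
have {n0} n0 : 0 < n x by rewrite lt_def nx.
rewrite -!EFinM -EFinD lee_fin.
set w := n x `^ _; have w0 : 0 < w by rewrite powR_gt0.
have nw : n x = w `^ (1 - q).
  rewrite /w -powRrM -[1 - q]opprB mulrNN mulVf ?gt_eqF// powRr1//; exact: ltW.
pose b := w / tau; have b0 : 0 < b by rewrite divr_gt0.
have := @powR_young1 R q (s / b) q1 (divr_ge0 s0 (ltW b0)).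
rewrite ler_pdivrMr// mulrDl => /le_trans; apply.
have bq : b `^ q != 0 by rewrite gt_eqF// powR_gt0.
have -> : (s / b) `^ q = s `^ q / b `^ q.
  rewrite powRM ?invr_ge0 ?(ltW b0)//; congr (_ * _).
  by rewrite -(powR_inv1 (ltW b0)) -powRrM mulrC powRrM powR_inv1 ?powR_ge0.
have E : tau `^ (q - 1) * n x = b / b `^ q.
  rewrite nw -[X in X / _](powRr1 (ltW b0)) -powRB ?(gt_eqF b0) ?implybT//.
  rewrite /b powRM ?invr_ge0 ?(ltW w0) ?(ltW tau0)// -(powR_inv1 (ltW tau0)) -powRrM mulrC.
  by congr (_ * _ `^ _); ring.
have -> : tau `^ (q - 1) / q * (s `^ q * n x) = (tau `^ (q - 1) * n x) * s `^ q / q by ring.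
rewrite E le_eqVlt; apply/orP; left; apply/eqP; congr (_ + _).
  by field; rewrite bq gt_eqF.
by rewrite /b; field; rewrite !gt_eqF.
Qed.

(* The value [W `^ (1 - q)], which is 0 at [W = +oo] since [fine +oo = 0]
   and [0 `^ (1 - q) = 0]. *)
Definition capacity (R : realType) (q : R) (W : \bar R) : R := fine W `^ (1 - q).

Lemma capacity_ge0 (R : realType) (q : R) (W : \bar R) : 0 <= capacity q W.
Proof. exact: powR_ge0. Qed.

Lemma capacityy (R : realType) (q : R) : q != 1 -> capacity q (+oo : \bar R) = 0.
Proof. by move=> q1; rewrite /capacity powR0// subr_eq0 eq_sym. Qed.

(** Positivity of [V] matters: [capacity q 0] is 0 by convention, and monotonicity fails there. *)
Lemma capacity_antitone (R : realType) (q : R) (V W : \bar R) : 1 < q ->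
  (0 < V)%E -> (V <= W)%E -> capacity q W <= capacity q V.
Proof.
move=> q1; case: V => [v||]//; case: W => [w||]//; rewrite ?lte_fin ?lee_fin => v0 vw.
- rewrite /capacity /= -[1 - q]opprB !powRN lef_pV2 ?posrE ?powR_gt0 ?(lt_le_trans v0 vw)//.
  have w0 := lt_le_trans v0 vw.
  by rewrite ge0_ler_powR ?nnegrE ?subr_ge0 ?(ltW q1) ?(ltW v0) ?(ltW w0).
- by rewrite capacityy ?capacity_ge0// gt_eqF.
Qed.

(** Monotonicity alone would keep only one of the two terms. Both are wanted: the first contracts
    along the levels, the second is paid for by the energy of one excursion. *)
Lemma capacity_split (R : realType) (q r : R) (V D W : \bar R) : 1 < q -> 0 < r < 1 ->
  (0 < V)%E -> (0 < D)%E -> (V + D <= W)%E ->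
  capacity q W <= r `^ q * capacity q V + (1 - r) `^ q * capacity q D.
Proof.
move=> q1 r01 V0 D0 VDW.
apply: (@le_trans _ _ (capacity q (V + D)%E)).
  by apply: capacity_antitone => //; exact: adde_gt0.
have rhs0 : 0 <= r `^ q * capacity q V + (1 - r) `^ q * capacity q D.
  by rewrite addr_ge0 ?mulr_ge0 ?powR_ge0 ?capacity_ge0.
have q1' : q != 1 by rewrite gt_eqF.
move: V D V0 D0 {VDW} rhs0 => [v||] [d||]//; rewrite ?lte_fin => v0 d0;
  [by move=> _; exact: powR_convex_split (ltW q1) _ _ _|move: (_ + _)%R => rhs rhs0..];
  by rewrite ?addye ?addey// capacityy.
Qed.

Lemma itv_integral_gt0 (R : realType) (a b : R) (w : R -> \bar R) :
  measurable_fun [set: measurableTypeR R] w -> (forall x, 0 < w x)%E -> a < b ->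
  (0 < \int[lebesgue_measure]_(x in `[a, b]) w x)%E.
Proof.
move=> mw w0 ab.
rewrite lt_def integral_ge0 ?andbT//; last by move=> x _; exact: ltW.
apply/negP => /eqP w_eq0.
have mab : measurable (`[a, b]%classic : set (measurableTypeR R)) by [].
have := ae_eq_integral_abs lebesgue_measure mab (measurable_funTS mw).
under eq_integral do rewrite gee0_abs ?ltW//.
move=> [/(_ w_eq0) [N [mN N0 abN]] _].
have : (lebesgue_measure (`[a, b]%classic : set (measurableTypeR R)) <= lebesgue_measure N)%E.
  apply: le_measure; rewrite ?inE// => x xab; apply: abN => /= /(_ xab) /eqP.
  by rewrite gt_eqF.
by rewrite N0 lebesgue_measure_itv/= lte_fin ab -EFinD lee_fin subr_le0 leNgt ab.
Qed.

Lemma integral_density_pow_gt0 (R : realType) (q a b : R) (n : R -> R) :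
  measurable_fun [set: measurableTypeR R] n -> (forall x, 0 <= n x) -> a < b ->
  (0 < \int[lebesgue_measure]_(x in `[a, b]) density_pow q n x)%E.
Proof.
move=> mn n0; apply: itv_integral_gt0; first exact: measurable_density_pow.
by move=> x; exact: density_pow_gt0.
Qed.

(** Hoelder's inequality, derived from the pointwise Young inequality so that an infinite weight
    needs no separate theory: if the weight has infinite integral, the capacity is 0 and nothing is
    claimed. *)
Lemma slope_energy_ge (R : realType) (q a b : R) (f n : R -> R) :
  locally_lipschitz f -> measurable_fun [set: measurableTypeR R] n ->
  (forall x, 0 <= n x) -> 1 < q -> a < b -> f a < f b ->
  (((f b - f a) `^ q * capacity q (\int[lebesgue_measure]_(x in `[a, b]) density_pow q n x))%:E
  <= \int[lebesgue_measure]_(x in `[a, b]) (local_slope f x `^ q * n x)%:E)%E.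
Proof.
move=> lf mn n0 q1 ab fab; have q0 : 0 < q by rewrite (lt_trans ltr01).
have w0 x : (0%:E <= density_pow q n x)%E by rewrite ltW// density_pow_gt0.
have mw := measurable_density_pow q mn.
have ms := measurable_local_slope lf.
have msn : measurable_fun [set: measurableTypeR R] (fun x => local_slope f x `^ q * n x).
  apply: measurable_funM => //; apply: (measurableT_comp (f := fun x => x `^ q)) => //.
have := integral_density_pow_gt0 q mn n0 ab.
set d := (\int[_]_(x in _) density_pow _ _ _)%E => d0.
set D := (X in (_ <= X)%E).
have D0 : (0%:E <= D)%E.
  by apply: integral_ge0 => x _; rewrite lee_fin mulr_ge0 ?powR_ge0.
have c0 : 0 < f b - f a by rewrite subr_gt0.
set c := f b - f a in c0 *.
move: D0; case DE : D => [D'||]//; last by move=> _; rewrite leey.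
rewrite !lee_fin => D0.
move: d0; case dE : d => [d'||]//; last first.
  by move=> _; rewrite capacityy ?mulr0// gt_eqF.
rewrite lte_fin => d0; rewrite /capacity/=.
(* The optimal Young parameter: the weight term becomes c - c/q, which cancels against the left-hand
   side up to c/q. *)
pose tau := d' / c; have tau0 : 0 < tau by rewrite divr_gt0.
have k1 : 0 <= tau `^ (q - 1) / q by rewrite divr_ge0 ?powR_ge0// ltW.
have k2 : 0 <= (q - 1) / (q * tau).
  by apply: divr_ge0; [rewrite subr_ge0 ltW|apply: mulr_ge0; exact: ltW].
have : c <= tau `^ (q - 1) / q * D' + (q - 1) / (q * tau) * d'.
  rewrite -lee_fin [X in (_ <= X)%E]EFinD (EFinM _ D') (EFinM _ d') -DE -dE.
  apply: (le_trans (ge0_integral_le_slope lf (ltW ab))).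
  rewrite -ge0_integralZl//; last 2 first.
  - by apply/measurable_EFinP; exact: measurable_funTS.
  - by move=> x _; rewrite lee_fin mulr_ge0 ?powR_ge0.
  rewrite -ge0_integralZl//; last exact: measurable_funTS.
  rewrite -ge0_integralD//; last 4 first.
  - by move=> x _; rewrite -EFinM lee_fin mulr_ge0// mulr_ge0 ?powR_ge0.
  - by apply/measurable_EFinP/measurable_funTS; exact: measurable_funM.
  - by move=> x _; rewrite mule_ge0.
  - apply: emeasurable_funM => //; exact: measurable_funTS.
  apply: ge0_le_integral => //.
  - by move=> x _; rewrite lee_fin local_slope_ge0.
  - by apply/measurable_EFinP/measurable_funTS.
  - apply: emeasurable_funD.
      by apply/measurable_EFinP/measurable_funTS; exact: measurable_funM.
    by apply: emeasurable_funM => //; exact: measurable_funTS.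
  - move=> x _; rewrite -EFinM.
    exact: (young_density q1 tau0 (local_slope_ge0 x lf) (n0 x)).
have -> : (q - 1) / (q * tau) * d' = c - c / q.
  by rewrite /tau; field; rewrite !gt_eqF.
rewrite -lerBlDr opprB addrC subrK ler_pdivrMr// mulrAC divfK ?gt_eqF// => H.
have tp : tau `^ (q - 1) = d' `^ (q - 1) / c `^ (q - 1).
  rewrite /tau powRM ?invr_ge0 ?ltW//; congr (_ * _).
  by rewrite -(powR_inv1 (ltW c0)) -powRrM mulrC powRrM powR_inv1 ?powR_ge0.
have -> : c `^ q = c * c `^ (q - 1) by rewrite mulr_powRB1// ltW.
rewrite -(opprB q 1) powRN ler_pdivrMr ?powR_gt0//.
move: H; rewrite tp mulrAC ler_pdivlMr ?powR_gt0//.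
by rewrite (mulrC D').
Qed.

Lemma first_hitting (R : realType) (f : R -> R) (m y t : R) :
  continuous f -> f m <= t -> m <= y -> t <= f y ->
  exists x, [/\ m <= x <= y, f x = t & forall z, m <= z -> z < x -> f z < t].
Proof.
move=> cf fm my fy.
pose S := [set z | m <= z <= y /\ t <= f z].
have Sy : S y by rewrite /S /= my lexx.
have lbS : lbound S m by move=> z [/andP[]].
have iS : has_inf S by split; [exists y|exists m].
pose x := inf S.
have mx : m <= x by apply: lb_le_inf => //; exists y.
have xy : x <= y by apply: ge_inf => //; exists m.
have lt_x z : m <= z -> z < x -> f z < t.
  move=> mz zx; rewrite ltNge; apply/negP => tz.
  have : x <= z by apply: ge_inf; [exists m|split => //; rewrite mz (le_trans (ltW zx))].
  by rewrite leNgt zx.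
have fx : t <= f x.
  rewrite leNgt; apply/negP => fxt.
  have /nbhs_ballP[r /= r0 Hr] : \forall z \near x, f z < t by exact: (cvgr_lt _ (cf x)).
  have [z [/andP[mz zy] tz] zxr] := inf_adherent r0 iS.
  have xz : x <= z by apply: ge_inf; [exists m|split => //; rewrite mz].
  have : f z < t.
    by apply: Hr; rewrite /ball/= ler0_norm ?subr_le0// opprB ltrBlDl.
  by rewrite ltNge tz.
have [c /itvP cmx fc] : exists2 c, c \in `[m, x] & f c = t.
  apply: IVT => //; first by exact: continuous_subspaceT.
  by rewrite ge_min fm/= le_max fx orbT.
have cx : c = x.
  apply/eqP; rewrite eq_le cmx leNgt; apply/negP => /lt_x; rewrite cmx fc ltxx.
  by move=> /(_ isT).
by exists x; split => //; [rewrite mx xy|rewrite -cx].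
Qed.

Lemma last_exit (R : realType) (f : R -> R) (x x' t : R) :
  continuous f -> x <= x' -> f x <= t -> t <= f x' ->
  exists y, [/\ x <= y <= x', f y = t & forall z, y < z -> z <= x' -> t < f z].
Proof.
move=> cf xx' fx fx'.
have cg : continuous (fun z => - f (- z)).
  move=> z; apply: cvgN; apply: (continuous_comp (f := -%R)); last exact: cf.
  exact: opp_continuous.
have := @first_hitting R (fun z => - f (- z)) (- x') (- x) (- t) cg.
rewrite !opprK !lerN2 => /(_ fx' xx' fx) [y [/andP[y1 y2] fy H]].
exists (- y); split.
- by rewrite lerNr y2 lerNl.
- by rewrite -[LHS]opprK fy opprK.
- by move=> z yz zx'; have := H (- z); rewrite opprK ltrN2 lerN2; apply => //; rewrite ltrNl.
Qed.

(** * Energy between consecutive levels *)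

(** The identity y^-1 = y (y^2)^-1, valid at 0 too, reduces inversion to a real power of a
    nonnegative function. *)
Lemma measurable_fun_invr (R : realType) (f : R -> R) :
  measurable_fun [set: measurableTypeR R] f ->
  measurable_fun [set: measurableTypeR R] (fun x => (f x)^-1).
Proof.
move=> mf; rewrite (_ : (fun x => _) = (fun x => f x * (f x ^+ 2) `^ (- 1))).
  apply: measurable_funM => //.
  apply: (measurableT_comp (f := fun x => x `^ (- 1))) => //.
  exact: measurable_funX.
apply/funext => x; rewrite powR_inv1 ?sqr_ge0//.
have [->|x0] := eqVneq (f x) 0; first by rewrite invr0 mul0r.
by field.
Qed.

Lemma Hq_ge0 (R : realType) (q x : R) : 0 <= Hq q x.
Proof. by rewrite /Hq le_max sqr_ge0. Qed.

Lemma sqr_le_Hq (R : realType) (q x : R) : x ^+ 2 <= Hq q x.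
Proof. by rewrite /Hq le_max lexx. Qed.

Lemma powR_le_Hq (R : realType) (q x : R) : `|x| `^ q <= Hq q x.
Proof. by rewrite /Hq le_max lexx orbT. Qed.

Lemma Hq_mono (R : realType) (q x y : R) : 0 <= q -> `|x| <= `|y| -> Hq q x <= Hq q y.
Proof.
move=> q0 xy; rewrite /Hq ge_max !le_max -[x ^+ 2]real_normK ?num_real//.
rewrite -[y ^+ 2]real_normK ?num_real// lerXn2r ?nnegrE//=.
by rewrite ge0_ler_powR ?nnegrE ?orbT.
Qed.

Lemma Hq0 (R : realType) (q : R) : q != 0 -> Hq q 0 = 0.
Proof. by move=> q0; rewrite /Hq normr0 powR0// expr0n/= maxxx. Qed.

Lemma measurable_Hq_slope (R : realType) (q : R) (f : R -> R) :
  locally_lipschitz f -> measurable_fun [set: measurableTypeR R]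
    (fun x => Hq q (local_slope f x / f x) * f x ^+ 2).
Proof.
move=> lf.
have mf : measurable_fun [set: measurableTypeR R] f.
  exact: measurable_locally_lipschitz lf.
have ms := measurable_local_slope lf.
have md : measurable_fun [set: measurableTypeR R] (fun x => local_slope f x / f x).
  apply: measurable_funM => //.
  exact: measurable_fun_invr.
apply: measurable_funM; last exact: measurable_funX.
apply: measurable_maxr; first exact: measurable_funX.
apply: (measurableT_comp (f := fun x => x `^ q)) => //.
exact: measurableT_comp.
Qed.

Definition hq_energy (R : realType) (q : R) (f n : R -> R) (x : R) : R :=
  Hq q (local_slope f x / f x) * f x ^+ 2 * n x.

Lemma hq_energy_ge0 (R : realType) (q : R) (f n : R -> R) x :
  0 <= n x -> 0 <= hq_energy q f n x.
Proof. by move=> n0; apply: mulr_ge0 => //; apply: mulr_ge0; [exact: Hq_ge0|exact: sqr_ge0]. Qed.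

Lemma measurable_hq_energy (R : realType) (q : R) (f n : R -> R) :
  locally_lipschitz f -> measurable_fun [set: measurableTypeR R] n ->
  measurable_fun [set: measurableTypeR R] (hq_energy q f n).
Proof. by move=> lf mn; apply: measurable_funM => //; exact: measurable_Hq_slope. Qed.

(** One has |f'|^q = f^(q-2) |f'/f|^q f^2, and 2 <= q lets f^(q-2) be bounded by its value at the
    upper level. *)
Lemma slope_powR_le_energy (R : realType) (q t : R) (f n : R -> R) x :
  locally_lipschitz f -> 2 <= q -> 0 <= n x -> 0 < f x <= t ->
  local_slope f x `^ q * n x <= t `^ (q - 2) * hq_energy q f n x.
Proof.
move=> lf q2 n0 /andP[f0 ft]; rewrite /hq_energy mulrA ler_wpM2r//.
have s0 := local_slope_ge0 x lf.
apply: (@le_trans _ _ (f x `^ (q - 2) * ((local_slope f x / f x) `^ q * f x ^+ 2))).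
  have f0' := ltW f0.
  rewrite -(powR_mulrn 2 f0') mulrC -mulrA -powRD ?(gt_eqF f0) ?implybT//.
  rewrite [2 + _]addrC subrK -(powRM _ (divr_ge0 s0 f0') f0').
  by rewrite divfK// gt_eqF.
apply: ler_pM; [exact: powR_ge0|by apply: mulr_ge0; [exact: powR_ge0|exact: sqr_ge0]| |].
  have t0 := lt_le_trans f0 ft.
  by rewrite ge0_ler_powR ?subr_ge0 ?nnegrE ?(ltW f0) ?(ltW t0).
rewrite ler_wpM2r ?sqr_ge0//.
apply: le_trans (powR_le_Hq _ _).
by rewrite ger0_norm// divr_ge0// ltW.
Qed.

Lemma level_increment (R : realType) (q y x t t' : R) (f n : R -> R) :
  locally_lipschitz f -> measurable_fun [set: measurableTypeR R] n ->
  (forall x, 0 <= n x) -> 2 <= q -> y < x -> 0 < t < t' -> f y = t -> f x = t' ->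
  (forall z, y <= z <= x -> t <= f z <= t') ->
  (((t' - t) `^ q * t' `^ (2 - q) *
     capacity q (\int[lebesgue_measure]_(x in `[y, x]) density_pow q n x))%:E
   <= \int[lebesgue_measure]_(x in `[y, x]) (hq_energy q f n x)%:E)%E.
Proof.
move=> lf mn n0 q2 yx /andP[t0 tt'] fy fx fb.
have q1 : 1 < q by lra.
have t'0 : 0 < t' by rewrite (lt_trans t0).
have fyx : f y < f x by rewrite fy fx.
have ms := measurable_local_slope lf.
have msn : measurable_fun [set: measurableTypeR R] (fun x => local_slope f x `^ q * n x).
  by apply: measurable_funM => //; apply: (measurableT_comp (f := fun x => x `^ q)).
have mE := measurable_hq_energy q lf mn.
have H1 := slope_energy_ge lf mn n0 q1 yx fyx.
have H2 : (\int[lebesgue_measure]_(x in `[y, x]) (local_slope f x `^ q * n x)%:E <=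
   (t' `^ (q - 2))%:E * \int[lebesgue_measure]_(x in `[y, x]) (hq_energy q f n x)%:E)%E.
  rewrite -ge0_integralZl//; last 3 first.
  - by apply/measurable_EFinP; exact: measurable_funTS.
  - by move=> z _; rewrite lee_fin hq_energy_ge0.
  - by rewrite lee_fin powR_ge0.
  apply: ge0_le_integral => //.
  - by move=> z _; rewrite lee_fin mulr_ge0 ?powR_ge0.
  - by apply/measurable_EFinP; exact: measurable_funTS.
  - by apply/measurable_EFinP/measurable_funM => //; exact: measurable_funTS.
  - move=> z; rewrite /= in_itv/= => zyx; rewrite -EFinM lee_fin.
    apply: slope_powR_le_energy => //.
    by have /andP[h1 h2] := fb _ zyx; rewrite (lt_le_trans t0).
have := le_trans H1 H2; rewrite fx fy muleC => H.
have p0 : (0%:E <= (t' `^ (2 - q))%:E)%E by rewrite lee_fin powR_ge0.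
have := lee_wpmul2l p0 H.
rewrite -EFinM muleCA -EFinM -powRD ?(gt_eqF t'0) ?implybT//.
have -> : 2 - q + (q - 2) = 0 :> R by ring.
by rewrite powRr0 mule1 mulrCA mulrA.
Qed.

(** The flag [b] includes or excludes [m]: the weight is integrated over [m, x] as in the definition
    of B, the energy over ]m, x] so that the two half-lines have disjoint energies. *)
Lemma ge0_integral_itv_concat (R : realType) (g : R -> \bar R) (b : bool) (m x y x' : R) :
  measurable_fun [set: measurableTypeR R] g -> (forall x, (0 <= g x)%E) ->
  m <= x -> x <= y -> y <= x' ->
  (\int[lebesgue_measure]_(z in [set` Interval (BSide b m) (BRight x)]) g z +
   \int[lebesgue_measure]_(z in `[y, x']) g z <=
   \int[lebesgue_measure]_(z in [set` Interval (BSide b m) (BRight x')]) g z)%E.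
Proof.
move=> mg g0 mx xy yx'.
rewrite -integral_itv_obnd_cbnd; last exact: measurable_funTS.
rewrite -ge0_integral_setU//=; last 2 first.
- exact: measurable_funTS.
- rewrite disj_set2E; apply/eqP/seteqP; split=> z //= []; case: b; rewrite !in_itv/=.
    by move=> /andP[_ zx] /andP[yz _]; have := lt_le_trans yz (le_trans zx xy); rewrite ltxx.
  by move=> /andP[_ zx] /andP[yz _]; have := lt_le_trans yz (le_trans zx xy); rewrite ltxx.
apply: ge0_subset_integral => //=.
- exact: measurableU.
- exact: measurable_funTS.
- move=> z []; case: b; rewrite /= !in_itv/=.
  + by move=> /andP[-> zx] /=; rewrite (le_trans zx)// (le_trans xy).
  + by move=> /andP[-> zx] /=; rewrite (le_trans zx)// (le_trans xy).
  + by move=> /andP[yz ->]; rewrite (le_trans mx)// (le_trans xy)// ltW.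
  + by move=> /andP[yz ->]; rewrite (le_lt_trans mx)// (le_lt_trans xy).
Qed.

Definition hits (R : realType) (f : R -> R) (m t x : R) :=
  [/\ m <= x, f x = t & forall z, m <= z -> z < x -> f z < t].

(* One step between consecutive levels: [D] is the weight of the last excursion
   from [t] to [t'], which is disjoint from what precedes the first visit to [t]. *)
Lemma hits_step (R : realType) (q m t t' x' : R) (f n : R -> R) :
  locally_lipschitz f -> measurable_fun [set: measurableTypeR R] n ->
  (forall x, 0 <= n x) -> 2 <= q -> 0 < t -> t' = 3 / 2 * t -> f m <= t ->
  hits f m t' x' ->
  exists x D, [/\ hits f m t x, x < x', (0 < D)%E,
    (\int[lebesgue_measure]_(z in `[m, x]) density_pow q n z + D <=
     \int[lebesgue_measure]_(z in `[m, x']) density_pow q n z)%E &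
    (\int[lebesgue_measure]_(z in `]m, x]) (hq_energy q f n z)%:E +
      (t' ^+ 2 / 3 `^ q * capacity q D)%:E <=
     \int[lebesgue_measure]_(z in `]m, x']) (hq_energy q f n z)%:E)%E].
Proof.
move=> lf mn n0 q2 t0 t'E fm [mx' fx' lt'].
have cf := locally_lipschitz_continuous lf.
have tt' : t < t' by lra.
have tfx' : t <= f x' by rewrite fx' ltW.
have [x [/andP[mx xx'] fx ltx]] := first_hitting cf fm mx' tfx'.
have fxt : f x <= t by rewrite fx.
have [y [/andP[xy yx'] fy gty]] := last_exit cf xx' fxt tfx'.
have yx : y < x'.
  rewrite lt_neqAle yx' andbT; apply/eqP => E.
  by have := tt'; rewrite -fy -fx' E ltxx.
exists x, (\int[lebesgue_measure]_(z in `[y, x']) density_pow q n z)%E; split.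
- by split.
- exact: le_lt_trans xy yx.
- exact: integral_density_pow_gt0.
- apply: ge0_integral_itv_concat => //; first exact: measurable_density_pow.
  by move=> z; rewrite ltW// density_pow_gt0.
- have mE := measurable_hq_energy q lf mn.
  have := @ge0_integral_itv_concat R (fun z => (hq_energy q f n z)%:E) false m x y x'.
  move=> H; apply: le_trans (H _ _ mx xy yx'); last 2 first.
  - exact/measurable_EFinP.
  - by move=> z; rewrite lee_fin hq_energy_ge0.
  apply: leeD2l.
  have := @level_increment R q y x' t t' f n lf mn n0 q2 yx.
  rewrite t0 tt' => /(_ isT fy fx'); set c := capacity _ _ => L.
  apply: le_trans (L _).
    rewrite lee_fin ler_wpM2r ?capacity_ge0//.
    have t'0 : 0 < t' by rewrite (lt_trans t0).
    (* The ratio 3/2 makes the increment a third of the upper level; this is where 3^q comes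
       from. *)
    have -> : t' - t = t' / 3 by rewrite t'E; field.
    have i3 : 0 <= (3^-1 : R) by [].
    rewrite (powRM _ (ltW t'0) i3) -[leRHS]mulrA [_ * t' `^ _]mulrC mulrA -powRD ?(gt_eqF t'0) ?implybT//.
    have -> : q + (2 - q) = 2%:R by ring.
    rewrite powR_mulrn ?(ltW t'0)//.
    by have -> : 3^-1 `^ q = (3 `^ q)^-1 :> R by rewrite -[3^-1]powR_inv1// -powRrM mulN1r powRN.
  move=> z /andP[yz zx']; apply/andP; split.
    move: yz; rewrite le_eqVlt => /predU1P[<-|yz]; first by rewrite fy.
    by rewrite ltW// gty.
  move: zx'; rewrite le_eqVlt => /predU1P[->|zx']; first by rewrite fx'.
  by rewrite ltW// lt'// (le_trans mx)// (le_trans xy).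
Qed.

(** Here [u], [v] are consecutive squared levels, [w], [w'] the capacities at their hitting points,
    [d] that of the excursion, [j], [j'] the energies and [c] is 3^q. The reserve 4/5 is the fixed
    point of x = (1 + x) 4/9, where 4/9 = (9/4)(16/81): the new term [v * h] raises the reserve to
    9/5 and the contraction brings it back to 4/5. *)
Lemma hardy_step_arith (R : realFieldType) (a b c B S u v w d w' j j' h : R) :
  0 <= B -> 0 <= u -> 0 < c -> 0 <= w -> v = 9 / 4 * u -> a <= 16 / 81 -> 0 <= b ->
  w' <= a * w + b * d -> j + v / c * d <= j' -> h <= B * w' ->
  S + 4 / 5 * u * B * w <= 9 / 5 * (b * c) * B * j ->
  S + v * h + 4 / 5 * v * B * w' <= 9 / 5 * (b * c) * B * j'.
Proof.
move=> B0 u0 c0 w0 vE aE b0 ww' jj' hw H.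
have v0 : 0 <= v by rewrite vE mulr_ge0.
have H1 : v * h <= v * B * w' by rewrite -mulrA ler_wpM2l.
have vB0 : 0 <= v * B by rewrite mulr_ge0.
have H2 := ler_wpM2l vB0 ww'.
have H3 : 9 / 5 * (v * B * (a * w)) <= 4 / 5 * u * B * w.
  have uBw : 0 <= u * B * w by rewrite !mulr_ge0.
  by have := ler_wpM2r uBw aE; rewrite vE; lra.
have H4 : v * d <= c * (j' - j).
  have : v / c * d <= j' - j by lra.
  by move=> /(ler_wpM2l (ltW c0)); rewrite mulrA (mulrCA c) divff ?gt_eqF// mulr1.
have bB0 : 0 <= b * B by rewrite mulr_ge0.
have H5 := ler_wpM2l bB0 H4.
by lra.
Qed.

(** At the lowest level W may be 0, namely when f(m) = t_0, and then its capacity is meaningless.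
    The capacity [d'] of the first excursion bounds [w] instead; going up one level costs 9/4, and
    (9/4)(4/5) = 9/5. *)
Lemma hardy_base_arith (R : realFieldType) (a b c B u v w d d' w' j0 j j' : R) :
  0 <= B -> 0 <= u -> 0 < c -> v = 9 / 4 * u -> a <= b -> 0 <= a -> 0 <= d -> 0 <= d' ->
  0 <= j0 -> w <= d' -> w' <= a * w + b * d ->
  j0 + u / c * d' <= j -> j + v / c * d <= j' ->
  4 / 5 * v * B * w' <= 9 / 5 * (b * c) * B * j'.
Proof.
move=> B0 u0 c0 vE ab a0 d0 d'0 j00 wd' ww' jj jj'.
have v0 : 0 <= v by rewrite vE mulr_ge0.
have b0 := le_trans a0 ab.
have H4 : u * d' + v * d <= c * j'.
  have -> : u * d' + v * d = c * (u / c * d' + v / c * d) by field; rewrite gt_eqF.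
  by rewrite ler_wpM2l ?(ltW c0)//; lra.
have bB0 : 0 <= b * B by rewrite mulr_ge0.
have H5 := ler_wpM2l bB0 H4.
have vB0 : 0 <= v * B by rewrite mulr_ge0.
have H2 := ler_wpM2l vB0 ww'.
have H6 : v * B * (a * w) <= v * B * (b * d').
  rewrite ler_wpM2l//; apply: (@le_trans _ _ (a * d')).
    by rewrite ler_wpM2l.
  by rewrite ler_wpM2r.
have H7 : 0 <= b * B * (v * d) by rewrite !mulr_ge0.
move: H2 H5 H6 H7; rewrite vE; lra.
Qed.

(* Discrete Hardy inequality along the levels t0 (3/2)^k; the constants come from
   [capacity_split] with ratio 4/9. *)
Lemma hits_hardy (R : realType) (q m t0 B : R) (f n : R -> R) (h : nat -> R) :
  locally_lipschitz f -> measurable_fun [set: measurableTypeR R] n ->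
  (forall x, 0 <= n x) -> 2 <= q -> 0 < t0 -> f m <= t0 -> 0 <= B ->
  (\int[lebesgue_measure]_(z in `]m, +oo[) (hq_energy q f n z)%:E < +oo)%E ->
  (forall k x, m < x -> hits f m (t0 * (3 / 2) ^+ k) x ->
     h k <= B * capacity q (\int[lebesgue_measure]_(z in `[m, x]) density_pow q n z)) ->
  forall N x, hits f m (t0 * (3 / 2) ^+ N.+2) x ->
  (\sum_(3 <= k < N.+3) (t0 * (3 / 2) ^+ k) ^+ 2 * h k)
   + 4 / 5 * (t0 * (3 / 2) ^+ N.+2) ^+ 2 * B
     * capacity q (\int[lebesgue_measure]_(z in `[m, x]) density_pow q n z)
  <= 9 / 5 * (5 / 3) `^ q * B *
     fine (\int[lebesgue_measure]_(z in `]m, x]) (hq_energy q f n z)%:E)%E.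
Proof.
move=> lf mn n0 q2 t00 fm B0 Joo Hh.
have q1 : 1 < q by lra.
pose W x := (\int[lebesgue_measure]_(z in `[m, x]) density_pow q n z)%E.
pose J x := (\int[lebesgue_measure]_(z in `]m, x]) (hq_energy q f n z)%:E)%E.
pose t k := t0 * (3 / 2) ^+ k.
have tk0 k : 0 < t k by rewrite mulr_gt0// exprn_gt0//; lra.
have tS k : t k.+1 = 3 / 2 * t k by rewrite /t exprS; ring.
have ft k : f m <= t k.
  by elim: k => [|k IH]; [rewrite /t expr0 mulr1|rewrite tS; have := tk0 k; lra].
have mE := measurable_hq_energy q lf mn.
have Jfin x : J x \is a fin_num.
  rewrite ge0_fin_numE; last by apply: integral_ge0 => z _; rewrite lee_fin hq_energy_ge0.
  apply: le_lt_trans Joo; apply: ge0_subset_integral => //.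
  - by apply/measurable_EFinP/measurable_funTS.
  - by move=> z _; rewrite lee_fin hq_energy_ge0.
  - by move=> z /=; rewrite !in_itv/= => /andP[->].
have J0 x : 0 <= fine (J x).
  by apply/fine_ge0/integral_ge0 => z _; rewrite lee_fin hq_energy_ge0.
have W0 x : (0 <= W x)%E.
  by apply: integral_ge0 => z _; rewrite ltW// density_pow_gt0.
have step k x' : hits f m (t k.+1) x' -> exists x D, [/\ hits f m (t k) x, x < x',
    (0 < D)%E, (W x + D <= W x')%E &
    fine (J x) + t k.+1 ^+ 2 / 3 `^ q * capacity q D <= fine (J x')].
  move=> hx'.
  have [x [D [h1 h2 h3 h4 h5]]] := hits_step lf mn n0 q2 (tk0 k) (tS k) (ft k) hx'.
  exists x, D; split => //; rewrite -lee_fin EFinD !fineK//.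
have r01 : 0 < (4 / 9 : R) < 1 by apply/andP; split; lra.
have q0 : q != 0 by rewrite gt_eqF//; lra.
set a := (4 / 9) `^ q : R; set b := (5 / 9) `^ q : R.
set c3 := 3 `^ q : R; have c30 : 0 < c3 by rewrite powR_gt0.
have a0 : 0 <= a by exact: powR_ge0.
have b0 : 0 <= b by exact: powR_ge0.
have aE : a <= 16 / 81.
  have -> : 16 / 81 = (4 / 9) `^ 2%:R :> R by rewrite powR_mulrn; [field|lra].
  by apply: ger_powR => //; apply/andP; split; lra.
have ab : a <= b by rewrite ge0_ler_powR ?nnegrE; lra.
have bc : (5 / 3) `^ q = b * c3 :> R.
  by rewrite /b /c3 -powRM; [congr (_ `^ _); field|lra|lra].
have b19 : 1 - 4 / 9 = 5 / 9 :> R by field.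
have capS V D V' : (0 < V)%E -> (0 < D)%E -> (V + D <= V')%E ->
    capacity q V' <= a * capacity q V + b * capacity q D.
  by move=> V0 D0 VD; rewrite /b -b19; exact: capacity_split.
have pos1 x' : m < x' -> (0 < W x')%E by exact: integral_density_pow_gt0.
elim=> [|N IH] x' hx'; rewrite -/(W x') -/(J x') bc.
(* The sum is empty here: levels 0, 1 and 2 only build up the reserve of 4/5. This is why the sums
   begin at k = 3. *)
- have [x [D [hx xx' D0 WD JD]]] := step 1%N x' hx'.
  have [x0 [D' [hx0 x0x D'0 WD' JD']]] := step 0%N x hx.
  have mx : m < x by case: hx0 => h1 _ _; exact: le_lt_trans h1 x0x.
  have c1 : capacity q (W x) <= capacity q D'.
    apply: capacity_antitone => //; apply: le_trans WD'.
    by rewrite leeDr.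
  have c2 := capS _ _ _ (pos1 _ mx) D0 WD.
  rewrite big_geq// add0r.
  apply: (hardy_base_arith B0 _ c30 _ ab a0 (capacity_ge0 q D) (capacity_ge0 q D') (J0 x0) c1 c2 JD' JD).
    exact: sqr_ge0.
  by rewrite (tS 1%N); field.
- have [x [D [hx xx' D0 WD JD]]] := step N.+2 x' hx'.
  have mx : m < x.
    case: hx => mx fx _; rewrite lt_neqAle mx andbT; apply/eqP => E.
    by have := ft N.+1; have := tk0 N.+1; rewrite E fx -/(t N.+2) (tS N.+1); lra.
  have c2 := capS _ _ _ (pos1 _ mx) D0 WD.
  rewrite big_nat_recr//=.
  have := IH _ hx; rewrite -/(W x) -/(J x) bc => IHx.
  have h3 := Hh N.+3 x' (lt_trans mx xx') hx'.
  apply: (hardy_step_arith B0 _ c30 (capacity_ge0 q (W x)) _ aE b0 c2 JD h3 IHx).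
    exact: sqr_ge0.
  by rewrite -/(t N.+2) (tS N.+2); field.
Qed.

(** Either the level [N.+3] is reached, and [hits_hardy] applies at its first hitting point, or by
    continuity [f] stays below it and the last term is 0. The bound thus becomes uniform in [N],
    with the energy of the whole half-line. *)
Lemma hits_hardy_sum (R : realType) (q m t0 B : R) (f n : R -> R) (h : nat -> R) :
  locally_lipschitz f -> measurable_fun [set: measurableTypeR R] n ->
  (forall x, 0 <= n x) -> 2 <= q -> 0 < t0 -> f m <= t0 -> 0 <= B ->
  (\int[lebesgue_measure]_(z in `]m, +oo[) (hq_energy q f n z)%:E < +oo)%E ->
  (forall k x, m < x -> hits f m (t0 * (3 / 2) ^+ k) x ->
     h k <= B * capacity q (\int[lebesgue_measure]_(z in `[m, x]) density_pow q n z)) ->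
  (forall k, (forall x, m <= x -> f x < t0 * (3 / 2) ^+ k) -> h k = 0) ->
  forall N, \sum_(3 <= k < N.+3) (t0 * (3 / 2) ^+ k) ^+ 2 * h k
  <= 9 / 5 * (5 / 3) `^ q * B *
     fine (\int[lebesgue_measure]_(z in `]m, +oo[) (hq_energy q f n z)%:E)%E.
Proof.
move=> lf mn n0 q2 t00 fm B0 Joo Hh Hz.
have mE := measurable_hq_energy q lf mn.
have C0 : 0 <= 9 / 5 * (5 / 3) `^ q * B by rewrite !mulr_ge0 ?powR_ge0.
have J0 (A : set R) : (0%:E <= \int[lebesgue_measure]_(z in A) (hq_energy q f n z)%:E)%E.
  by apply: integral_ge0 => z _; rewrite lee_fin hq_energy_ge0.
elim=> [|N IH].
  by rewrite big_geq// mulr_ge0// fine_ge0.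
have [[x hx]|nohit] := pselect (exists x, hits f m (t0 * (3 / 2) ^+ N.+3) x).
  have H := hits_hardy lf mn n0 q2 t00 fm B0 Joo Hh hx.
  apply: (@le_trans _ _ (9 / 5 * (5 / 3) `^ q * B *
     fine (\int[lebesgue_measure]_(z in `]m, x]) (hq_energy q f n z)%:E)%E)).
    apply: le_trans H; rewrite lerDl; apply: mulr_ge0; last exact: capacity_ge0.
    by apply: mulr_ge0 => //; apply: mulr_ge0 => //; exact: sqr_ge0.
  have JJ : (\int[lebesgue_measure]_(z in `]m, x]) (hq_energy q f n z)%:E <=
     \int[lebesgue_measure]_(z in `]m, +oo[) (hq_energy q f n z)%:E)%E.
    apply: ge0_subset_integral => //.
    - by apply/measurable_EFinP/measurable_funTS.
    - by move=> z _; rewrite lee_fin hq_energy_ge0.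
    - by move=> z /=; rewrite !in_itv/= => /andP[->].
  rewrite ler_wpM2l// fine_le// ge0_fin_numE//.
  exact: le_lt_trans JJ Joo.
rewrite big_nat_recr//= Hz ?mulr0 ?addr0// => x mx.
rewrite ltNge; apply/negP => tx; apply: nohit.
have fmt : f m <= t0 * (3 / 2) ^+ N.+3.
  apply: (le_trans fm); rewrite ler_peMr ?(ltW t00)// exprn_ege1//; lra.
have [y [/andP[h1 _] h2 h3]] := first_hitting (locally_lipschitz_continuous lf) fmt mx tx.
by exists y; split.
Qed.

(** * Entropy carried by the high levels *)

Lemma ln_inv_ge_1B (R : realType) (p : R) : 0 < p -> 1 - p <= ln p^-1.
Proof. by move=> p0; rewrite lnV ?posrE// lerNr opprB; exact: ln_le_sub1. Qed.

(* Tangent line to [ln] at [1 / p]; a substitute for Jensen's inequality. *)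
Lemma integral_ln_le_mass_log (R : realType) (mu : probability (measurableTypeR R) R)
    (f : R -> R) (A : set (measurableTypeR R)) :
  measurable A -> measurable_fun [set: measurableTypeR R] f ->
  (\int[mu]_x (f x ^+ 2)%:E <= 1)%E -> (mu A <= (2^-1)%:E)%E ->
  (\int[mu]_(x in A) (ln (1 + f x ^+ 2 / 2))%:E <= mass_log mu A)%E.
Proof.
move=> mA mf f1 muA.
have fA : mu A \is a fin_num by exact: fin_num_measure.
have mf2 : measurable_fun [set: measurableTypeR R] (fun x => f x ^+ 2).
  exact: measurable_funX.
have ml : measurable_fun [set: measurableTypeR R] (fun x => ln (1 + f x ^+ 2 / 2)).
  by apply: measurableT_comp => //; apply: measurable_funD => //; exact: measurable_funM.
have y1 x : 1 <= 1 + f x ^+ 2 / 2 by rewrite lerDl mulr_ge0 ?sqr_ge0.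
rewrite /mass_log; set p := fine (mu A).
have pE : mu A = p%:E by rewrite /p fineK.
have p0 : 0 <= p by exact: fine_ge0.
have p2 : p <= 2^-1 by rewrite -lee_fin -pE.
have [p00|pN0] := eqVneq p 0.
  rewrite p00 mul0r null_set_integral//.
  - by apply/measurable_EFinP; exact: measurable_funTS.
  - exact: (etrans pE (congr1 EFin p00)).
have pp : 0 < p by rewrite lt_def pN0.
(* The tangent bound ln z <= p z - 1 + ln (1/p) at z = 1 + y/2 reads (p/2) y + [kap]. Integrated
   over the set it gives p ln (1/p) + p (p - 1/2): halving y inside the logarithm leaves just the
   room that a mass at most 1/2 fills. *)
pose kap := p - 1 + ln p^-1.
have kap0 : 0 <= kap by have := ln_inv_ge_1B pp; rewrite /kap; lra.
apply: (@le_trans _ _ (\int[mu]_(x in A) ((p / 2)%:E * (f x ^+ 2)%:E + kap%:E))%E).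
  apply: ge0_le_integral => //.
  - by move=> x _; rewrite lee_fin ln_ge0.
  - by apply/measurable_EFinP; exact: measurable_funTS.
  - apply: emeasurable_funD => //; apply: emeasurable_funM => //.
    by apply/measurable_EFinP; exact: measurable_funTS.
  - move=> x _; rewrite -EFinM -EFinD lee_fin.
    have y0 : 0 < 1 + f x ^+ 2 / 2 by rewrite (lt_le_trans ltr01).
    have := ln_le_sub1 (mulr_gt0 pp y0).
    by rewrite lnM ?posrE// /kap lnV ?posrE//; lra.
rewrite ge0_integralD//; last 2 first.
- by move=> x _; rewrite -EFinM lee_fin mulr_ge0 ?sqr_ge0// divr_ge0.
- by apply: emeasurable_funM => //; apply/measurable_EFinP; exact: measurable_funTS.
rewrite ge0_integralZl//; last 3 first.
- by apply/measurable_EFinP; exact: measurable_funTS.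
- by move=> x _; rewrite lee_fin sqr_ge0.
- by rewrite lee_fin divr_ge0.
have -> : (\int[mu]_(x in A) kap%:E = kap%:E * p%:E)%E.
  by rewrite integral_cst//; congr (_ * _)%E; exact: pE.
apply: (@le_trans _ _ ((p / 2)%:E * 1 + kap%:E * p%:E)%E).
  apply: leeD2r; apply: lee_wpmul2l; first by rewrite lee_fin divr_ge0.
  apply: le_trans f1; apply: ge0_subset_integral => //.
  - by apply/measurable_EFinP.
  - by move=> x _; rewrite lee_fin sqr_ge0.
rewrite mule1 -EFinM -EFinD lee_fin /kap.
have : p * (p - 2^-1) <= 0 by rewrite mulr_ge0_le0// subr_le0.
by set l := ln _; lra.
Qed.

Lemma mass_log_le_capacity (R : realType) (mu : probability (measurableTypeR R) R)
    (q B : R) (A : set (measurableTypeR R)) (W : \bar R) :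
  measurable A -> 1 < q -> (mu A <= (2^-1)%:E)%E -> 0 <= B -> (0 < W)%E ->
  (mass_log mu A * W `^ (q - 1) <= B%:E)%E ->
  (mass_log mu A <= (B * capacity q W)%:E)%E.
Proof.
move=> mA q1 muA B0.
have fA : mu A \is a fin_num by exact: fin_num_measure.
rewrite /mass_log; set p := fine (mu A).
have pE : mu A = p%:E by rewrite /p fineK.
have p0 : 0 <= p by exact: fine_ge0.
have p2 : p <= 2^-1 by rewrite -lee_fin -pE.
have [p00|pN0] := eqVneq p 0.
  by rewrite p00 mul0r => _ _; rewrite lee_fin mulr_ge0 ?capacity_ge0.
have pp : 0 < p by rewrite lt_def pN0.
have l0 : 0 < p * ln p^-1.
  by rewrite mulr_gt0// (lt_le_trans _ (ln_inv_ge_1B pp))//; lra.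
case: W => [w||]//; last first.
  (* An infinite [W] contradicts the hypothesis: since 0 < p <= 1/2, the factor p ln (1/p) is
     positive and the product would be +oo. *)
  by rewrite poweRyr ?gt_eqF ?subr_gt0// gt0_muley ?lte_fin.
rewrite lte_fin => w0; rewrite poweR_EFin -EFinM !lee_fin => H.
have wq : 0 < w `^ (q - 1) by rewrite powR_gt0.
by rewrite /capacity/= -(opprB q 1) powRN ler_pdivlMr.
Qed.

(** For y >= 64 = 2^6 the missing ln 2 is at most a fifth of ln (y/2). The 6/5 is the price for the
    argument 1 + y/2 needed in the mass bound. *)
Lemma ln_sqr_le (R : realType) (y : R) : 64 <= y -> ln y <= 6 / 5 * ln (1 + y / 2).
Proof.
move=> y64; have y0 : 0 < y by lra.
have H : ln (y / 2) <= ln (1 + y / 2) by rewrite ler_ln ?posrE//; lra.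
have H2 : ln (2 ^+ 5) <= ln (y / 2) :> R by rewrite ler_ln ?posrE//; lra.
have H3 : ln y = ln (y / 2) + ln 2.
  by rewrite -lnM ?posrE// ?divfK//; lra.
have H5 : ln (2 ^+ 5) = 5 * ln 2 :> R by rewrite lnXn// mulr_natl.
lra.
Qed.

(** A layer-cake formula: t_(k+1)^2 - t_k^2 = (5/4) t_k^2. Cutting s^2 at the top level makes the
    claim inductive in [N]. *)
Lemma truncated_sqr_le_levels (R : realType) (t0 s : R) (N : nat) : 0 < t0 -> 0 <= s ->
  Num.min (s ^+ 2) ((t0 * (3 / 2) ^+ N.+3) ^+ 2) - (t0 * (3 / 2) ^+ 3) ^+ 2 <=
  \sum_(3 <= k < N.+3) 5 / 4 * (t0 * (3 / 2) ^+ k) ^+ 2 * ((t0 * (3 / 2) ^+ k <= s)%R : bool)%:R.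
Proof.
move=> t00 s0; elim: N => [|N IH].
  by rewrite big_geq// subr_le0 ge_min lexx orbT.
rewrite big_nat_recr//=.
set t := t0 * (3 / 2) ^+ N.+3 in IH *.
have t_gt0 : 0 < t by rewrite mulr_gt0// exprn_gt0//; lra.
have -> : t0 * (3 / 2) ^+ N.+4 = 3 / 2 * t by rewrite /t exprS; ring.
have [ts|st] := leP t s; last first.
  rewrite [X in _ <= _ + X]mulr0 addr0 (le_trans _ IH)// lerD2r le_min ge_min lexx/= ge_min.
  by rewrite lerXn2r ?nnegrE ?(ltW t_gt0) ?(ltW st).
rewrite mulr1 (le_trans _ (lerD IH (lexx _)))//.
rewrite (@min_r _ _ (s ^+ 2) (t ^+ 2)) ?lerXn2r ?nnegrE ?(ltW t_gt0)//.
rewrite addrAC lerD2r ge_min; apply/orP; right; rewrite le_eqVlt; apply/orP; left; apply/eqP; by field.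
Qed.

Lemma sum_nat_shift3 (V : nmodType) (F : nat -> V) (N : nat) :
  \sum_(3 <= k < N.+3) F k = \sum_(0 <= k < N) F k.+3.
Proof.
rewrite -(add0n 3%N) -[N.+3]addn3 big_addn addnK.
by apply: eq_bigr => k _; rewrite addn3.
Qed.

(** The part of s^2 ln s^2 above T. The square is lowered by T^2, rather than restricted to {s >=
    T}, so that it is a telescoping sum over the levels. *)
Definition entropy_tail (R : realType) (T s : R) : R :=
  Num.max 0 (s ^+ 2 - T ^+ 2) * ln (s ^+ 2).

Lemma entropy_tail_ge0 (R : realType) (T s : R) : 1 <= T -> 0 <= s ->
  0 <= entropy_tail T s.
Proof.
move=> T1 s0; rewrite /entropy_tail.
have [Ts|sT] := leP T s.
  by rewrite mulr_ge0 ?le_max ?lexx// ln_ge0// exprn_ege1// (le_trans T1).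
rewrite max_l ?mul0r// subr_le0 lerXn2r ?nnegrE ?(ltW sT)//.
by rewrite (le_trans ler01).
Qed.

Lemma measurable_entropy_tail (R : realType) (T : R) (f : R -> R) :
  measurable_fun [set: measurableTypeR R] f ->
  measurable_fun [set: measurableTypeR R] (fun x => entropy_tail T (f x)).
Proof.
move=> mf; have mf2 : measurable_fun [set: measurableTypeR R] (fun x => f x ^+ 2).
  exact: measurable_funX.
apply: measurable_funM; last exact: measurableT_comp.
by apply: measurable_maxr => //; exact: measurable_funB.
Qed.

(** With 4 <= t_0 the tail lives on s >= 27/2, where the logarithms compare; the factor is 3/2 =
    (5/4)(6/5). The index [N] is taken so large that the truncation of s^2 is inactive. *)
Lemma entropy_tail_le_levels (R : realType) (t0 s : R) : 4 <= t0 -> 0 <= s ->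
  exists N, entropy_tail (t0 * (3 / 2) ^+ 3) s <=
  \sum_(0 <= k < N) 3 / 2 * (t0 * (3 / 2) ^+ k.+3) ^+ 2 *
     (((t0 * (3 / 2) ^+ k.+3 <= s)%R : bool)%:R * ln (1 + s ^+ 2 / 2)).
Proof.
move=> t4 s0; have t00 : 0 < t0 by lra.
set T := t0 * _.
have TE : T = 27 / 8 * t0 by rewrite /T; field.
have l0 : 0 <= ln (1 + s ^+ 2 / 2) by rewrite ln_ge0// lerDl mulr_ge0 ?sqr_ge0.
have [N sN] : exists N, s <= t0 * (3 / 2) ^+ N.+3.
  have [N sN] : exists N : nat, s < N%:R.
    by exists (Num.truncn s).+1; rewrite truncnS_gt.
  exists N; apply: (le_trans (ltW sN)).
  have bern k : 1 + k%:R / 2 <= (3 / 2) ^+ k :> R.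
    elim: k => [|k IH]; first by rewrite expr0; lra.
    rewrite exprS -natr1.
    by have : 0 <= k%:R :> R by []; lra.
  have := bern N; have : 0 <= N%:R :> R by [].
  rewrite -[N.+3]addn3 exprD; set v := (3 / 2) ^+ N => v0 v1.
  have -> : t0 * (v * (3 / 2) ^+ 3) = 27 / 8 * (t0 * v) by field.
  by have : 4 * v <= t0 * v; [rewrite ler_wpM2r//; lra|lra].
exists N.
have [Ts|sT] := leP T s; last first.
  rewrite /entropy_tail max_l ?mul0r.
    apply: sumr_ge0 => k _; apply: mulr_ge0; last exact: mulr_ge0.
    by apply: mulr_ge0 => //; exact: sqr_ge0.
  by rewrite subr_le0 lerXn2r ?nnegrE ?(ltW sT)// (le_trans s0 (ltW sT)).
have s64 : 64 <= s ^+ 2.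
  by have : 8 <= s; [lra|nra].
rewrite /entropy_tail max_r; last by rewrite subr_ge0 lerXn2r ?nnegrE// TE; lra.
have := truncated_sqr_le_levels N t00 s0; rewrite -/T.
rewrite min_l; last by rewrite lerXn2r ?nnegrE// (le_trans s0 sN).
move=> H; apply: (@le_trans _ _ ((s ^+ 2 - T ^+ 2) * (6 / 5 * ln (1 + s ^+ 2 / 2)))).
  rewrite ler_wpM2l ?ln_sqr_le// subr_ge0 lerXn2r ?nnegrE// TE; lra.
have := ler_wpM2r (mulr_ge0 (_ : 0 <= 6 / 5) l0) H.
move=> /(_ _)/le_trans; apply; first by [].
rewrite -(add0n 3%N) big_addn addn3 subSS subSS subSS subn0 mulr_suml ler_sum// => k _.
rewrite addn3 le_eqVlt; apply/orP; left; apply/eqP; by field.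
Qed.

Lemma entropy_tail_right (R : realType) (mu : probability (measurableTypeR R) R)
    (q m t0 B : R) (f n : R -> R) :
  locally_lipschitz f -> (forall x, 0 <= f x) ->
  measurable_fun [set: measurableTypeR R] n -> (forall x, 0 <= n x) -> 2 <= q ->
  (\int[mu]_x (f x ^+ 2)%:E <= 1)%E ->
  (mu `]m, +oo[%classic <= (2^-1)%:E)%E -> 4 <= t0 -> f m <= t0 -> 0 <= B ->
  (\int[lebesgue_measure]_(z in `]m, +oo[) (hq_energy q f n z)%:E < +oo)%E ->
  (forall x, m < x -> (mass_log mu `[x, +oo[%classic *
      (\int[lebesgue_measure]_(t in `[m, x]) density_pow q n t) `^ (q - 1) <= B%:E)%E) ->
  (\int[mu]_(x in `]m, +oo[) (entropy_tail (t0 * (3 / 2) ^+ 3)%R (f x))%:E <=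
   (2 `^ (q + 1) * B)%:E *
     \int[lebesgue_measure]_(z in `]m, +oo[) (hq_energy q f n z)%:E)%E.
Proof.
move=> lf f0 mn n0 q2 f1 muhalf t4 fm B0 Joo HB.
have t00 : 0 < t0 by lra.
have q1 : 1 < q by lra.
have mf : measurable_fun [set: measurableTypeR R] f.
  exact: measurable_locally_lipschitz lf.
have mf2 : measurable_fun [set: measurableTypeR R] (fun x => f x ^+ 2).
  exact: measurable_funX.
have ml : measurable_fun [set: measurableTypeR R] (fun x => ln (1 + f x ^+ 2 / 2)).
  by apply: measurableT_comp => //; apply: measurable_funD => //; exact: measurable_funM.
have l0 x : 0 <= ln (1 + f x ^+ 2 / 2) by rewrite ln_ge0// lerDl mulr_ge0 ?sqr_ge0.
pose t k := t0 * (3 / 2) ^+ k.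
pose g k (x : measurableTypeR R) : R := ((t k <= f x)%R : bool)%:R * ln (1 + f x ^+ 2 / 2).
have g0 k x : 0 <= g k x by rewrite mulr_ge0.
have mg k : measurable_fun [set: measurableTypeR R] (g k).
  apply: measurable_funM => //.
  rewrite (_ : (fun x => _) = (\1_[set x | t k <= f x] : _ -> R)); last first.
    by apply/funext => x; rewrite indicE; congr (_%:R); congr nat_of_bool;
      apply/idP/idP; rewrite inE.
  apply: measurable_indic; rewrite -[X in measurable X]setTI.
  by apply: measurable_fun_le => //; exact: measurable_cst.
have gl k x : g k x <= ln (1 + f x ^+ 2 / 2).
  by rewrite /g; case: (t k <= f x); rewrite ?mul1r// mul0r.
have mr : measurable (`]m, +oo[%classic : set (measurableTypeR R)) by [].
pose h k := fine (\int[mu]_(x in `]m, +oo[) (g k x)%:E)%E.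
have Hall : (\int[mu]_(x in `]m, +oo[) (ln (1 + f x ^+ 2 / 2))%:E < +oo)%E.
  by apply: le_lt_trans (integral_ln_le_mass_log mr mf f1 muhalf) _; rewrite ltry.
have hE k : ((h k)%:E = \int[mu]_(x in `]m, +oo[) (g k x)%:E)%E.
  rewrite /h fineK// ge0_fin_numE; last by apply: integral_ge0 => x _; rewrite lee_fin.
  apply: le_lt_trans Hall; apply: ge0_le_integral => //.
  - by move=> x _; rewrite lee_fin.
  - by apply/measurable_EFinP; exact: measurable_funTS.
  - by apply/measurable_EFinP; exact: measurable_funTS.
  - by move=> x _; rewrite lee_fin.
(* To the right of [m], the set {f >= t_k} lies beyond the first hitting point [x], so its
   contribution is at most the one of [x, +oo[. *)
have Hh k x : m < x -> hits f m (t k) x ->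
     h k <= B * capacity q (\int[lebesgue_measure]_(z in `[m, x]) density_pow q n z).
  move=> mx [_ fx ltx]; rewrite -lee_fin hE.
  have mA : measurable (`[x, +oo[%classic : set (measurableTypeR R)) by [].
  have muA : (mu `[x, +oo[%classic <= (2^-1)%:E)%E.
    apply: le_trans muhalf; apply: le_measure; rewrite ?inE//.
    by move=> z; rewrite /= !in_itv/= !andbT; exact: lt_le_trans.
  apply: le_trans (mass_log_le_capacity mA q1 muA B0 _ (HB _ mx)).
    apply: le_trans (integral_ln_le_mass_log mA mf f1 muA).
    rewrite integral_mkcond [leRHS]integral_mkcond; apply: ge0_le_integral => //.
    - by move=> z _; rewrite patchE; case: ifP => // _; rewrite lee_fin.
    - by apply/(measurable_restrictT _ _).1 => //; apply/measurable_EFinP; exact: measurable_funTS.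
    - by apply/(measurable_restrictT _ _).1 => //; apply/measurable_EFinP; exact: measurable_funTS.
    - move=> z _; rewrite !patchE; case: ifPn => [zm|_]; last first.
        by case: ifP => // _; rewrite lee_fin.
      case: ifPn => [_|zx]; first by rewrite lee_fin.
      have -> : g k z = 0; last exact: lexx.
      rewrite /g leNgt ltx ?mul0r//.
        by move: zm; rewrite inE/= in_itv/= andbT => /ltW.
      by move: zx; rewrite notin_setE/= in_itv/= andbT => /negP; rewrite ltNge.
  by apply: integral_density_pow_gt0.
have Hz k : (forall x, m <= x -> f x < t k) -> h k = 0.
  move=> fk; rewrite /h integral0_eq// => x; rewrite /= in_itv/= andbT => /ltW mx.
  by rewrite /g leNgt fk// mul0r.
have Hsum := hits_hardy_sum lf mn n0 q2 t00 fm B0 Joo Hh Hz.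
pose G k x := ((3 / 2 * t k.+3 ^+ 2)%:E * (g k.+3 x)%:E)%E.
have G0 k x : (0%:E <= G k x)%E.
  by rewrite /G -EFinM lee_fin; apply: mulr_ge0 => //; apply: mulr_ge0 => //; exact: sqr_ge0.
have mG k : measurable_fun `]m, +oo[ (G k).
  apply: emeasurable_funM; first exact: measurable_cst.
  by apply/measurable_EFinP; apply: measurable_funTS; exact: mg.
apply: (@le_trans _ _ (\int[mu]_(x in `]m, +oo[) \sum_(0 <= k <oo) G k x)%E).
  apply: ge0_le_integral => //.
  - move=> x _; rewrite lee_fin entropy_tail_ge0//; lra.
  - by apply/measurable_EFinP/measurable_funTS; exact: measurable_entropy_tail.
  - by apply: ge0_emeasurable_sum; [move=> k x _ _; exact: G0|move=> k _; exact: mG].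
  - move=> x _; have [N] := entropy_tail_le_levels t4 (f0 x).
    rewrite -lee_fin => /le_trans; apply.
    apply: le_trans (@nneseries_lim_ge _ (G^~ x) xpredT 0%N N _) => //.
    by rewrite sumEFin.
rewrite integral_nneseries//.
have GE k : (\int[mu]_(x in `]m, +oo[) G k x = (3 / 2 * t k.+3 ^+ 2 * h k.+3)%:E)%E.
  rewrite /G ge0_integralZl//; last 3 first.
  - by apply/measurable_EFinP; exact: measurable_funTS.
  - by move=> x _; rewrite lee_fin.
  - by rewrite lee_fin; apply: mulr_ge0 => //; exact: sqr_ge0.
  by rewrite [RHS]EFinM hE.
under eq_eseriesr do rewrite GE.
have Jf : (\int[lebesgue_measure]_(z in `]m, +oo[) (hq_energy q f n z)%:E)%E \is a fin_num.
  by rewrite ge0_fin_numE//; apply: integral_ge0 => z _; rewrite lee_fin hq_energy_ge0.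
rewrite -(fineK Jf) -EFinM.
have J0 : 0 <= fine (\int[lebesgue_measure]_(z in `]m, +oo[) (hq_energy q f n z)%:E)%E.
  by apply/fine_ge0/integral_ge0 => z _; rewrite lee_fin hq_energy_ge0.
set J := fine _ in Hsum J0 *.
apply: lime_le.
  apply: is_cvg_nneseries => k _ _; rewrite -GE; apply: integral_ge0 => x _; exact: G0.
apply: nearW => N; rewrite sumEFin lee_fin.
apply: (@le_trans _ _ (3 / 2 * \sum_(3 <= k < N.+3) t k ^+ 2 * h k)).
  rewrite sum_nat_shift3 mulr_sumr le_eqVlt; apply/orP; left; apply/eqP.
  by apply: eq_bigr => k _; ring.
apply: (@le_trans _ _ (3 / 2 * (9 / 5 * (5 / 3) `^ q * B * J))).
  by rewrite ler_wpM2l.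
(* The constants multiply to (3/2)(9/5)(5/3)^q = (27/10)(5/3)^q. As 2 = (5/3)(6/5), it remains to
   see that 27/20 <= (6/5)^q, and (6/5)^2 = 36/25 suffices. *)
have q65 : 27 / 20 <= (6 / 5) `^ q :> R.
  apply: (@le_trans _ _ ((6 / 5) `^ 2%:R)); first by rewrite powR_mulrn; lra.
  by apply: ler_powR => //; lra.
have BJ : 0 <= B * J by rewrite mulr_ge0.
have -> : 2 `^ (q + 1) = 2 * 2 `^ q :> R.
  rewrite powRD; last by rewrite pnatr_eq0 implybT.
  by rewrite powRr1// mulrC.
have -> : 2 `^ q = (5 / 3) `^ q * (6 / 5) `^ q :> R.
  by rewrite -powRM; [congr (_ `^ _); field|lra|lra].
have p0 : 0 <= (5 / 3 : R) `^ q * (B * J) by rewrite mulr_ge0 ?powR_ge0.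
by have := ler_wpM2l p0 q65; lra.
Qed.

(** * Density and reflection *)

Import HBNNSimple.

(** The density is given on sets only, that is on indicators; simple functions and monotone
    convergence carry it to nonnegative integrands. *)
Lemma ge0_integral_density (R : realType)
    (nu : {measure set (measurableTypeR R) -> \bar R}) (n g : R -> R) :
  is_density nu n -> measurable_fun [set: measurableTypeR R] g -> (forall x, 0 <= g x) ->
  (\int[nu]_x (g x)%:E = \int[lebesgue_measure]_x (g x * n x)%:E)%E.
Proof.
move=> [mn n0 nuE] mg g0.
have mg' : measurable_fun [set: measurableTypeR R] (EFin \o g) by exact/measurable_EFinP.
pose h_ := nnsfun_approx measurableT mg'.
have hg x : (h_ k x)%:E @[k --> \oo] --> (g x)%:E.
  by apply: (cvg_nnsfun_approx measurableT mg') => // y _; rewrite /= lee_fin.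
have hnd x : {homo (fun k => h_ k x) : a b / (a <= b)%N >-> a <= b}.
  by move=> a b ab; exact/lefP/nd_nnsfun_approx.
transitivity (limn (fun k => \int[nu]_x (h_ k x)%:E)%E).
  rewrite -monotone_convergence//.
  - by apply: eq_integral => x _; apply/esym/cvg_lim => //; exact: hg.
  - by move=> k; exact/measurable_EFinP.
  - by move=> k x _; rewrite lee_fin.
  - by move=> x _ a b ab; rewrite lee_fin hnd.
transitivity (limn (fun k => \int[lebesgue_measure]_x (h_ k x * n x)%:E)%E); last first.
  rewrite -monotone_convergence//.
  - apply: eq_integral => x _; apply/cvg_lim => //.
    by under eq_fun do rewrite EFinM; rewrite EFinM; apply: cvgeZr => //; exact: hg.
  - by move=> k; apply/measurable_EFinP; apply: measurable_funM.
  - by move=> k x _; rewrite lee_fin mulr_ge0.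
  - by move=> x _ a b ab; rewrite lee_fin ler_wpM2r// hnd.
congr (limn _); apply/funext => k.
transitivity (\sum_(r \in range (h_ k)) \int[nu]_x (r * \1_((h_ k) @^-1` [set r]) x)%:E)%E.
  rewrite -ge0_integral_fsum//.
  - by apply: eq_integral => x _; rewrite fsumEFin// -fimfunE.
  - by move=> r; exact/measurable_EFinP/measurable_funM.
  - by move=> r x _; rewrite nnfun_muleindic_ge0.
transitivity (\sum_(r \in range (h_ k))
    \int[lebesgue_measure]_x (r * \1_((h_ k) @^-1` [set r]) x * n x)%:E)%E; last first.
  rewrite -ge0_integral_fsum//.
  - apply: eq_integral => x _; rewrite fsumEFin//.
    by rewrite -mulr_fsuml -fimfunE.
  - by move=> r; apply/measurable_EFinP/measurable_funM => //; exact: measurable_funM.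
  - move=> r x _; rewrite lee_fin mulr_ge0//.
    by have := nnfun_muleindic_ge0 (h_ k) r x; rewrite -EFinM lee_fin.
apply: eq_fsbigr => r _.
have mA : measurable ((h_ k) @^-1` [set r]) by exact: measurable_funPTI.
have [r0|r0] := ltP r 0.
  rewrite preimage_nnfun0//.
  by rewrite !integral0_eq// => x _; rewrite indic0 mulr0 ?mul0r.
under eq_integral do rewrite EFinM.
under [RHS]eq_integral do rewrite -mulrA EFinM.
rewrite !ge0_integralZl_EFin//.
- congr (_ * _)%E; rewrite integral_indic//= setIT.
  rewrite [LHS]nuE// [LHS]integral_mkcond; apply: eq_integral => x _.
  by rewrite patchE indicE; case: ifP => _; rewrite ?mul1r ?mul0r.
- by move=> x _; rewrite lee_fin mulr_ge0.
- by apply/measurable_EFinP/measurable_funM.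
- exact/measurable_EFinP.
Qed.

Lemma variance_integral (R : realType) (mu : probability (measurableTypeR R) R) (f : R -> R) :
  'V_mu[f] = (\int[mu]_x ((f x - fine 'E_mu[f]) ^+ 2)%:E)%E.
Proof. by rewrite /variance covariance.unlock expectation.unlock. Qed.

Lemma measurable_oppr (R : realType) :
  measurable_fun [set: measurableTypeR R] (fun x : measurableTypeR R => (- x)%R : measurableTypeR R).
Proof. exact: measurable_funN. Qed.

Lemma ge0_integral_oppr (R : realType) (g : R -> \bar R) (A : set (measurableTypeR R)) :
  measurable A -> measurable_fun [set: measurableTypeR R] g -> (forall x, 0 <= g x)%E ->
  (\int[lebesgue_measure]_(x in A) g (- x)%R = \int[lebesgue_measure]_(x in -%R @^-1` A) g x)%E.
Proof.
move=> mA mg g0.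
have mN := @measurable_oppr R.
transitivity (\int[pushforward lebesgue_measure (fun x : R => (- x)%R : measurableTypeR R)]_(x in A) g (- x)%R)%E.
  by apply: eq_measure_integral => //= B mB _; exact/esym/lebesgue_measureN.
rewrite ge0_integral_pushforward//.
- by apply: eq_integral => x _ /=; rewrite opprK.
- by apply: measurable_funTS; exact: measurableT_comp.
Qed.

Definition opp_mfun (R : realType) : {mfun measurableTypeR R >-> measurableTypeR R} :=
  MeasurableFun.Pack (MeasurableFun.Class
    (isMeasurableFun.Build _ _ _ _ _ (@measurable_oppr R))).

Definition reflection (R : realType) (mu : probability (measurableTypeR R) R)
  : probability (measurableTypeR R) R := distribution mu (@opp_mfun R).

Lemma reflectionE (R : realType) (mu : probability (measurableTypeR R) R) A :
  reflection mu A = mu (-%R @^-1` A).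
Proof. by []. Qed.

Lemma ge0_integral_reflection (R : realType) (mu : probability (measurableTypeR R) R)
    (g : R -> \bar R) (A : set (measurableTypeR R)) :
  measurable A -> measurable_fun [set: measurableTypeR R] g -> (forall x, 0 <= g x)%E ->
  (\int[reflection mu]_(x in A) g x = \int[mu]_(x in -%R @^-1` A) g (- x)%R)%E.
Proof.
move=> mA mg g0; rewrite ge0_integral_pushforward//.
exact: measurable_funTS.
Qed.

Lemma hq_energyN (R : realType) (q : R) (f n : R -> R) (x : R) : locally_lipschitz f ->
  hq_energy q (fun x => f (- x)) (fun x => n (- x)) x = hq_energy q f n (- x).
Proof. by move=> lf; rewrite /hq_energy local_slopeN. Qed.

Lemma integral_density_powN (R : realType) (q a b : R) (n : R -> R) :
  measurable_fun [set: measurableTypeR R] n -> (forall x, 0 <= n x) ->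
  (\int[lebesgue_measure]_(x in `[(- b)%R, (- a)%R]) density_pow q (fun x => n (- x)%R) x =
   \int[lebesgue_measure]_(x in `[a, b]) density_pow q n x)%E.
Proof.
move=> mn n0; rewrite (@ge0_integral_oppr R (density_pow q n))//.
- by rewrite opp_preimage_itvbndbnd/= !opprK.
- exact: measurable_density_pow.
- by move=> x; rewrite ltW// density_pow_gt0.
Qed.

Lemma entropy_tail_left (R : realType) (mu : probability (measurableTypeR R) R)
    (q m t0 B : R) (f n : R -> R) :
  locally_lipschitz f -> (forall x, 0 <= f x) ->
  measurable_fun [set: measurableTypeR R] n -> (forall x, 0 <= n x) -> 2 <= q ->
  (\int[mu]_x (f x ^+ 2)%:E <= 1)%E ->
  (mu `]-oo, m[%classic <= (2^-1)%:E)%E -> 4 <= t0 -> f m <= t0 -> 0 <= B ->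
  (\int[lebesgue_measure]_(z in `]-oo, m[) (hq_energy q f n z)%:E < +oo)%E ->
  (forall x, x < m -> (mass_log mu `]-oo, x]%classic *
      (\int[lebesgue_measure]_(t in `[x, m]) density_pow q n t) `^ (q - 1) <= B%:E)%E) ->
  (\int[mu]_(x in `]-oo, m[) (entropy_tail (t0 * (3 / 2) ^+ 3)%R (f x))%:E <=
   (2 `^ (q + 1) * B)%:E *
     \int[lebesgue_measure]_(z in `]-oo, m[) (hq_energy q f n z)%:E)%E.
Proof.
move=> lf f0 mn n0 q2 f1 muhalf t4 fm B0 Joo HB.
have mf : measurable_fun [set: measurableTypeR R] f.
  exact: measurable_locally_lipschitz lf.
have mE := measurable_hq_energy q lf mn.
have mN := @measurable_oppr R.
pose f' x := f (- x); pose n' x := n (- x).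
have lf' : locally_lipschitz f' by exact: locally_lipschitzN.
have mf' : measurable_fun [set: measurableTypeR R] f' by exact: measurableT_comp.
have mn' : measurable_fun [set: measurableTypeR R] n' by exact: measurableT_comp.
have itvE : -%R @^-1` `]- m, +oo[%classic = `]-oo, m[%classic :> set R.
  by apply/seteqP; split => x /=; rewrite !in_itv/= andbT ltrN2.
have itvE' x : -%R @^-1` `[x, +oo[%classic = `]-oo, - x]%classic :> set R.
  by apply/seteqP; split => y /=; rewrite !in_itv/= andbT lerNr.
have JE : (\int[lebesgue_measure]_(z in `](- m)%R, +oo[) (hq_energy q f' n' z)%:E =
    \int[lebesgue_measure]_(z in `]-oo, m[) (hq_energy q f n z)%:E)%E.
  under eq_integral do rewrite hq_energyN//.
  rewrite (@ge0_integral_oppr R (fun x => (hq_energy q f n x)%:E))//.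
  - by rewrite itvE.
  - exact/measurable_EFinP.
  - by move=> x; rewrite lee_fin hq_energy_ge0.
have := @entropy_tail_right R (reflection mu) q (- m) t0 B f' n' lf' (fun x => f0 _) mn'
  (fun x => n0 _) q2.
rewrite JE !ge0_integral_reflection//; last 4 first.
- apply/measurable_EFinP; exact: measurable_entropy_tail.
- by move=> x; rewrite lee_fin; apply: entropy_tail_ge0; [lra|exact: f0].
- by apply/measurable_EFinP; exact: measurable_funX.
- by move=> x; rewrite lee_fin sqr_ge0.
rewrite preimage_setT itvE.
under eq_integral do rewrite /f' opprK.
have fE x : f' (- x) = f x by rewrite /f' opprK.
move=> H; under eq_integral do rewrite -fE.
apply: H => //.
- by rewrite reflectionE itvE.
- by rewrite /f' opprK.
- move=> x mx; have := HB (- x); rewrite ltrNl => /(_ mx).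
  rewrite -integral_density_powN// opprK.
  by rewrite /mass_log reflectionE itvE'.
Qed.

(** * The upper bound *)

Lemma integral_probability_cst (R : realType) (mu : probability (measurableTypeR R) R)
    (k : R) : (\int[mu]_x k%:E = k%:E)%E.
Proof.
by rewrite integral_cst// -[RHS]mule1; congr (_ * _)%E; exact: probability_setT.
Qed.

Lemma sqr_slope_le_energy (R : realType) (q : R) (f n : R -> R) (x : R) :
  0 <= n x -> f x != 0 -> local_slope f x ^+ 2 * n x <= hq_energy q f n x.
Proof.
move=> n0 fx; rewrite /hq_energy ler_wpM2r//.
apply: (@le_trans _ _ ((local_slope f x / f x) ^+ 2 * f x ^+ 2)).
  by rewrite -exprMn divfK.
by rewrite ler_wpM2r ?sqr_ge0// sqr_le_Hq.
Qed.

Lemma max_contr (R : realType) (f : R -> R) (e x y : R) :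
  `|Num.max (f x) e - Num.max (f y) e| <= 1 * `|f x - f y|.
Proof.
rewrite mul1r; case: (leP (f x) e) => h1; case: (leP (f y) e) => h2; rewrite ?lexx//.
- by rewrite subrr normr0.
- rewrite ler0_norm ?subr_le0 ?(ltW h2)// ler0_norm ?subr_le0 ?(le_trans h1 (ltW h2))//; lra.
- rewrite ger0_norm ?subr_ge0 ?(ltW h1)// ger0_norm ?subr_ge0 ?(le_trans h2 (ltW h1))//; lra.
Qed.

(** Where f < e the maximum is locally constant; where f >= e > 0 the quotient by f in the energy is
    a true quotient and H_q dominates the square. *)
Lemma sqr_slope_max_le_energy (R : realType) (q e : R) (f n : R -> R) (x : R) :
  locally_lipschitz f -> 0 <= n x -> 0 < e ->
  local_slope (fun y => Num.max (f y) e) x ^+ 2 * n x <= hq_energy q f n x.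
Proof.
move=> lf n0 e0.
have lg : locally_lipschitz (fun y => Num.max (f y) e).
  exact: locally_lipschitz_dominated lf ler01 (max_contr f e).
have [fe|ef] := ltP (f x) e.
  have [r /= r0 Hr] : \forall y \near x, f y < e.
    have cf := locally_lipschitz_continuous lf.
    by exact: (cvgr_lt _ (cf x)).
  rewrite (@local_slope_near_cst _ _ _ (r / 2))//.
  - by rewrite expr0n/= mul0r hq_energy_ge0.
  - exact: divr_gt0.
  - move=> y yr; rewrite !max_r ?(ltW fe)//; apply: ltW; apply: Hr.
    by rewrite /= (le_lt_trans yr)// ltr_pdivrMr//; lra.
apply: le_trans (sqr_slope_le_energy q n0 _); last by rewrite gt_eqF// (lt_le_trans e0).
rewrite ler_wpM2r// lerXn2r ?nnegrE ?local_slope_ge0//.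
rewrite -[leRHS]mul1r; exact: local_slope_dominated lf ler01 (max_contr f e).
Qed.

Definition poincare_admissible (R : realType) (mu : probability (measurableTypeR R) R)
    (n : R -> R) (C : R) := forall f : R -> R, locally_lipschitz f ->
  ('V_mu[f] <= C%:E * \int[lebesgue_measure]_x (local_slope f x ^+ 2 * n x)%:E)%E.

Lemma measurable_sqr_slope (R : realType) (f n : R -> R) : locally_lipschitz f ->
  measurable_fun [set: measurableTypeR R] n ->
  measurable_fun [set: measurableTypeR R] (fun x => local_slope f x ^+ 2 * n x).
Proof.
move=> lf mn; apply: measurable_funM => //; apply: measurable_funX.
exact: measurable_local_slope.
Qed.

(* [f \max e] is used because the energy vanishes on the zero set of [f],
   where the slope need not. *)
Lemma poincare_max (R : realType) (mu : probability (measurableTypeR R) R)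
    (q C e : R) (f n : R -> R) :
  poincare_admissible mu n C -> 0 <= C ->
  locally_lipschitz f -> measurable_fun [set: measurableTypeR R] n ->
  (forall x, 0 <= n x) -> 0 < e ->
  exists c, (\int[mu]_x ((Num.max (f x) e - c) ^+ 2)%:E <=
    C%:E * \int[lebesgue_measure]_x (hq_energy q f n x)%:E)%E.
Proof.
move=> HC C0 lf mn n0 e0.
have lg : locally_lipschitz (fun y => Num.max (f y) e).
  exact: locally_lipschitz_dominated lf ler01 (max_contr f e).
exists (fine 'E_mu[fun y => Num.max (f y) e]).
rewrite -variance_integral; apply: le_trans (HC _ lg) _.
apply: lee_wpmul2l; first by rewrite lee_fin.
apply: ge0_le_integral => //.
- by move=> x _; rewrite lee_fin mulr_ge0 ?sqr_ge0.
- by apply/measurable_EFinP; exact: measurable_sqr_slope.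
- by apply/measurable_EFinP; exact: measurable_hq_energy.
- by move=> x _; rewrite lee_fin; exact: sqr_slope_max_le_energy.
Qed.

(** This keeps [entropy] away from its default value +oo: the Poincare bound on g = max(f, 1)
    controls the integral of (g - c)^2, and g^2 <= 2 (g - c)^2 + 2 c^2. *)
Lemma sqr_integrable_of_energy (R : realType) (mu : probability (measurableTypeR R) R)
    (q C : R) (f n : R -> R) :
  poincare_admissible mu n C -> 0 <= C ->
  locally_lipschitz f -> (forall x, 0 <= f x) ->
  measurable_fun [set: measurableTypeR R] n -> (forall x, 0 <= n x) ->
  (\int[lebesgue_measure]_x (hq_energy q f n x)%:E < +oo)%E ->
  (\int[mu]_x (f x ^+ 2)%:E < +oo)%E.
Proof.
move=> HC C0 lf f0 mn n0 Ioo.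
have [c Hc] := poincare_max q HC C0 lf mn n0 ltr01.
have mf : measurable_fun [set: measurableTypeR R] f.
  exact: measurable_locally_lipschitz lf.
have mg : measurable_fun [set: measurableTypeR R] (fun x => (Num.max (f x) 1 - c) ^+ 2).
  by apply: measurable_funX; apply: measurable_funB => //; exact: measurable_maxr.
apply: (@le_lt_trans _ _ (\int[mu]_x (2%:E * ((Num.max (f x) 1 - c) ^+ 2)%:E + (2 * c ^+ 2)%:E))%E).
  apply: ge0_le_integral => //.
  - by move=> x _; rewrite lee_fin sqr_ge0.
  - by apply/measurable_EFinP; exact: measurable_funX.
  - apply: emeasurable_funD => //; apply: emeasurable_funM => //; exact/measurable_EFinP.
  - move=> x _; rewrite -EFinM -EFinD lee_fin.
    set g := Num.max _ _; have fg : f x <= g by rewrite le_max lexx.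
    apply: (@le_trans _ _ (g ^+ 2)).
      by rewrite lerXn2r ?nnegrE// (le_trans (f0 x)).
    by rewrite -subr_ge0 (_ : _ - _ = (g - 2 * c) ^+ 2) ?sqr_ge0//; ring.
rewrite ge0_integralD//; last 3 first.
- by move=> x _; rewrite -EFinM lee_fin mulr_ge0 ?sqr_ge0.
- by apply: emeasurable_funM => //; exact/measurable_EFinP.
- by move=> x _; rewrite lee_fin mulr_ge0 ?sqr_ge0.
rewrite ge0_integralZl//; last 2 first.
- exact/measurable_EFinP.
- by move=> x _; rewrite lee_fin sqr_ge0.
rewrite integral_probability_cst lte_add_pinfty ?ltry//.
apply: lte_mul_pinfty => //; apply: le_lt_trans Hc _.
exact: lte_mul_pinfty.
Qed.

Lemma Rintegral_sqrB (R : realType) (mu : probability (measurableTypeR R) R)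
    (f : R -> R) (c : R) :
  measurable_fun [set: measurableTypeR R] f -> (\int[mu]_x (f x ^+ 2)%:E < +oo)%E ->
  (\int[mu]_x ((f x - c) ^+ 2)%:E =
   (fine (\int[mu]_x (f x ^+ 2)%:E)%E - 2 * c * fine (\int[mu]_x (f x)%:E)%E + c ^+ 2)%:E)%E.
Proof.
move=> mf f2.
have i2 : mu.-integrable setT (EFin \o (fun x => f x ^+ 2)).
  apply/integrableP; split; first exact/measurable_EFinP/measurable_funX.
  by under eq_integral do rewrite /= ger0_norm ?sqr_ge0//.
have ic (k : R) : mu.-integrable setT (EFin \o cst k) by exact: finite_measure_integrable_cst.
have i1 : mu.-integrable setT (EFin \o f).
  have i12 : mu.-integrable setT (EFin \o (fun x => 1 + f x ^+ 2)).
    by apply: (integrableD measurableT (ic 1) i2).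
  apply: le_integrable i12 => //; first exact/measurable_EFinP.
  move=> x _; rewrite /= lee_fin [leRHS]ger0_norm ?addr_ge0 ?sqr_ge0//.
  by rewrite -[f x ^+ 2]real_normK ?num_real//; have := normr_ge0 (f x); nra.
have i3 : mu.-integrable setT (EFin \o (fun x => - (2 * c) * f x)).
  exact: (integrableZl measurableT (- (2 * c)) i1).
have i4 : mu.-integrable setT (EFin \o (fun x => - (2 * c) * f x + c ^+ 2)).
  exact: (integrableD measurableT i3 (ic _)).
have i5 : mu.-integrable setT (EFin \o (fun x => (f x - c) ^+ 2)).
  rewrite (_ : (fun x => _) = (fun x => f x ^+ 2 + (- (2 * c) * f x + c ^+ 2))).
    exact: (integrableD measurableT i2 i4).
  by apply/funext => x; ring.
rewrite -[LHS]fineK; last exact: (integrable_fin_num measurableT i5).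
congr EFin; rewrite -![fine _]/(Rintegral _ _ _).
transitivity (\int[mu]_x (f x ^+ 2 + (- (2 * c) * f x + c ^+ 2)))%R.
  by apply: eq_Rintegral => x _; ring.
rewrite (RintegralD measurableT i2 i4) (RintegralD measurableT i3 (ic _)).
rewrite (RintegralZl (- (2 * c)) measurableT i1).
rewrite (_ : (\int[mu]_x c ^+ 2)%R = c ^+ 2); first by ring.
by rewrite /Rintegral integral_probability_cst.
Qed.

(** If e is the mean of f, the left-hand side is 2 - 2e <= 2 (1 - e^2), as 0 <= e <= 1, which is
    twice the variance. The other factor 2 is lost when f is compared with max(f, d), d -> 0. *)
Lemma variance_energy_bound (R : realType) (mu : probability (measurableTypeR R) R)
    (q C : R) (f n : R -> R) :
  poincare_admissible mu n C -> 0 <= C ->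
  locally_lipschitz f -> (forall x, 0 <= f x) ->
  measurable_fun [set: measurableTypeR R] n -> (forall x, 0 <= n x) ->
  (\int[lebesgue_measure]_x (hq_energy q f n x)%:E < +oo)%E ->
  (\int[mu]_x (f x ^+ 2)%:E = 1)%E ->
  (\int[mu]_x ((f x - 1) ^+ 2)%:E <=
   (4 * C)%:E * \int[lebesgue_measure]_x (hq_energy q f n x)%:E)%E.
Proof.
move=> HC C0 lf f0 mn n0 Ioo f1.
have mf : measurable_fun [set: measurableTypeR R] f.
  exact: measurable_locally_lipschitz lf.
have I0 : (0%:E <= \int[lebesgue_measure]_x (hq_energy q f n x)%:E)%E.
  by apply: integral_ge0 => z _; rewrite lee_fin hq_energy_ge0.
move: I0 Ioo; case IE : (\int[lebesgue_measure]_x _)%E => [I||]//; rewrite lee_fin => I0 _.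
have f2 : (\int[mu]_x (f x ^+ 2)%:E < +oo)%E by rewrite f1 ltry.
have Q c := Rintegral_sqrB c mf f2; rewrite f1 /= in Q.
set e := fine _ in Q.
have e0 : 0 <= e by apply/fine_ge0/integral_ge0 => x _; rewrite lee_fin.
have e1 : e ^+ 2 <= 1.
  have : (0%:E <= \int[mu]_x ((f x - e) ^+ 2)%:E)%E.
    by apply: integral_ge0 => x _; rewrite lee_fin sqr_ge0.
  by rewrite Q lee_fin; lra.
have He d : 0 < d -> 1 - e ^+ 2 <= 2 * C * I + 2 * d ^+ 2.
  move=> d0; have [c Hc] := poincare_max q HC C0 lf mn n0 d0.
  have mg : measurable_fun [set: measurableTypeR R] (fun x => (Num.max (f x) d - c) ^+ 2).
    by apply: measurable_funX; apply: measurable_funB => //; exact: measurable_maxr.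
  apply: (@le_trans _ _ (1 - 2 * c * e + c ^+ 2)).
    by rewrite -subr_ge0 (_ : _ - _ = (c - e) ^+ 2) ?sqr_ge0//; ring.
  rewrite -lee_fin -Q.
  apply: (@le_trans _ _ (\int[mu]_x (2%:E * ((Num.max (f x) d - c) ^+ 2)%:E + (2 * d ^+ 2)%:E))%E).
    apply: ge0_le_integral => //.
    - by move=> x _; rewrite lee_fin sqr_ge0.
    - by apply/measurable_EFinP/measurable_funX; exact: measurable_funB.
    - by apply: emeasurable_funD => //; apply: emeasurable_funM => //; exact/measurable_EFinP.
    - move=> x _; rewrite -EFinM -EFinD lee_fin.
      set g := Num.max _ _; have fg : f x <= g by rewrite le_max lexx.
      have gf : g <= f x + d by rewrite ge_max lerDl (ltW d0)/= lerDr.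
      have : (f x - g) ^+ 2 <= d ^+ 2 by nra.
      have : 0 <= (g - c - (f x - g)) ^+ 2 by exact: sqr_ge0.
      by nra.
  rewrite ge0_integralD//; last 3 first.
  - by move=> x _; rewrite -EFinM lee_fin mulr_ge0 ?sqr_ge0.
  - by apply: emeasurable_funM => //; exact/measurable_EFinP.
  - by move=> x _; rewrite lee_fin mulr_ge0 ?sqr_ge0.
  rewrite ge0_integralZl//; last 2 first.
  - exact/measurable_EFinP.
  - by move=> x _; rewrite lee_fin sqr_ge0.
  rewrite integral_probability_cst [leRHS]EFinD; apply: leeD2r.
  rewrite -mulrA EFinM; apply: lee_wpmul2l => //; rewrite EFinM -IE.
  exact: Hc.
rewrite Q -EFinM lee_fin.
have : 1 - e ^+ 2 <= 2 * C * I.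
  apply/ler_addgt0Pr => d d0; pose d' := Num.min 1 (d / 2).
  have d'0 : 0 < d' by rewrite lt_min ltr01 divr_gt0.
  have d'1 : d' <= 1 by rewrite ge_min lexx.
  have d'd : d' <= d / 2 by rewrite ge_min lexx orbT.
  by have := He _ d'0; nra.
by nra.
Qed.

(** By Chebyshev {f >= 2} has mass at most 1/4, so f reaches 2 at some y > m with mass at least 1/4
    on [y, +oo[. Poincare is applied to f frozen outside [m, y], where f >= 2: it equals f(m) with
    mass 1/2 and 2 with mass 1/4, and the minimum over c of (f(m) - c)^2 / 2 + (2 - c)^2 / 4 is
    (f(m) - 2)^2 / 6. *)
Lemma peak_energy_bound (R : realType) (mu : probability (measurableTypeR R) R)
    (q C m : R) (f n : R -> R) :
  poincare_admissible mu n C -> 0 <= C ->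
  locally_lipschitz f -> (forall x, 0 <= f x) ->
  measurable_fun [set: measurableTypeR R] n -> (forall x, 0 <= n x) ->
  (\int[mu]_x (f x ^+ 2)%:E <= 1)%E -> is_median mu m -> 2 < f m ->
  (((f m - 2) ^+ 2)%:E <=
   (6 * C)%:E * \int[lebesgue_measure]_x (hq_energy q f n x)%:E)%E.
Proof.
move=> HC C0 lf f0 mn n0 f1 [ml mr] fm.
have cf := locally_lipschitz_continuous lf.
have mf : measurable_fun [set: measurableTypeR R] f by exact: continuous_measurable_fun.
have mf2 : measurable_fun [set: measurableTypeR R] (fun x => f x ^+ 2).
  exact: measurable_funX.
pose A : set (measurableTypeR R) := [set x | 2 <= f x].
have mA : measurable A.
  by rewrite -[X in measurable X]setTI; apply: measurable_fun_le => //; exact: measurable_cst.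
have muA : (mu A <= (4^-1)%:E)%E.
  have : (4%:E * mu A <= 1)%E.
    rewrite -integral_cst//.
    apply: (@le_trans _ _ (\int[mu]_(x in A) (f x ^+ 2)%:E)%E).
      apply: ge0_le_integral => //.
      - by move=> x _; rewrite lee_fin.
      - by apply/measurable_EFinP; exact: measurable_funTS.
      - by move=> x; rewrite /A/= lee_fin => h; nra.
    apply: le_trans f1; apply: ge0_subset_integral => //.
    - exact/measurable_EFinP.
    - by move=> x _; rewrite lee_fin sqr_ge0.
  have fA : mu A \is a fin_num by exact: fin_num_measure.
  by rewrite -(fineK fA) -EFinM !lee_fin; lra.
(* A point to the right of [m] is either beyond [y] or in the set where f >= 2, so 1/2 - 1/4 of the
   mass lies beyond [y]. *)
have muN (y : R) : (forall z, m <= z -> ~ A z -> y <= z) -> ((4^-1)%:E <= mu `[y, +oo[%classic)%E.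
  move=> Hy.
  have : (mu `[m, +oo[%classic <= mu (`[y, +oo[%classic `|` A))%E.
    apply: le_measure; rewrite ?inE//; first exact: measurableU.
    move=> z; rewrite /= !in_itv/= !andbT => mz.
    by have [zA|zA] := pselect (A z); [right|left; exact: Hy].
  move=> /(le_trans mr)/le_trans/(_ (measureU2 _ _ _)) => /(_ _ mA) H.
  have {}H : ((2^-1)%:E <= mu `[y, +oo[%classic + (4^-1)%:E)%E.
    by apply: le_trans (H _) _ => //; exact: leeD2l.
  have fy : mu `[y, +oo[%classic \is a fin_num by exact: fin_num_measure.
  by move: H; rewrite -(fineK fy) -EFinD !lee_fin; lra.
have [y0 my0 fy0] : exists2 y0, m <= y0 & f y0 <= 2.
  apply: contrapT => H.
  have mA' : (mu `[m, +oo[%classic <= mu A)%E.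
    apply: le_measure; rewrite ?inE// => z; rewrite /= in_itv/= andbT => mz.
    by rewrite /A/= leNgt; apply/negP => /ltW fz; apply: H; exists z.
  by have := le_trans (le_trans mr mA') muA; rewrite lee_fin; lra.
have cNf : continuous (fun x => - f x) by move=> x; apply: cvgN; exact: cf.
have h1 : - f m <= - 2 by rewrite lerN2 ltW.
have h2 : - 2 <= - f y0 by rewrite lerN2.
have [y [/andP[my _] fyE Hy]] := first_hitting cNf h1 my0 h2.
have fy : f y = 2 by apply/eqP; rewrite -eqr_opp fyE.
have muy : ((4^-1)%:E <= mu `[y, +oo[%classic)%E.
  apply: muN => z mz zA; rewrite leNgt; apply/negP => zy; apply: zA.
  by rewrite /A/= ltW// -ltrN2 Hy.
pose v := f \o clamp m y.
have lv : locally_lipschitz v by exact: locally_lipschitz_clamp.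
have := HC _ lv; rewrite variance_integral; set c := fine _ => Hv.
have Hs : (\int[lebesgue_measure]_x (local_slope v x ^+ 2 * n x)%:E <=
    \int[lebesgue_measure]_x (hq_energy q f n x)%:E)%E.
  apply: ge0_le_integral => //.
  - by move=> x _; rewrite lee_fin mulr_ge0 ?sqr_ge0.
  - by apply/measurable_EFinP; exact: measurable_sqr_slope.
  - by apply/measurable_EFinP; exact: measurable_hq_energy.
  - move=> x _; rewrite lee_fin.
    have [xmy|xmy] := boolP (m <= x <= y); last first.
      by rewrite local_slope_clamp_out// expr0n/= mul0r hq_energy_ge0.
    apply: (@le_trans _ _ (local_slope f x ^+ 2 * n x)).
      rewrite ler_wpM2r// lerXn2r ?nnegrE ?local_slope_ge0//.
      exact: local_slope_clamp_le.
    apply: sqr_slope_le_energy => //; rewrite gt_eqF//.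
    have /andP[mx xy] := xmy; move: xy; rewrite le_eqVlt => /predU1P[->|xy].
      by rewrite fy.
    by rewrite (@lt_trans _ _ 2)// -ltrN2 Hy.
have {}Hv := le_trans Hv (lee_wpmul2l (_ : 0%:E <= C%:E)%E Hs).
have {}Hv : (\int[mu]_x ((v x - c) ^+ 2)%:E <=
     C%:E * \int[lebesgue_measure]_x (hq_energy q f n x)%:E)%E by apply: Hv; rewrite lee_fin.
have p6 : (0%:E <= 6%:E :> \bar R)%E by rewrite lee_fin.
rewrite [(6 * C)%:E]EFinM -muleA; apply: le_trans (lee_wpmul2l p6 Hv).
have mv2 : measurable_fun [set: measurableTypeR R] (fun x => (v x - c) ^+ 2).
  apply: measurable_funX; apply: measurable_funB => //.
  exact: measurable_locally_lipschitz lv.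
have v20 x : (0%:E <= ((v x - c) ^+ 2)%:E)%E by rewrite lee_fin sqr_ge0.
have Hl : ((2^-1 * (f m - c) ^+ 2)%:E <= \int[mu]_(x in `]-oo, m]) ((v x - c) ^+ 2)%:E)%E.
  have -> : (\int[mu]_(x in `]-oo, m]) ((v x - c) ^+ 2)%:E =
      \int[mu]_(x in `]-oo, m]) (((f m - c) ^+ 2)%:E))%E.
    apply: eq_integral => x; rewrite inE/= in_itv/= => xm.
    by rewrite /v /= clamp_lo.
  by rewrite integral_cst// EFinM muleC lee_wpmul2l// lee_fin sqr_ge0.
have Hr : ((4^-1 * (2 - c) ^+ 2)%:E <= \int[mu]_(x in `[y, +oo[) ((v x - c) ^+ 2)%:E)%E.
  have -> : (\int[mu]_(x in `[y, +oo[) ((v x - c) ^+ 2)%:E =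
      \int[mu]_(x in `[y, +oo[) (((2 - c) ^+ 2)%:E))%E.
    apply: eq_integral => x; rewrite inE/= in_itv/= andbT => yx.
    by rewrite /v /= clamp_hi// fy.
  by rewrite integral_cst// EFinM muleC lee_wpmul2l// lee_fin sqr_ge0.
have ym : m < y.
  rewrite lt_neqAle my andbT; apply/eqP => E; have := fm; by rewrite E fy ltxx.
have Hsum : (\int[mu]_(x in `]-oo, m]) ((v x - c) ^+ 2)%:E +
   \int[mu]_(x in `[y, +oo[) ((v x - c) ^+ 2)%:E <= \int[mu]_x ((v x - c) ^+ 2)%:E)%E.
  rewrite -ge0_integral_setU//=.
  - apply: ge0_subset_integral => //; first exact: measurableU.
    exact/measurable_EFinP.
  - by apply/measurable_EFinP; exact: measurable_funTS.
  - rewrite disj_set2E; apply/eqP/seteqP; split=> z //= []; rewrite !in_itv/= andbT => zm yz.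
    by have := lt_le_trans ym (le_trans yz zm); rewrite ltxx.
apply: le_trans (lee_wpmul2l p6 (le_trans (leeD Hl Hr) Hsum)).
rewrite -EFinD -EFinM lee_fin -subr_ge0.
have -> : 6 * (2^-1 * (f m - c) ^+ 2 + 4^-1 * (2 - c) ^+ 2) - (f m - 2) ^+ 2 =
   2^-1 * (2 * (f m - c) + (2 - c)) ^+ 2 by field.
by rewrite mulr_ge0 ?sqr_ge0.
Qed.

(** * From the tail to the full entropy *)

Lemma ln2_ge_half (R : realType) : 2^-1 <= ln 2 :> R.
Proof.
have h : 0 < 2^-1 :> R by [].
by have := ln_inv_ge_1B h; rewrite invrK; lra.
Qed.

(** Above T the claim is T^2 ln s^2 <= s^2 ln T^2, the monotonicity of x / ln x beyond the number e.
    It follows from the tangent to ln at T^2 and ln T^2 >= 1. *)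
Lemma sqr_ln_le_tail (R : realType) (T s : R) : 6 <= T -> 0 <= s ->
  s ^+ 2 * ln (s ^+ 2) <= s ^+ 2 * ln (T ^+ 2) + entropy_tail T s.
Proof.
move=> T6 s0.
have T0 : 0 < T ^+ 2 by rewrite exprn_gt0//; lra.
have [Ts|sT] := leP T s; last first.
  rewrite /entropy_tail max_l; last by rewrite subr_le0 lerXn2r ?nnegrE ?(ltW sT)//; lra.
  rewrite mul0r addr0 ler_wpM2l ?sqr_ge0//.
  have [->|sN0] := eqVneq s 0.
    by rewrite expr0n/= ln0// ln_ge0//; nra.
  have s2 : 0 < s ^+ 2 by rewrite exprn_gt0// lt_def sN0.
  by rewrite ler_ln ?posrE// lerXn2r ?nnegrE ?(ltW sT)//; lra.
have sT2 : T ^+ 2 <= s ^+ 2 by rewrite lerXn2r ?nnegrE//; lra.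
rewrite /entropy_tail max_r ?subr_ge0//.
have s2 : 0 < s ^+ 2 by exact: lt_le_trans sT2.
suff : T ^+ 2 * ln (s ^+ 2) <= s ^+ 2 * ln (T ^+ 2) by lra.
set y := s ^+ 2 in sT2 s2 *; set Y := T ^+ 2 in sT2 T0 *.
have lY : 1 <= ln Y.
  have h1 : ln (2 ^+ 5) <= ln Y by rewrite ler_ln ?posrE// /Y; nra.
  have h2 : ln (2 ^+ 5) = 5 * ln 2 :> R by rewrite lnXn// mulr_natl.
  by have := ln2_ge_half R; lra.
have h : ln y <= ln Y + (y / Y - 1).
  have yY : 0 < y / Y by rewrite divr_gt0.
  by have := ln_le_sub1 yY; rewrite ln_div ?posrE//; lra.
have := ler_wpM2l (ltW T0) h.
have -> : Y * (ln Y + (y / Y - 1)) = Y * ln Y + (y - Y) by field; rewrite gt_eqF.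
have : 0 <= (y - Y) * (ln Y - 1) by rewrite mulr_ge0 ?subr_ge0.
by lra.
Qed.

(** For s <= 4, s^2 (s^2 - 1) = (s^2 - 1) + (s - 1)^2 (s + 1)^2 and (s + 1)^2 <= 25. For s > 4 the
    tail bound applies with ln T^2 <= 8, since (27/2)^2 <= 2^8. The term s^2 - 1 is kept because it
    integrates to 0. *)
Lemma sqr_ln_le_quadratic (R : realType) (s : R) : 0 <= s ->
  s ^+ 2 * ln (s ^+ 2) <=
  s ^+ 2 - 1 + 25 * (s - 1) ^+ 2 + entropy_tail (4 * (3 / 2) ^+ 3) s.
Proof.
move=> s0; have tl0 : 0 <= entropy_tail (4 * (3 / 2) ^+ 3) s.
  by apply: entropy_tail_ge0 => //; lra.
have [s4|s4] := leP s 4.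
  have [sE|sN0] := eqVneq s 0; first by rewrite sE expr0n/= mul0r; rewrite sE in tl0; lra.
  have s2 : 0 < s ^+ 2 by rewrite exprn_gt0// lt_def sN0.
  have := ler_wpM2l (ltW s2) (ln_le_sub1 s2) => H; apply: (le_trans H).
  have : 0 <= (s - 1) ^+ 2 * (25 - (s + 1) ^+ 2).
    by rewrite mulr_ge0 ?sqr_ge0//; nra.
  have -> : (s - 1) ^+ 2 * (25 - (s + 1) ^+ 2) = 25 * (s - 1) ^+ 2 - (s ^+ 2 - 1) ^+ 2 by ring.
  by lra.
have T6 : 6 <= 4 * (3 / 2) ^+ 3 :> R by lra.
apply: (le_trans (sqr_ln_le_tail T6 s0)); rewrite lerD2r.
have : ln ((4 * (3 / 2) ^+ 3) ^+ 2) <= 8 :> R.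
  apply: (@le_trans _ _ (ln (2 ^+ 8))).
    by rewrite ler_ln ?posrE//; lra.
  have h2 : ln (2 ^+ 8) = 8 * ln 2 :> R by rewrite lnXn// mulr_natl.
  by have := @ln_le_sub1 R 2 (ltr0Sn _ _); lra.
move=> /(ler_wpM2l (sqr_ge0 s)) H; apply: (le_trans H); nra.
Qed.

Lemma ge0_integrable (R : realType) (mu : {measure set (measurableTypeR R) -> \bar R})
    (g : R -> R) :
  measurable_fun [set: measurableTypeR R] g -> (forall x, 0 <= g x) ->
  (\int[mu]_x (g x)%:E < +oo)%E -> mu.-integrable setT (EFin \o g).
Proof.
move=> mg g0 goo; apply/integrableP; split; first exact/measurable_EFinP.
by under eq_integral do rewrite /= ger0_norm//.
Qed.

Lemma le_integral_of_lower (R : realType) (mu : probability (measurableTypeR R) R)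
    (phi psi : R -> R) :
  measurable_fun [set: measurableTypeR R] phi -> mu.-integrable setT (EFin \o psi) ->
  (forall x, - 1 <= phi x <= psi x) ->
  (\int[mu]_x (phi x)%:E <= \int[mu]_x (psi x)%:E)%E.
Proof.
move=> mphi ipsi pp.
have ic : mu.-integrable setT (EFin \o cst (1 : R)) by exact: finite_measure_integrable_cst.
have i1 : mu.-integrable setT (EFin \o (fun x => 1 + `|psi x|)).
  exact: (integrableD measurableT ic (integrable_norm ipsi)).
apply: le_integral => //.
  apply: le_integrable i1 => //; first exact/measurable_EFinP.
  move=> x _; rewrite /= lee_fin [leRHS]ger0_norm ?addr_ge0//.
  have /andP[h1 h2] := pp x; rewrite ler_norml.
  have := ler_norm (psi x); have := normr_ge0 (psi x) => h3 h4.
  by apply/andP; split; lra.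
by move=> x _; rewrite lee_fin; have /andP[] := pp x.
Qed.

Lemma mul_ln_ge (R : realType) (y : R) : 0 <= y -> - 1 <= y * ln y.
Proof.
move=> y0; have [->|yN0] := eqVneq y 0; first by rewrite mul0r; lra.
have yp : 0 < y by rewrite lt_def yN0.
have iy : 0 < y^-1 by rewrite invr_gt0.
have := ln_le_sub1 iy; rewrite lnV ?posrE// => h.
have := ler_wpM2l y0 h; rewrite mulrN mulrBr divff// mulr1; lra.
Qed.

Lemma entropy_tail_total (R : realType) (mu : probability (measurableTypeR R) R)
    (q m t0 B : R) (f n : R -> R) :
  locally_lipschitz f -> (forall x, 0 <= f x) ->
  measurable_fun [set: measurableTypeR R] n -> (forall x, 0 <= n x) -> 2 <= q ->
  (\int[mu]_x (f x ^+ 2)%:E <= 1)%E -> is_median mu m ->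
  4 <= t0 -> f m <= t0 -> 0 <= B ->
  (\int[lebesgue_measure]_z (hq_energy q f n z)%:E < +oo)%E ->
  (forall x, m < x -> (mass_log mu `[x, +oo[%classic *
      (\int[lebesgue_measure]_(t in `[m, x]) density_pow q n t) `^ (q - 1) <= B%:E)%E) ->
  (forall x, x < m -> (mass_log mu `]-oo, x]%classic *
      (\int[lebesgue_measure]_(t in `[x, m]) density_pow q n t) `^ (q - 1) <= B%:E)%E) ->
  (\int[mu]_x (entropy_tail (t0 * (3 / 2) ^+ 3)%R (f x))%:E <=
   (2 `^ (q + 1) * B)%:E * \int[lebesgue_measure]_z (hq_energy q f n z)%:E)%E.
Proof.
move=> lf f0 mn n0 q2 f1 [ml mr] t4 fm B0 Ioo HBp HBm.
have mf : measurable_fun [set: measurableTypeR R] f.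
  exact: measurable_locally_lipschitz lf.
set T := t0 * _; have T1 : 1 <= T by rewrite /T; lra.
have mt : measurable_fun [set: measurableTypeR R] (fun x => (entropy_tail T (f x))%:E).
  by apply/measurable_EFinP; exact: measurable_entropy_tail.
have tl0 x : (0%:E <= (entropy_tail T (f x))%:E)%E by rewrite lee_fin entropy_tail_ge0.
have mE : measurable_fun [set: measurableTypeR R] (fun x => (hq_energy q f n x)%:E).
  by apply/measurable_EFinP; exact: measurable_hq_energy.
have E0 x : (0%:E <= (hq_energy q f n x)%:E)%E by rewrite lee_fin hq_energy_ge0.
have sub (A : set R) : measurable (A : set (measurableTypeR R)) ->
    (\int[lebesgue_measure]_(z in A) (hq_energy q f n z)%:E <=
     \int[lebesgue_measure]_z (hq_energy q f n z)%:E)%E.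
  by move=> mA; apply: ge0_subset_integral.
have mur : (mu `]m, +oo[%classic <= (2^-1)%:E)%E.
  have -> : `]m, +oo[%classic = ~` `]-oo, m]%classic :> set (measurableTypeR R).
    by apply/seteqP; split => z /=; rewrite !in_itv/= andbT ltNge => /negP.
  rewrite probability_setC//.
  have fA : mu `]-oo, m]%classic \is a fin_num by exact: fin_num_measure.
  by move: ml; rewrite -(fineK fA) -EFinB !lee_fin; lra.
have mul : (mu `]-oo, m[%classic <= (2^-1)%:E)%E.
  have -> : `]-oo, m[%classic = ~` `[m, +oo[%classic :> set (measurableTypeR R).
    by apply/seteqP; split => z /=; rewrite !in_itv/= andbT ltNge => /negP.
  rewrite probability_setC//.
  have fA : mu `[m, +oo[%classic \is a fin_num by exact: fin_num_measure.
  by move: mr; rewrite -(fineK fA) -EFinB !lee_fin; lra.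
have Rr := entropy_tail_right lf f0 mn n0 q2 f1 mur t4 fm B0 (le_lt_trans (sub _ _) Ioo) HBp.
have Rl := entropy_tail_left lf f0 mn n0 q2 f1 mul t4 fm B0 (le_lt_trans (sub _ _) Ioo) HBm.
have setTE : [set: measurableTypeR R] = `]-oo, m[%classic `|` ([set m] `|` `]m, +oo[%classic).
  apply/seteqP; split => // x _ /=; rewrite !in_itv/= andbT.
  by case: (ltgtP x m) => [||->]; [left|right; right|right; left].
(* An atom of the measure at [m] belongs to neither half-line; it contributes nothing because f(m)
   lies below the threshold. *)
have tm : entropy_tail T (f m) = 0.
  rewrite /entropy_tail max_l ?mul0r// subr_le0 lerXn2r ?nnegrE//; first lra.
  by rewrite (le_trans fm)// /T; lra.
have -> : (\int[mu]_x (entropy_tail T (f x))%:E =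
    \int[mu]_(x in `]-oo, m[) (entropy_tail T (f x))%:E +
    \int[mu]_(x in `]m, +oo[) (entropy_tail T (f x))%:E)%E.
  have mU : measurable ([set m] `|` `]m, +oo[%classic : set (measurableTypeR R)).
    exact: measurableU.
  rewrite setTE ge0_integral_setU//=; last 2 first.
  - exact: measurable_funTS.
  - rewrite disj_set2E; apply/eqP/seteqP; split=> z //= []; rewrite !in_itv/= => zm [zm'|].
      by move: zm; rewrite zm' ltxx.
    by rewrite andbT => /(lt_trans zm); rewrite ltxx.
  rewrite ge0_integral_setU//=; last 2 first.
  - exact: measurable_funTS.
  - by rewrite disj_set2E; apply/eqP/seteqP; split=> z //= [->]; rewrite in_itv/= ltxx.
  rewrite [X in (_ + (X + _))%E](_ : _ = 0%E) ?add0e//.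
  by apply: integral0_eq => x ->; rewrite tm.
apply: (le_trans (leeD (Rl _) (Rr _))) => //.
rewrite -ge0_muleDr; last 2 first.
- by apply: integral_ge0 => x _; exact: E0.
- by apply: integral_ge0 => x _; exact: E0.
apply: lee_wpmul2l; first by rewrite lee_fin mulr_ge0 ?powR_ge0.
rewrite -ge0_integral_setU//=.
- by apply: sub; exact: measurableU.
- exact: measurable_funTS.
- rewrite disj_set2E; apply/eqP/seteqP; split=> z //= []; rewrite !in_itv/= andbT => zm.
  by move=> /(lt_trans zm); rewrite ltxx.
Qed.

Lemma entropy_le_energy_normalized (R : realType) (mu : probability (measurableTypeR R) R)
    (q m C B : R) (f n : R -> R) :
  poincare_admissible mu n C -> 0 <= C ->
  locally_lipschitz f -> (forall x, 0 <= f x) ->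
  measurable_fun [set: measurableTypeR R] n -> (forall x, 0 <= n x) -> 2 <= q ->
  is_median mu m -> 0 <= B ->
  (forall x, m < x -> (mass_log mu `[x, +oo[%classic *
      (\int[lebesgue_measure]_(t in `[m, x]) density_pow q n t) `^ (q - 1) <= B%:E)%E) ->
  (forall x, x < m -> (mass_log mu `]-oo, x]%classic *
      (\int[lebesgue_measure]_(t in `[x, m]) density_pow q n t) `^ (q - 1) <= B%:E)%E) ->
  (\int[lebesgue_measure]_x (hq_energy q f n x)%:E < +oo)%E ->
  (\int[mu]_x (f x ^+ 2)%:E = 1)%E ->
  (\int[mu]_x (f x ^+ 2 * ln (f x ^+ 2))%:E <=
   (235 * C + 2 `^ (q + 1) * B)%:E *
   \int[lebesgue_measure]_x (hq_energy q f n x)%:E)%E.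
Proof.
move=> HC C0 lf f0 mn n0 q2 med B0 HBp HBm Ioo f1.
have mf : measurable_fun [set: measurableTypeR R] f.
  exact: measurable_locally_lipschitz lf.
have mf2 : measurable_fun [set: measurableTypeR R] (fun x => f x ^+ 2).
  exact: measurable_funX.
have mphi : measurable_fun [set: measurableTypeR R] (fun x => f x ^+ 2 * ln (f x ^+ 2)).
  by apply: measurable_funM => //; exact: measurableT_comp.
have I0 : (0%:E <= \int[lebesgue_measure]_x (hq_energy q f n x)%:E)%E.
  by apply: integral_ge0 => z _; rewrite lee_fin hq_energy_ge0.
have f1' : (\int[mu]_x (f x ^+ 2)%:E <= 1)%E by rewrite f1.
have f2 : (\int[mu]_x (f x ^+ 2)%:E < +oo)%E by rewrite f1 ltry.
have V := variance_energy_bound HC C0 lf f0 mn n0 Ioo f1.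
have P := peak_energy_bound q HC C0 lf f0 mn n0 f1' med.
pose t0 := Num.max (f m) 4.
have t4 : 4 <= t0 by rewrite le_max lexx orbT.
have fm : f m <= t0 by rewrite le_max lexx.
have TL := entropy_tail_total lf f0 mn n0 q2 f1' med t4 fm B0 Ioo HBp HBm.
set T := t0 * _ in TL.
have T1 : 1 <= T by rewrite /T; lra.
move: I0 Ioo V P TL; case IE : (\int[lebesgue_measure]_x _)%E => [I||]//.
rewrite lee_fin => I0 _ V P TL.
have tl0 x : 0 <= entropy_tail T (f x) by exact: entropy_tail_ge0.
have it : mu.-integrable setT (EFin \o (fun x => entropy_tail T (f x))).
  apply: ge0_integrable => //; first exact: measurable_entropy_tail.
  by apply: le_lt_trans TL _; rewrite -EFinM ltry.
have i2 : mu.-integrable setT (EFin \o (fun x => f x ^+ 2)).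
  by apply: ge0_integrable => // x; exact: sqr_ge0.
have ic (k : R) : mu.-integrable setT (EFin \o cst k) by exact: finite_measure_integrable_cst.
have Rc (k : R) : (\int[mu]_x k)%R = k by rewrite /Rintegral integral_probability_cst.
have R2 : (\int[mu]_x f x ^+ 2)%R = 1 by rewrite /Rintegral f1.
have Rt : (\int[mu]_x entropy_tail T (f x))%R <= 2 `^ (q + 1) * B * I.
  rewrite -lee_fin /Rintegral fineK; first by rewrite EFinM.
  exact: (integrable_fin_num measurableT it).
have phi_ge x : - 1 <= f x ^+ 2 * ln (f x ^+ 2) by rewrite mul_ln_ge ?sqr_ge0.
have [fm4|fm4] := leP (f m) 4.
(* Since s^2 - 1 integrates to 0, what remains besides the tail is 25 times the bound 4 C I, that is
   100 C I. *)
- have t0E : t0 = 4 by rewrite /t0 max_r.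
  have iq : mu.-integrable setT (EFin \o (fun x => (f x - 1) ^+ 2)).
    apply: ge0_integrable => [|x|]; [|exact: sqr_ge0|].
      by apply: measurable_funX; exact: measurable_funB.
    by apply: le_lt_trans V _; rewrite -EFinM ltry.
  have Rq : (\int[mu]_x (f x - 1) ^+ 2)%R <= 4 * C * I.
    rewrite -lee_fin /Rintegral fineK; first by rewrite EFinM.
    exact: (integrable_fin_num measurableT iq).
  have i3 := integrableZl measurableT 25 iq.
  have i4 := integrableD measurableT i3 it.
  have i5 := integrableD measurableT (ic (- 1)) i4.
  have i6 := integrableD measurableT i2 i5.
  have := @le_integral_of_lower R mu _
    (fun x => f x ^+ 2 + (- 1 + (25 * (f x - 1) ^+ 2 + entropy_tail T (f x)))) mphi i6.
  move=> /(_ _)/le_trans -> //.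
    move=> x; rewrite phi_ge/=; have := sqr_ln_le_quadratic (f0 x).
    by rewrite /T t0E; lra.
  rewrite -[X in (X <= _)%E]fineK; last exact: (integrable_fin_num measurableT i6).
  rewrite -EFinM lee_fin -[fine _]/(Rintegral _ _ _).
  rewrite (RintegralD measurableT i2 i5) (RintegralD measurableT (ic (- 1)) i4).
  rewrite (RintegralD measurableT i3 it) (RintegralZl 25 measurableT iq) R2 Rc.
  have CI : 0 <= C * I by rewrite mulr_ge0.
  by lra.
(* Now s^2 ln T^2 integrates to ln T^2 <= 2 (T - 1), affine in f(m), while 6 C I >= (f(m) - 2)^2 is
   quadratic; for f(m) > 4 the comparison holds well within the constant 235. *)
- have t0E : t0 = f m by rewrite /t0 max_l// ltW.
  have fm2 : 2 < f m by lra.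
  have {}P := P fm2; rewrite -EFinM lee_fin in P.
  have T6 : 6 <= T by rewrite /T; lra.
  have i3 : mu.-integrable setT (EFin \o (fun x => ln (T ^+ 2) * f x ^+ 2)).
    exact: (integrableZl measurableT _ i2).
  have i4 := integrableD measurableT i3 it.
  have := @le_integral_of_lower R mu _
    (fun x => ln (T ^+ 2) * f x ^+ 2 + entropy_tail T (f x)) mphi i4.
  move=> /(_ _)/le_trans -> //.
    by move=> x; rewrite phi_ge/= [_ * f x ^+ 2]mulrC; exact: sqr_ln_le_tail.
  rewrite -[X in (X <= _)%E]fineK; last exact: (integrable_fin_num measurableT i4).
  rewrite -EFinM lee_fin -[fine _]/(Rintegral _ _ _).
  rewrite (RintegralD measurableT i3 it) (RintegralZl _ measurableT i2) R2 mulr1.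
  suff : ln (T ^+ 2) <= 235 * C * I by lra.
  have TE : T = 27 / 8 * f m by rewrite /T t0E; field.
  have T0 : 0 < T by lra.
  rewrite lnXn// -mulr_natl.
  have := ln_le_sub1 T0.
  by nra.
Qed.

Lemma hq_energy_le_scale (R : realType) (q a : R) (f g n : R -> R) (x : R) :
  locally_lipschitz f -> locally_lipschitz g -> 0 <= q -> 0 < a -> 0 <= n x ->
  `|g x| = a * `|f x| -> local_slope g x <= a * local_slope f x ->
  hq_energy q g n x <= a ^+ 2 * hq_energy q f n x.
Proof.
move=> lf lg q0 a0 n0 gf sgf; rewrite /hq_energy [leRHS]mulrA ler_wpM2r//.
have -> : g x ^+ 2 = a ^+ 2 * f x ^+ 2.
  by rewrite -[g x ^+ 2]real_normK ?num_real// gf exprMn real_normK ?num_real.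
rewrite mulrCA ler_wpM2l ?sqr_ge0// ler_wpM2r ?sqr_ge0//.
apply: Hq_mono => //; rewrite !normrM !normfV gf.
have sg0 := local_slope_ge0 x lg; have sf0 := local_slope_ge0 x lf.
rewrite (ger0_norm sg0) (ger0_norm sf0) invfM mulrA ler_wpM2r ?invr_ge0//.
by rewrite ler_pdivrMr// mulrC.
Qed.

(** The integral is the difference of those of the positive and negative parts; the latter is at
    most 1, so a value below +oo forces the former to be finite. *)
Lemma integrable_of_lower (R : realType) (mu : probability (measurableTypeR R) R)
    (phi : R -> R) : measurable_fun [set: measurableTypeR R] phi ->
  (forall x, - 1 <= phi x) -> (\int[mu]_x (phi x)%:E < +oo)%E ->
  mu.-integrable setT (EFin \o phi).
Proof.
move=> mphi phi1; have mE : measurable_fun [set: measurableTypeR R] (EFin \o phi).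
  exact/measurable_EFinP.
rewrite integralE.
have neg : (\int[mu]_x (EFin \o phi)^\- x <= 1)%E.
  rewrite -[leRHS](integral_probability_cst mu 1); apply: ge0_le_integral => //.
  - exact: measurable_funeneg.
  - by move=> x _; rewrite funenegE/= ge_max !lee_fin lerNl phi1 ler01.
have neg0 : (0 <= \int[mu]_x (EFin \o phi)^\- x)%E by apply: integral_ge0.
move=> Ioo; apply/integrableP; split => //.
rewrite (_ : (\int[mu]_x `|(EFin \o phi) x| =
    \int[mu]_x ((EFin \o phi)^\+ x + (EFin \o phi)^\- x))%E); last first.
  apply: eq_integral => x _; rewrite funeposE funenegE /= -!EFin_max -EFinD.
  congr EFin; have /orP[h|h] := le_total 0 (phi x).
    by rewrite ger0_norm// max_l// max_r ?oppr_le0// addr0.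
  by rewrite ler0_norm// max_r// max_l ?oppr_ge0// add0r.
rewrite ge0_integralD//; last 2 first.
- exact: measurable_funepos.
- exact: measurable_funeneg.
apply: lte_add_pinfty; last exact: le_lt_trans neg (ltry _).
rewrite ltNge leye_eq; apply/negP => /eqP E; move: Ioo.
have Nf : (\int[mu]_x (EFin \o phi)^\- x)%E \is a fin_num.
  by rewrite ge0_fin_numE//; exact: le_lt_trans neg (ltry _).
by rewrite [X in (X - _)%E]E -(fineK Nf) -EFinN addye// ltxx.
Qed.

(** Both sides are homogeneous of degree 2, because H_q(f'/f) does not see a scaling of f. So f is
    divided by the square root of its second moment, unless that moment is 0 and f vanishes almost
    everywhere. *)
Lemma entropy_le_energy_nonneg (R : realType) (mu : probability (measurableTypeR R) R)
    (q m C B : R) (f n : R -> R) :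
  poincare_admissible mu n C -> 0 < C ->
  locally_lipschitz f -> (forall x, 0 <= f x) ->
  measurable_fun [set: measurableTypeR R] n -> (forall x, 0 <= n x) -> 2 <= q ->
  is_median mu m -> 0 <= B ->
  (forall x, m < x -> (mass_log mu `[x, +oo[%classic *
      (\int[lebesgue_measure]_(t in `[m, x]) density_pow q n t) `^ (q - 1) <= B%:E)%E) ->
  (forall x, x < m -> (mass_log mu `]-oo, x]%classic *
      (\int[lebesgue_measure]_(t in `[x, m]) density_pow q n t) `^ (q - 1) <= B%:E)%E) ->
  (entropy mu (fun x => f x ^+ 2)%R <=
   (235 * C + 2 `^ (q + 1) * B)%:E *
   \int[lebesgue_measure]_x (hq_energy q f n x)%:E)%E.
Proof.
move=> HC C0 lf f0 mn n0 q2 med B0 HBp HBm.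
set K := 235 * C + _.
have k0 : 0 < 235 :> R by rewrite ltr0n.
have K0 : 0 < K := ltr_pwDl (mulr_gt0 k0 C0) (mulr_ge0 (powR_ge0 _ _) B0).
have mf : measurable_fun [set: measurableTypeR R] f.
  exact: measurable_locally_lipschitz lf.
have mf2 : measurable_fun [set: measurableTypeR R] (fun x => f x ^+ 2).
  exact: measurable_funX.
have I0 : (0%:E <= \int[lebesgue_measure]_x (hq_energy q f n x)%:E)%E.
  by apply: integral_ge0 => z _; rewrite lee_fin hq_energy_ge0.
have [Ioo|] := ltP (\int[lebesgue_measure]_x (hq_energy q f n x)%:E)%E +oo%E; last first.
  by rewrite leye_eq => /eqP ->; rewrite gt0_muley ?lte_fin// leey.
have f2 := sqr_integrable_of_energy HC (ltW C0) lf f0 mn n0 Ioo.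
have f20 : (0%:E <= \int[mu]_x (f x ^+ 2)%:E)%E.
  by apply: integral_ge0 => x _; rewrite lee_fin sqr_ge0.
rewrite /entropy; move: f2 f20; case cE : (\int[mu]_x (f x ^+ 2)%:E)%E => [c||]//= _.
rewrite lee_fin le_eqVlt => /predU1P[c0|c0].
  rewrite -c0 mul0r oppr0 adde0 in cE *.
  have aef : ae_eq mu setT (fun x => (f x ^+ 2)%:E) (cst 0%E).
    apply/(ae_eq_integral_abs mu measurableT) => //; first exact/measurable_EFinP.
    by under eq_integral do rewrite gee0_abs ?lee_fin ?sqr_ge0//.
  rewrite (@ae_eq_integral _ _ _ mu setT (cst 0%E))//.
  - by rewrite integral0 mule_ge0// lee_fin ltW.
  - by apply/measurable_EFinP/measurable_funM => //; exact: measurableT_comp.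
  - by apply: filterS aef => x /(_ I) [->] _; rewrite mul0r.
pose s := Num.sqrt c; have s0 : 0 < s by rewrite sqrtr_gt0.
have s2 : s ^+ 2 = c by rewrite sqr_sqrtr// ltW.
pose g x := s^-1 * f x.
have gf x y : `|g x - g y| <= s^-1 * `|f x - f y|.
  by rewrite /g -mulrBr normrM gtr0_norm// invr_gt0.
have is0 : 0 < s^-1 by rewrite invr_gt0.
have lg : locally_lipschitz g := locally_lipschitz_dominated lf (ltW is0) gf.
have g0 x : 0 <= g x by rewrite mulr_ge0// ltW.
have fg x : f x ^+ 2 = c * g x ^+ 2.
  by rewrite /g -s2; field; rewrite gt_eqF.
have gf2 x : g x ^+ 2 = c^-1 * f x ^+ 2 by rewrite fg mulrA mulVf ?mul1r// gt_eqF.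
have ic0 : 0 <= c^-1 by rewrite invr_ge0 ltW.
have g1 : (\int[mu]_x (g x ^+ 2)%:E = 1)%E.
  under eq_integral do rewrite gf2 EFinM.
  rewrite ge0_integralZl//; last 2 first.
  - exact/measurable_EFinP.
  - by move=> x _; rewrite lee_fin sqr_ge0.
  by rewrite cE -EFinM mulVf// gt_eqF.
have mEf : measurable_fun [set: measurableTypeR R] (fun x => (hq_energy q f n x)%:E).
  by apply/measurable_EFinP; exact: measurable_hq_energy.
have Ig : (\int[lebesgue_measure]_x (hq_energy q g n x)%:E <=
    (c^-1)%:E * \int[lebesgue_measure]_x (hq_energy q f n x)%:E)%E.
  rewrite -ge0_integralZl//; last first.
    by move=> x _; rewrite lee_fin hq_energy_ge0.
  apply: ge0_le_integral => //.
  - by move=> x _; rewrite lee_fin hq_energy_ge0.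
  - by apply/measurable_EFinP; exact: measurable_hq_energy.
  - exact: emeasurable_funM.
  - move=> x _; rewrite -EFinM lee_fin.
    have -> : c^-1 = s^-1 ^+ 2 by rewrite exprVn s2.
    apply: hq_energy_le_scale => //; first lra.
      by rewrite /g normrM gtr0_norm.
    exact: local_slope_dominated lf (ltW is0) gf.
have Igoo : (\int[lebesgue_measure]_x (hq_energy q g n x)%:E < +oo)%E.
  by apply: le_lt_trans Ig _; exact: lte_mul_pinfty.
have N := entropy_le_energy_normalized HC (ltW C0) lg g0 mn n0 q2 med B0 HBp HBm Igoo g1.
have mg : measurable_fun [set: measurableTypeR R] g by exact: measurable_funM.
have mg2 : measurable_fun [set: measurableTypeR R] (fun x => g x ^+ 2).
  exact: measurable_funX.
have mgl : measurable_fun [set: measurableTypeR R] (fun x => g x ^+ 2 * ln (g x ^+ 2)).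
  by apply: measurable_funM => //; exact: measurableT_comp.
have ig2 : mu.-integrable setT (EFin \o (fun x => g x ^+ 2)).
  by apply: ge0_integrable => //; [move=> x; exact: sqr_ge0|rewrite g1 ltry].
rewrite -/K in N; clearbody K.
have N' : (\int[mu]_x (g x ^+ 2 * ln (g x ^+ 2))%:E < +oo)%E.
  by apply: le_lt_trans N _; apply: lte_mul_pinfty => //; rewrite lee_fin ltW.
have igl : mu.-integrable setT (EFin \o (fun x => g x ^+ 2 * ln (g x ^+ 2))).
  by apply: integrable_of_lower => // x; rewrite mul_ln_ge ?sqr_ge0.
have fE x : f x ^+ 2 * ln (f x ^+ 2) =
    c * ln c * g x ^+ 2 + c * (g x ^+ 2 * ln (g x ^+ 2)).
  rewrite fg; have [->|gN0] := eqVneq (g x) 0; first by rewrite expr0n/= !(mulr0,mul0r) addr0.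
  rewrite lnM ?posrE//; first ring.
  by rewrite exprn_gt0// lt_def gN0 g0.
have igc := integrableZl measurableT (c * ln c) ig2.
have iglc := integrableZl measurableT c igl.
have -> : (\int[mu]_x (f x ^+ 2 * ln (f x ^+ 2))%:E - (c * ln c)%:E =
   c%:E * \int[mu]_x (g x ^+ 2 * ln (g x ^+ 2))%:E)%E.
  under eq_integral do rewrite fE EFinD.
  rewrite (integralD measurableT igc iglc).
  rewrite [X in (X + _ - _)%E](_ : _ = (c * ln c)%:E).
    rewrite addeAC subee// add0e.
    by rewrite -integralZl//; apply: eq_integral => x _; rewrite EFinM.
  under eq_integral do rewrite EFinM.
  by rewrite integralZl// g1 mule1.
apply: (le_trans (lee_wpmul2l (_ : 0%:E <= c%:E)%E N)); first by rewrite lee_fin ltW.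
rewrite muleCA; apply: lee_wpmul2l; first by rewrite lee_fin ltW.
have c0' : (0%:E <= c%:E)%E by rewrite lee_fin ltW.
apply: (le_trans (lee_wpmul2l c0' Ig)).
by rewrite muleA -EFinM divff ?mul1e// gt_eqF.
Qed.

Lemma entropy_le_energy (R : realType) (mu : probability (measurableTypeR R) R)
    (q m C B : R) (f n : R -> R) :
  poincare_admissible mu n C -> 0 < C -> locally_lipschitz f ->
  measurable_fun [set: measurableTypeR R] n -> (forall x, 0 <= n x) -> 2 <= q ->
  is_median mu m -> 0 <= B ->
  (forall x, m < x -> (mass_log mu `[x, +oo[%classic *
      (\int[lebesgue_measure]_(t in `[m, x]) density_pow q n t) `^ (q - 1) <= B%:E)%E) ->
  (forall x, x < m -> (mass_log mu `]-oo, x]%classic *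
      (\int[lebesgue_measure]_(t in `[x, m]) density_pow q n t) `^ (q - 1) <= B%:E)%E) ->
  (entropy mu (fun x => f x ^+ 2)%R <=
   (235 * C + 2 `^ (q + 1) * B)%:E *
   \int[lebesgue_measure]_x (hq_energy q f n x)%:E)%E.
Proof.
move=> HC C0 lf mn n0 q2 med B0 HBp HBm.
pose g x := `|f x|.
have gf x y : `|g x - g y| <= 1 * `|f x - f y| by rewrite mul1r; exact: ler_dist_dist.
have lg : locally_lipschitz g := locally_lipschitz_dominated lf ler01 gf.
have := entropy_le_energy_nonneg HC C0 lg (fun x => normr_ge0 _) mn n0 q2 med B0 HBp HBm.
have -> : (fun x => g x ^+ 2) = (fun x => f x ^+ 2).
  by apply/funext => x; rewrite /g real_normK ?num_real.
move=> /le_trans; apply; apply: lee_wpmul2l.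
  have c0 : 0 <= 235 :> R by rewrite ler0n.
  rewrite lee_fin; exact: (addr_ge0 (mulr_ge0 c0 (ltW C0)) (mulr_ge0 (powR_ge0 _ _) B0)).
apply: ge0_le_integral => //.
- by move=> x _; rewrite lee_fin hq_energy_ge0.
- by apply/measurable_EFinP; exact: measurable_hq_energy.
- by apply/measurable_EFinP; exact: measurable_hq_energy.
- move=> x _; rewrite lee_fin -[leRHS]mul1r -(expr1n _ 2).
  apply: hq_energy_le_scale => //; first lra.
    by rewrite /g normr_id mul1r.
  exact: local_slope_dominated lf ler01 gf.
Qed.

(** * Passage to the optimal constants *)

Lemma mass_log_ge0 (R : realType) (mu : probability (measurableTypeR R) R)
    (A : set R) : measurable (A : set (measurableTypeR R)) -> (0 <= mass_log mu A)%E.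
Proof.
move=> mA; rewrite /mass_log lee_fin.
have fA : mu A \is a fin_num by exact: fin_num_measure.
have p0 : 0 <= fine (mu A) by exact: fine_ge0.
have p1 : fine (mu A) <= 1.
  by rewrite -lee_fin fineK//; exact: probability_le1.
rewrite mulr_ge0//; have [->|pN0] := eqVneq (fine (mu A)) 0; first by rewrite invr0 ln0.
by rewrite ln_ge0// invf_ge1// lt_def pN0.
Qed.

Lemma B_plus_ge (R : realType) (q m x : R) (mu : probability (measurableTypeR R) R)
    (n : R -> R) : m < x -> (mass_log mu `[x, +oo[%classic *
      (\int[lebesgue_measure]_(t in `[m, x]) density_pow q n t) `^ (q - 1)
      <= B_plus q mu n m)%E.
Proof.
by move=> mx; apply: ereal_sup_ubound; exists x => //=; rewrite in_itv/= mx.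
Qed.

Lemma B_minus_ge (R : realType) (q m x : R) (mu : probability (measurableTypeR R) R)
    (n : R -> R) : x < m -> (mass_log mu `]-oo, x]%classic *
      (\int[lebesgue_measure]_(t in `[x, m]) density_pow q n t) `^ (q - 1)
      <= B_minus q mu n m)%E.
Proof.
by move=> mx; apply: ereal_sup_ubound; exists x => //=; rewrite in_itv/= mx.
Qed.

Lemma B_plus_ge0 (R : realType) (q m : R) (mu : probability (measurableTypeR R) R)
    (n : R -> R) : (0 <= B_plus q mu n m)%E.
Proof.
apply: le_trans (B_plus_ge q mu n (_ : m < m + 1)); last by rewrite ltrDl.
by rewrite mule_ge0 ?mass_log_ge0// poweR_ge0.
Qed.

Lemma best_constant_ge0 (R : realType) (P : R -> Prop) : (0 <= best_constant P)%E.
Proof.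
by apply: le_ereal_inf_tmp => _ [C [C0 _] <-]; rewrite lee_fin ltW.
Qed.

Lemma best_constant_le (R : realType) (P : R -> Prop) (C : R) :
  0 < C -> P C -> (best_constant P <= C%:E)%E.
Proof. by move=> C0 PC; apply: ereal_inf_lbound; exists C. Qed.

Lemma best_constant_adherent (R : realType) (P : R -> Prop) (e : R) :
  best_constant P \is a fin_num -> 0 < e ->
  exists C, [/\ 0 < C, P C & (C%:E <= best_constant P + e%:E)%E].
Proof.
move=> fP e0; have [_ [C [C0 PC] <-] Ce] := lb_ereal_inf_adherent e0 fP.
by exists C; split => //; exact: ltW.
Qed.

Lemma modified_logsob_constant_le (R : realType)
    (mu : probability (measurableTypeR R) R) (m : R)
    (nu : {measure set (measurableTypeR R) -> \bar R}) (n : R -> R) (q : R) :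
  is_median mu m -> is_density nu n -> 2 <= q ->
  (modified_logsob_constant q mu nu <=
    235%:E * poincare_constant mu nu
    + (2 `^ (q + 1))%:E * Order.max (B_plus q mu n m) (B_minus q mu n m))%E.
Proof.
move=> med hn q2; have [mn n0 nuE] := hn.
set Bm := Order.max _ _.
have Bm0 : (0 <= Bm)%E by rewrite le_max B_plus_ge0.
have CP0 : (0 <= poincare_constant mu nu)%E by exact: best_constant_ge0.
have c0 : 0 < 235 :> R by rewrite ltr0n.
have c0E : (0%:E < 235%:E :> \bar R)%E by rewrite lte_fin.
have c235 : (0%:E <= 235%:E :> \bar R)%E by exact: ltW.
have c2 : 0 < 2 `^ (q + 1) :> R by rewrite powR_gt0.
move: (Bm0); case BE : Bm => [B||]// B0; last first.
  by rewrite gt0_muley ?lte_fin// addey ?leey// gt_eqF// (lt_le_trans _ (mule_ge0 c235 CP0)).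
have [CPoo|] := ltP (poincare_constant mu nu) +oo%E; last first.
  rewrite leye_eq => /eqP ->; rewrite (gt0_muley c0E) addye; first exact: leey.
  by rewrite -EFinM.
have fCP : poincare_constant mu nu \is a fin_num by rewrite ge0_fin_numE.
apply/lee_addgt0Pr => e e0.
(* The infimum need not be attained; an admissible constant within [e / 235] of it costs only [e] in
   the end. *)
have d0 : 0 < e / 235 := divr_gt0 e0 c0.
have [C [C0 HC Ce]] := best_constant_adherent fCP d0.
have K0 : 0 < 235 * C + 2 `^ (q + 1) * B :=
  ltr_pwDl (mulr_gt0 c0 C0) (mulr_ge0 (ltW c2) B0).
have HBp x : m < x -> (mass_log mu `[x, +oo[%classic *
      (\int[lebesgue_measure]_(t in `[m, x]) density_pow q n t) `^ (q - 1) <= B%:E)%E.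
  by move=> mx; apply: (le_trans (B_plus_ge q mu n mx)); rewrite -BE le_max lexx.
have HBm x : x < m -> (mass_log mu `]-oo, x]%classic *
      (\int[lebesgue_measure]_(t in `[x, m]) density_pow q n t) `^ (q - 1) <= B%:E)%E.
  by move=> mx; apply: (le_trans (B_minus_ge q mu n mx)); rewrite -BE le_max lexx orbT.
have HC' : poincare_admissible mu n C.
  move=> f lf; apply: (le_trans (HC _ lf)); apply: lee_wpmul2l; first by rewrite lee_fin ltW.
  rewrite (ge0_integral_density hn)//; last by move=> x; exact: sqr_ge0.
  by apply: measurable_funX; exact: measurable_local_slope.
apply: (@le_trans _ _ (235 * C + 2 `^ (q + 1) * B)%:E).
  apply: best_constant_le => // f lf.
  rewrite (ge0_integral_density hn).
  - exact: entropy_le_energy HC' C0 lf mn n0 q2 med B0 HBp HBm.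
  - exact: measurable_Hq_slope.
  - by move=> x; apply: mulr_ge0; [exact: Hq_ge0|exact: sqr_ge0].
rewrite EFinD !EFinM addeAC; apply: leeD2r.
apply: (le_trans (lee_wpmul2l c235 Ce)).
rewrite muleDr ?ge0_adde_def ?inE ?lee_fin ?(ltW d0)//.
by apply: leeD2l; rewrite -EFinM (mulrC 235) (divfK (lt0r_neq0 c0)) lexx.
Qed.

(** * The Poincare constant from below *)

(** The quartic Taylor coefficient -1/4 is lowered to -1. The derivative of the difference is then
    x^3 (4 - 1/(1 + x)), which has the sign of x on the whole interval, so the minimum is at 0. *)
Lemma ln1D_ge (R : realType) (s : R) : - 2^-1 <= s <= 2^-1 ->
  s - s ^+ 2 / 2 + s ^+ 3 / 3 - s ^+ 4 <= ln (1 + s).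
Proof.
move=> s2; pose p x : R := x - x ^+ 2 / 2 + x ^+ 3 / 3 - x ^+ 4.
have pos (x : R) : - 2^-1 <= x -> 0 < 1 + x by move=> ?; lra.
have dp (x : R) : - 2^-1 <= x ->
    is_derive x 1 (fun y => ln (1 + y) - p y) (x ^+ 3 * (4 - (1 + x)^-1)).
  move=> x2; have x0 := pos _ x2.
  have dl : is_derive x 1 (fun y => ln (1 + y)) (1 + x)^-1.
    have := @is_derive1_comp R (@ln R) (fun y => 1 + y) x (1 + x)^-1 1.
    rewrite mulr1; apply; first exact: is_derive1_ln.
    by have := @is_deriveD R R R (cst 1) id x 1 0 1; rewrite add0r; apply.
  have -> : x ^+ 3 * (4 - (1 + x)^-1) = (1 + x)^-1 - (1 - x + x ^+ 2 - 4 * x ^+ 3).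
    by field; lra.
  rewrite /p; apply: is_deriveB.
  apply: is_derive_eq; rewrite !scaler1 -![_ *: _]/(_ * _) /=.
  by rewrite !mulr0 !add0r; field.
have ep : ln (1 + 0) - p 0 = 0 by rewrite addr0 ln1 /p; ring.
suff : 0 <= ln (1 + s) - p s by rewrite subr_ge0.
have ds (x : R) : - 2^-1 <= x -> 0 <= 4 - (1 + x)^-1.
  by move=> x2; rewrite subr_ge0 invf_ple ?posrE ?pos//; lra.
have cont (a b : R) : - 2^-1 <= a -> {within `[a, b], continuous (fun y => ln (1 + y) - p y)}.
  move=> a2; apply: derivable_within_continuous => x; rewrite in_itv/= => /andP[ax _].
  by have [] := dp x (le_trans a2 ax).
rewrite -ep; have /orP[s0|s0] := le_total 0 s.
- apply: (@ger0_derive1_le_cc R (fun y => ln (1 + y) - p y) 0 s) => //.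
  + by move=> x; rewrite in_itv/= => /andP[x0 _]; case: (dp x _) => //; lra.
  + move=> x; rewrite in_itv/= => /andP[x0 _]; rewrite derive1E.
    have [|_ ->] := dp x; first lra.
    by rewrite mulr_ge0 ?ds// ?exprn_ge0 ?ltW//; lra.
  + by apply: cont; lra.
  + by rewrite in_itv/= lexx.
  + by rewrite in_itv/= lexx s0.
- case/andP: s2 => s2 _.
  apply: (@ler0_derive1_le_cc R (fun y => ln (1 + y) - p y) s 0) => //.
  + by move=> x; rewrite in_itv/= => /andP[x0 _]; case: (dp x _) => //; lra.
  + move=> x; rewrite in_itv/= => /andP[x0 x1]; rewrite derive1E.
    have [|_ ->] := dp x; first lra.
    rewrite mulr_le0_ge0 ?ds//; last lra.
    by rewrite exprS mulr_le0_ge0 ?sqr_ge0// ltW.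
  + exact: cont.
  + by rewrite in_itv/= lexx s0.
  + by rewrite in_itv/= lexx s0.
Qed.

(** The expansion starts with 2 s + 3 s^2; after division by s^2 the remainder is at least -10 d. *)
Lemma sqr_ln1D_ge (R : realType) (s d : R) : `|s| <= d -> d <= 2^-1 ->
  2 * s + (3 - 10 * d) * s ^+ 2 <= (1 + s) ^+ 2 * ln ((1 + s) ^+ 2).
Proof.
move=> sd d2; have /ler_normlP[s1 s2] := sd.
have s0 : 0 < 1 + s by lra.
have H : s - s ^+ 2 / 2 + s ^+ 3 / 3 - s ^+ 4 <= ln (1 + s) by apply: ln1D_ge; lra.
rewrite lnXn// -[ln _ *+ 2]mulr_natl [leRHS]mulrCA.
apply: (@le_trans _ _ (2 * ((1 + s) ^+ 2 * (s - s ^+ 2 / 2 + s ^+ 3 / 3 - s ^+ 4)))); last first.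
  by rewrite ler_pM2l// ler_pM2l ?exprn_gt0.
have -> : 2 * ((1 + s) ^+ 2 * (s - s ^+ 2 / 2 + s ^+ 3 / 3 - s ^+ 4))
   = 2 * s + (3 - 10 * d) * s ^+ 2 +
     (10 * d + 2 / 3 * s - 5 / 3 * s ^+ 2 - 10 / 3 * s ^+ 3 - 2 * s ^+ 4) * s ^+ 2.
  by field.
rewrite lerDl; apply: mulr_ge0; last exact: sqr_ge0.
have d0 : 0 <= d := le_trans (normr_ge0 s) sd.
have s2d : s ^+ 2 <= d / 2 by rewrite -[s ^+ 2]real_normK ?num_real//; have := normr_ge0 s; nra.
have s3d : s ^+ 3 <= d / 4 by rewrite (exprS s 2); have := sqr_ge0 s; nra.
have s4d : s ^+ 4 <= d / 4 by rewrite (exprM s 2 2); have := sqr_ge0 s; nra.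
lra.
Qed.

Definition logsob_admissible (R : realType) (q : R)
    (mu : probability (measurableTypeR R) R) (n : R -> R) (K : R) :=
  forall f : R -> R, locally_lipschitz f ->
  (entropy mu (fun x => f x ^+ 2)%R <=
    K%:E * \int[lebesgue_measure]_x (hq_energy q f n x)%:E)%E.

Lemma Hq_small (R : realType) (q x : R) : 2 <= q -> `|x| <= 1 -> Hq q x = x ^+ 2.
Proof.
move=> q2 x1; rewrite /Hq max_l//; have [->|x0] := eqVneq x 0.
  by rewrite normr0 powR0 ?expr0n// gt_eqF// (lt_le_trans _ q2).
rewrite -[leRHS]real_normK ?num_real// -powR_mulrn//.
by rewrite ger_powR// normr_gt0 x0.
Qed.

(** The perturbation stays above 1/2 and its slope below 1/2, so the quotient is at most 1, where
    H_q is the square: q disappears from the linearised inequality. *)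
Lemma hq_energy_perturbation (R : realType) (q e c : R) (g n : R -> R) (x : R) :
  locally_lipschitz g -> 2 <= q -> 0 <= n x -> 0 <= e ->
  `|e * (g x - c)| <= 2^-1 -> e * local_slope g x <= 2^-1 ->
  hq_energy q (fun y => 1 + e * (g y - c)) n x <= e ^+ 2 * (local_slope g x ^+ 2 * n x).
Proof.
move=> lg q2 n0 e0 gc ge.
have dom (y z : R) : `|(1 + e * (g y - c)) - (1 + e * (g z - c))| <= e * `|g y - g z|.
  by rewrite (_ : _ - _ = e * (g y - g z)) ?normrM ?(ger0_norm e0)//; ring.
have lf := locally_lipschitz_dominated lg e0 dom.
have sf := local_slope_dominated x lg e0 dom.
have sf0 := local_slope_ge0 x lf.
rewrite /hq_energy mulrA ler_wpM2r//.
have /ler_normlP[h1 h2] := gc.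
have f0 : 2^-1 <= 1 + e * (g x - c) by lra.
have fp : 0 < 1 + e * (g x - c) by lra.
rewrite Hq_small//; last first.
  rewrite ger0_norm ?divr_ge0 ?(ltW fp)// ler_pdivrMr// mul1r.
  exact: le_trans sf (le_trans ge f0).
rewrite -exprMn divfK ?gt_eqF// -exprMn lerXn2r ?nnegrE//.
by apply: mulr_ge0 => //; exact: local_slope_ge0.
Qed.

Lemma bounded_integrable (R : realType) (mu : probability (measurableTypeR R) R)
    (g : R -> R) (M : R) : measurable_fun [set: measurableTypeR R] g ->
  (forall x, `|g x| <= M) -> mu.-integrable setT (EFin \o g).
Proof.
move=> mg gM; apply: measurable_bounded_integrable => //.
  by rewrite (le_lt_trans (probability_le1 _ _)) ?ltry.
exists M; split; first exact: num_real.
by move=> y My x _ /=; rewrite (le_trans (gM x))// ltW.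
Qed.

(** The expansion contributes 3 e^2 V, and c ln c <= c (c - 1) with c = 1 + e^2 V takes away e^2 V
    (1 + e^2 V). The difference 2 e^2 V is the source of the factor 2 in front of C_P. *)
Lemma entropy_perturbation_ge (R : realType) (mu : probability (measurableTypeR R) R)
    (u : R -> R) (M V e : R) :
  measurable_fun [set: measurableTypeR R] u -> (forall x, `|u x| <= M) ->
  (\int[mu]_x (u x)%:E = 0)%E -> (\int[mu]_x (u x ^+ 2)%:E = V%:E)%E ->
  0 <= e -> e * M <= 2^-1 ->
  ((e ^+ 2 * V * (2 - 10 * (e * M) - e ^+ 2 * V))%:E <=
    entropy mu (fun x => (1 + e * u x) ^+ 2)%R)%E.
Proof.
move=> mu_ uM u1 u2 e0 eM.
have M0 : 0 <= M := le_trans (normr_ge0 _) (uM 0).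
have eu x : `|e * u x| <= e * M by rewrite normrM (ger0_norm e0) ler_wpM2l.
have iu : mu.-integrable setT (EFin \o u) by exact: bounded_integrable mu_ uM.
have iu2 : mu.-integrable setT (EFin \o (fun x => u x ^+ 2)).
  apply: (@bounded_integrable _ _ _ (M ^+ 2)); first exact: measurable_funX.
  by move=> x; rewrite normrX lerXn2r ?nnegrE.
have quad (a b c : R) : (\int[mu]_x (a + (b * u x + c * u x ^+ 2))%:E = (a + c * V)%:E)%E.
  have i1 : mu.-integrable setT (EFin \o (fun x => b * u x)) by exact: (integrableZl measurableT b iu).
  have i2 : mu.-integrable setT (EFin \o (fun x => c * u x ^+ 2)) by exact: (integrableZl measurableT c iu2).
  have i0 : mu.-integrable setT (EFin \o cst a) by exact: finite_measure_integrable_cst.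
  rewrite (integralD measurableT i0 (integrableD measurableT i1 i2)).
  rewrite (integralD measurableT i1 i2) integral_probability_cst.
  by rewrite (integralZl measurableT iu b) (integralZl measurableT iu2 c) u1 u2 mule0 add0e.
have V0 : 0 <= V by rewrite -lee_fin -u2; apply: integral_ge0 => x _; rewrite lee_fin sqr_ge0.
have mf2 : measurable_fun [set: measurableTypeR R] (fun x => (1 + e * u x) ^+ 2).
  by apply: measurable_funX; apply: measurable_funD => //; exact: measurable_funM.
rewrite /entropy (_ : (\int[mu]_x ((1 + e * u x) ^+ 2)%:E = (1 + e ^+ 2 * V)%:E)%E); last first.
  by rewrite -(quad 1 (2 * e) (e ^+ 2)); apply: eq_integral => x _; congr EFin; ring.
have c0 : 0 < 1 + e ^+ 2 * V by rewrite ltr_pwDl// mulr_ge0// sqr_ge0.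
rewrite leeBrDr//.
apply: (@le_trans _ _ (0 + (3 - 10 * (e * M)) * e ^+ 2 * V)%:E).
  rewrite -EFinD lee_fin.
  have := ler_wpM2l (ltW c0) (ln_le_sub1 c0).
  set L := _ * ln _; set v := e ^+ 2 * V.
  have -> : (3 - 10 * (e * M)) * e ^+ 2 * V = (3 - 10 * (e * M)) * v by rewrite /v; ring.
  by rewrite -/v; lra.
rewrite -(quad 0 (2 * e) ((3 - 10 * (e * M)) * e ^+ 2)).
have lowx x : 0 + (2 * e * u x + (3 - 10 * (e * M)) * e ^+ 2 * u x ^+ 2) <=
    (1 + e * u x) ^+ 2 * ln ((1 + e * u x) ^+ 2).
  apply: le_trans (sqr_ln1D_ge (eu x) eM).
  by rewrite le_eqVlt; apply/orP; left; apply/eqP; ring.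
apply: le_integral => //.
- apply: (@bounded_integrable _ _ _ (2 * (e * M) + (3 + 10 * (e * M)) * (e * M) ^+ 2)).
    apply: measurable_funD => //; apply: measurable_funD; apply: measurable_funM => //.
    exact: measurable_funX.
  move=> x; rewrite add0r (le_trans (ler_normD _ _))// lerD//.
    by rewrite -mulrA normrM ger0_norm// ler_pM2l.
  rewrite -mulrA -exprMn normrM normrX ler_pM ?exprn_ge0// ?lerXn2r ?nnegrE ?mulr_ge0//.
  have eM0 : 0 <= e * M by exact: mulr_ge0.
  by apply/ler_normlP; split; lra.
- apply: (@bounded_integrable _ _ _ 12).
    apply: measurable_funM => //; exact: measurableT_comp.
  move=> x; have /ler_normlP[h1 h2] := eu x.
  have y0 : 0 < (1 + e * u x) ^+ 2 by rewrite exprn_gt0//; lra.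
  have y1 : 4^-1 <= (1 + e * u x) ^+ 2 by nra.
  have y2 : (1 + e * u x) ^+ 2 <= 9 / 4 by nra.
  set y := (1 + e * u x) ^+ 2 in y0 y1 y2 *.
  have l1 := ln_le_sub1 y0.
  have yi : 0 < y^-1 by rewrite invr_gt0.
  have l2 := ln_le_sub1 yi; rewrite lnV ?posrE// in l2.
  have yV : y^-1 <= 4 by rewrite invf_ple ?posrE//; lra.
  have yyV : y * y^-1 = 1 by rewrite divff// gt_eqF.
  apply/ler_normlP; split; nra.
- by move=> x _; rewrite lee_fin lowx.
Qed.

Lemma fatou_cvg_le d (T : measurableType d) (R : realType)
    (mu : {measure set T -> \bar R}) (D : set T) (f_ : nat -> T -> R) (f : T -> R)
    (M : \bar R) :
  measurable D -> (forall k, measurable_fun D (f_ k)) ->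
  (forall k x, D x -> 0 <= f_ k x) ->
  {ae mu, forall x, D x -> f_ ^~ x @ \oo --> f x} -> measurable_fun D f ->
  (forall k, (\int[mu]_(x in D) (f_ k x)%:E <= M)%E) ->
  (\int[mu]_(x in D) (f x)%:E <= M)%E.
Proof.
move=> mD mf_ f0 cf mf fM.
have := @fatou _ _ _ mu D mD (fun k x => (f_ k x)%:E)
  (fun k => (measurable_EFinP _ _).2 (mf_ k)) (fun k x Dx => f0 k x Dx).
have -> : (\int[mu]_(x in D) limn_einf (fun k => (f_ k x)%:E) =
           \int[mu]_(x in D) (f x)%:E)%E.
  apply: ae_eq_integral => //.
  - rewrite /limn_einf; apply: measurableT_comp => //.
    apply: measurable_fun_limn_esup => k; apply: measurableT_comp => //.
    exact/measurable_EFinP.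
  - exact/measurable_EFinP.
  - apply: filterS cf => x H Dx.
    have cx : (fun k => (f_ k x)%:E) @ \oo --> (f x)%:E.
      by apply: cvg_EFin; [exact: nearW|exact: H].
    by rewrite is_cvg_limn_einfE; [apply/cvg_lim|apply/cvg_ex; eexists; exact: cx].
move=> /le_trans; apply; rewrite limn_einf_lim; apply: lime_le; first exact: is_cvg_einfs.
apply: nearW => k; apply: le_trans (fM k).
by apply: ereal_inf_lbound; exists k => /=.
Qed.

Lemma variance_cvg_le (R : realType) (mu : probability (measurableTypeR R) R)
    (g_ : nat -> R -> R) (g h : R -> R) (D : \bar R) :
  (forall k, measurable_fun [set: measurableTypeR R] (g_ k)) ->
  measurable_fun [set: measurableTypeR R] g ->
  mu.-integrable setT (EFin \o h) -> (forall k x, `|g_ k x| <= h x) ->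
  (forall x, g_ ^~ x @ \oo --> g x) ->
  (forall k, ('V_mu[g_ k] <= D)%E) -> ('V_mu[g] <= D)%E.
Proof.
move=> mg_ mg ih gh cg VD.
have cgE x : (g_ k x)%:E @[k --> \oo] --> (g x)%:E.
  by apply: cvg_EFin; [exact: nearW|exact: cg].
have [ig _ cE] := @dominated_convergence _ _ _ mu setT measurableT
  (fun k x => (g_ k x)%:E) (EFin \o g) (EFin \o h)
  (fun k => (measurable_EFinP _ _).2 (mg_ k)) ((measurable_EFinP _ _).2 mg)
  (aeW mu (fun x _ => cgE x)) ih
  (aeW mu (fun x k _ => gh k x)).
rewrite variance_integral expectation.unlock.
have fE : (\int[mu]_x (g x)%:E)%E \is a fin_num by exact: integrable_fin_num.
move: cE; rewrite -[X in _ --> X](fineK fE) => /fine_cvg cc.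
apply: (@fatou_cvg_le _ (measurableTypeR R) R mu setT
  (fun k x => (g_ k x - fine (\int[mu]_y (g_ k y)%:E)%E) ^+ 2)
  (fun x => (g x - fine (\int[mu]_y (g y)%:E)%E) ^+ 2)) => //.
- by move=> k; apply: measurable_funX; exact: measurable_funB.
- by move=> k x _; exact: sqr_ge0.
- apply: aeW => x _; under eq_fun do rewrite expr2; rewrite expr2.
  by apply: cvgM; apply: cvgB => //; exact: cc.
- by apply: measurable_funX; exact: measurable_funB.
- by move=> k; have := VD k; rewrite variance_integral expectation.unlock.
Qed.

Lemma poincare_of_logsob_lipschitz (R : realType) (q K M L : R)
    (mu : probability (measurableTypeR R) R) (n g : R -> R) :
  logsob_admissible q mu n K -> 0 < K -> 2 <= q ->
  measurable_fun [set: measurableTypeR R] n -> (forall x, 0 <= n x) ->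
  locally_lipschitz g -> (forall x, `|g x| <= M) -> (forall x, local_slope g x <= L) ->
  ('V_mu[g] <= (K / 2)%:E * \int[lebesgue_measure]_x (local_slope g x ^+ 2 * n x)%:E)%E.
Proof.
move=> HK K0 q2 mn n0 lg gM gL.
have mg : measurable_fun [set: measurableTypeR R] g.
  exact: measurable_locally_lipschitz lg.
have K20 : 0 < K / 2 by exact: divr_gt0.
set I := (\int[lebesgue_measure]_x _)%E.
have I0 : (0 <= I)%E.
  by apply: integral_ge0 => x _; rewrite lee_fin mulr_ge0 ?sqr_ge0.
case IE : I I0 => [I'||]// I0; last by rewrite gt0_muley ?lte_fin// leey.
have ig := bounded_integrable mu mg gM.
rewrite variance_integral expectation.unlock; set c := fine _.
pose u x := g x - c.
have mu_ : measurable_fun [set: measurableTypeR R] u by exact: measurable_funB.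
have uM x : `|u x| <= M + `|c| by rewrite (le_trans (ler_normB _ _))// lerD2r.
have M0 : 0 <= M + `|c| := le_trans (normr_ge0 _) (uM 0).
have fE : (\int[mu]_x (g x)%:E)%E \is a fin_num by exact: integrable_fin_num.
have u1 : (\int[mu]_x (u x)%:E = 0)%E.
  have ic : mu.-integrable setT (EFin \o cst c) by exact: finite_measure_integrable_cst.
  rewrite (integralB measurableT ig ic) integral_probability_cst.
  by rewrite /c fineK// subee.
have iu2 : mu.-integrable setT (EFin \o (fun x => u x ^+ 2)).
  apply: (@bounded_integrable _ _ _ ((M + `|c|) ^+ 2)); first exact: measurable_funX.
  by move=> x; rewrite normrX lerXn2r ?nnegrE.
have f2 : (\int[mu]_x (u x ^+ 2)%:E)%E \is a fin_num by exact: integrable_fin_num.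
set V := fine (\int[mu]_x (u x ^+ 2)%:E)%E.
have u2 : (\int[mu]_x (u x ^+ 2)%:E = V%:E)%E by rewrite fineK.
have V0 : 0 <= V by rewrite -lee_fin -u2; apply: integral_ge0 => x _; rewrite lee_fin sqr_ge0.
have L0 : 0 <= L := le_trans (local_slope_ge0 0 lg) (gL 0).
rewrite -/(u _) u2 -EFinM lee_fin.
have key e : 0 < e -> e * (M + `|c|) <= 2^-1 -> e * L <= 2^-1 ->
    V * (2 - 10 * (e * (M + `|c|)) - e ^+ 2 * V) <= K * I'.
  move=> e0 eM eL.
  have lf : locally_lipschitz (fun x => 1 + e * u x).
    apply: (locally_lipschitz_dominated lg (ltW e0)) => x y.
    by rewrite (_ : _ - _ = e * (g x - g y)) ?normrM ?(gtr0_norm e0)// /u; ring.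
  have e20 : 0 < e ^+ 2 by exact: exprn_gt0.
  have := le_trans (entropy_perturbation_ge mu_ uM u1 u2 (ltW e0) eM) (HK _ lf).
  move=> /le_trans H; rewrite -(ler_pM2l e20) -lee_fin (mulrA (e ^+ 2) V).
  apply: H; rewrite [e ^+ 2 * _]mulrCA EFinM; apply: lee_wpmul2l; first by rewrite lee_fin ltW.
  rewrite EFinM -IE -ge0_integralZl//; last 3 first.
  - by apply/measurable_EFinP; exact: measurable_sqr_slope.
  - by move=> x _; rewrite lee_fin mulr_ge0 ?sqr_ge0.
  - by rewrite lee_fin ltW.
  apply: ge0_le_integral => //.
  - by move=> x _; rewrite lee_fin hq_energy_ge0.
  - by apply/measurable_EFinP; exact: measurable_hq_energy.
  - by apply: emeasurable_funM => //; apply/measurable_EFinP; exact: measurable_sqr_slope.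
  - move=> x _; rewrite -EFinM lee_fin; apply: hq_energy_perturbation => //; first exact: ltW.
      by rewrite normrM (gtr0_norm e0) (le_trans _ eM)// ler_pM2l// uM.
    by rewrite (le_trans _ eL)// ler_pM2l// gL.
suff : 2 * V <= K * I' by lra.
apply/ler_addgt0Pr => d d0.
(* For e <= 1 the error terms are together at most e A. The second bound on [e] below enforces both
   smallness conditions of [key] as well as e <= 1. *)
pose A := V * (10 * (M + `|c|) + V).
have A0 : 0 <= A by rewrite mulr_ge0// addr_ge0// mulr_ge0.
have A1 : 0 < A + 1 by lra.
pose e := Num.min (d / (A + 1)) (2 * (M + `|c|) + 2 * L + 1)^-1.
have B1 : 0 < 2 * (M + `|c|) + 2 * L + 1 by lra.
have e0 : 0 < e by rewrite lt_min divr_gt0//= invr_gt0.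
have eB : e * (2 * (M + `|c|) + 2 * L + 1) <= 1.
  by rewrite -ler_pdivlMr// div1r ge_min lexx orbT.
have eA : e * (A + 1) <= d by rewrite -ler_pdivlMr// ge_min lexx.
have eM : 0 <= e * (M + `|c|) by rewrite mulr_ge0// ltW.
have eL : 0 <= e * L by rewrite mulr_ge0// ltW.
have e1 : e <= 1 by nra.
have := key e e0; have h1 : e * (M + `|c|) <= 2^-1 by lra.
have h2 : e * L <= 2^-1 by lra.
move=> /(_ h1 h2).
have : V * (e ^+ 2 * V) <= V * (e * V).
  by rewrite ler_wpM2l// ler_wpM2r// expr2 ger_pMl.
have : e * A <= d by lra.
rewrite /A; lra.
Qed.

(** Clamping the variable to [-k, k] bounds the slope and nowhere increases it; bounded functions
    then pass to the limit by dominated convergence and Fatou. *)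
Lemma poincare_of_logsob_bounded (R : realType) (q K M : R)
    (mu : probability (measurableTypeR R) R) (n g : R -> R) :
  logsob_admissible q mu n K -> 0 < K -> 2 <= q ->
  measurable_fun [set: measurableTypeR R] n -> (forall x, 0 <= n x) ->
  locally_lipschitz g -> (forall x, `|g x| <= M) ->
  ('V_mu[g] <= (K / 2)%:E * \int[lebesgue_measure]_x (local_slope g x ^+ 2 * n x)%:E)%E.
Proof.
move=> HK K0 q2 mn n0 lg gM.
have mf f : locally_lipschitz f -> measurable_fun [set: measurableTypeR R] f.
  by move=> lf; exact: measurable_locally_lipschitz lf.
pose g_ k := g \o clamp (- k%:R) k%:R.
have kk k : - k%:R <= k%:R :> R by rewrite (@le_trans _ _ 0)// oppr_le0.
have lg_ k : locally_lipschitz (g_ k) by exact: locally_lipschitz_clamp.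
apply: (@variance_cvg_le _ _ g_ _ (cst M)).
- by move=> k; exact: mf.
- exact: mf.
- exact: finite_measure_integrable_cst.
- by move=> k x; exact: gM.
- move=> x; apply: cvg_near_cst; near=> k; rewrite /g_ /= clamp_id// -ler_norml.
  by near: k; exact: nbhs_infty_ger.
- move=> k.
  have [L L0 [_ sL]] := local_slope_bounded (- k%:R) k%:R (lg_ k).
  have gL x : local_slope (g_ k) x <= L.
    by have [/sL//|/(local_slope_clamp_out (kk k) (lg_ k)) ->] := boolP (- k%:R <= x <= k%:R).
  apply: (le_trans (poincare_of_logsob_lipschitz HK K0 q2 mn n0 (lg_ k) (fun x => gM _) gL)).
  apply: lee_wpmul2l; first by rewrite lee_fin ltW// divr_gt0.
  apply: ge0_le_integral => //.
  + by move=> x _; rewrite lee_fin mulr_ge0 ?sqr_ge0.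
  + by apply/measurable_EFinP; exact: measurable_sqr_slope.
  + by apply/measurable_EFinP; exact: measurable_sqr_slope.
  + move=> x _; rewrite lee_fin ler_wpM2r// lerXn2r ?nnegrE ?local_slope_ge0//.
    have [xk|xk] := boolP (- k%:R <= x <= k%:R); first exact: local_slope_clamp_le.
    by rewrite (local_slope_clamp_out (kk k) (lg_ k) xk) local_slope_ge0.
Unshelve. all: by end_near. Qed.

(** Bounded variances alone do not prevent the means of the truncations from escaping. They are held
    back by a set {|g| <= r} of mass at least 1/2: a mean c with |c| > r costs a variance of at
    least (|c| - r)^2 / 2. *)
Lemma integrable_of_variance_bound (R : realType) (mu : probability (measurableTypeR R) R)
    (g : R -> R) (D : R) : measurable_fun [set: measurableTypeR R] g ->
  (forall k : nat, ('V_mu[clamp (- k%:R) k%:R \o g] <= D%:E)%E) ->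
  mu.-integrable setT (EFin \o g).
Proof.
move=> mg VD.
have kk k : - k%:R <= k%:R :> R by rewrite (@le_trans _ _ 0)// oppr_le0.
have clg (k : nat) x : `|clamp (- k%:R) k%:R (g x)| <= `|g x|.
  have := clamp_contr (- k%:R) k%:R (g x) 0.
  by rewrite (@clamp_id _ _ _ 0) ?subr0// oppr_le0 ler0n.
pose A (r : nat) : set (measurableTypeR R) := [set x | `|g x| <= r%:R].
have mA r : measurable (A r).
  rewrite (_ : A r = setT `&` (fun x => `|g x|) @^-1` `]-oo, r%:R]).
    by apply: (measurableT_comp (@normr_measurable R setT) mg) => //; exact: measurable_itv.
  by rewrite setTI; apply/seteqP; split=> x /=; rewrite in_itv.
have [r Hr] : exists r, ((2^-1)%:E <= mu (A r))%E.
  have AT : \bigcup_r A r = setT.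
    apply/seteqP; split => // x _.
    exists (Num.bound `|g x|) => //=; rewrite /A /=.
    by rewrite ltW// archi_boundP.
  have ndA : nondecreasing_seq A.
    move=> i j ij; apply/subsetPset => x /= xi.
    by rewrite /A /= (le_trans xi)// ler_nat.
  have := @nondecreasing_cvg_mu _ _ _ mu A mA (bigcupT_measurable _ mA) ndA.
  rewrite AT => cA.
  have cA1 : (mu (A k) @[k --> \oo] --> 1%:E)%E.
    exact: (eq_ind _ (fun z => mu (A k) @[k --> \oo] --> z) cA _ (probability_setT mu)).
  have : \forall k \near \oo, 2^-1 < fine (mu (A k)).
    by apply: (cvgr_gt _ (fine_cvg cA1)); rewrite invf_lt1// ltr1n.
  move=> [k _ /(_ k (leqnn k))] /= H; exists k.
  by rewrite -[mu (A k)]fineK ?fin_num_measure// lee_fin ltW.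
have D0 : 0 <= D.
  rewrite -lee_fin; apply: le_trans (VD 0); rewrite variance_integral.
  by apply: integral_ge0 => x _; rewrite lee_fin sqr_ge0.
have mgk (k : nat) : measurable_fun [set: measurableTypeR R] (fun x => clamp (- k%:R) k%:R (g x)).
  by apply: measurable_maxr => //; exact: measurable_minr.
apply/integrableP; split; first exact/measurable_EFinP.
apply: (@le_lt_trans _ _ (1 + D + (r%:R + (1 + 2 * D)))%:E); last exact: ltry.
apply: (@fatou_cvg_le _ (measurableTypeR R) R mu setT
  (fun k x => `|clamp (- k%:R) k%:R (g x)|) (fun x => `|g x|)) => //.
- by move=> k; exact: measurableT_comp.
- apply: aeW => x _; apply: cvg_near_cst; near=> k; rewrite clamp_id// -ler_norml.
  by near: k; exact: nbhs_infty_ger.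
- exact: measurableT_comp.
- move=> k; have := VD k; rewrite variance_integral; set c := fine _; rewrite /=.
  set gk := fun x => clamp (- k%:R) k%:R (g x).
  have mq : measurable_fun [set: measurableTypeR R] (fun x => (gk x - c) ^+ 2).
    by apply: measurable_funX; apply: measurable_funB => //; exact: mgk.
  move=> Vk.
  have cr : `|c| <= r%:R + (1 + 2 * D).
    have [rc|] := ltP r%:R `|c|; last by lra.
    suff : (`|c| - r%:R) ^+ 2 <= 2 * D by nra.
    suff : (`|c| - r%:R) ^+ 2 * 2^-1 <= D by lra.
    rewrite -lee_fin; apply: le_trans Vk.
    apply: (@le_trans _ _ (\int[mu]_(x in A r) (cst ((`|c| - r%:R) ^+ 2)%:E x))%E).
      rewrite integral_cst// EFinM; apply: lee_wpmul2l => //.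
      by rewrite lee_fin sqr_ge0.
    apply: (@le_trans _ _ (\int[mu]_(x in A r) ((gk x - c) ^+ 2)%:E)%E).
      apply: ge0_le_integral => //.
      - by move=> x _; rewrite lee_fin sqr_ge0.
      - by apply/measurable_EFinP; exact: measurable_funTS.
      move=> x Ax; rewrite lee_fin -[leRHS]real_normK ?num_real//.
      rewrite lerXn2r ?nnegrE ?subr_ge0 ?(ltW rc)//.
      rewrite distrC (le_trans _ (lerB_dist _ _))// lerB//.
      exact: le_trans (clg k x) Ax.
    apply: ge0_subset_integral => //; first exact/measurable_EFinP.
    by move=> x _; rewrite lee_fin sqr_ge0.
  apply: (@le_trans _ _ (\int[mu]_x ((gk x - c) ^+ 2 + (1 + (r%:R + (1 + 2 * D))))%:E)%E).
    apply: ge0_le_integral => //.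
    + by apply/measurable_EFinP; exact: measurableT_comp.
    + by apply/measurable_EFinP; exact: measurable_funD.
    + move=> x _; rewrite lee_fin.
      have h1 : `|gk x| <= `|gk x - c| + `|c| by rewrite -{1}(subrK c (gk x)) ler_normD.
      have h2 : `|gk x - c| <= (gk x - c) ^+ 2 + 1.
        by rewrite -[_ ^+ 2]real_normK ?num_real//; have := normr_ge0 (gk x - c); nra.
      by lra.
  have b0 : 0 <= 1 + (r%:R + (1 + 2 * D)).
    by have : 0 <= r%:R :> R by []; lra.
  rewrite (_ : (1 + D + _)%:E = D%:E + (1 + (r%:R + (1 + 2 * D)))%:E)%E; last first.
    by rewrite -EFinD; congr EFin; ring.
  rewrite [leLHS](_ : _ = \int[mu]_x (((gk x - c) ^+ 2)%:E + (1 + (r%:R + (1 + 2 * D)))%:E))%E//.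
  rewrite ge0_integralD//; last 2 first.
  + by move=> x _; rewrite lee_fin sqr_ge0.
  + exact/measurable_EFinP.
  by rewrite integral_probability_cst leeD2r.
Unshelve. all: by end_near. Qed.

Lemma poincare_of_logsob (R : realType) (q K : R)
    (mu : probability (measurableTypeR R) R) (n : R -> R) :
  logsob_admissible q mu n K -> 0 < K -> 2 <= q ->
  measurable_fun [set: measurableTypeR R] n -> (forall x, 0 <= n x) ->
  poincare_admissible mu n (K / 2).
Proof.
move=> HK K0 q2 mn n0 g lg.
have mg : measurable_fun [set: measurableTypeR R] g.
  exact: measurable_locally_lipschitz lg.
have kk k : - k%:R <= k%:R :> R by rewrite (@le_trans _ _ 0)// oppr_le0.
have dom k x y : `|clamp (- k%:R) k%:R (g x) - clamp (- k%:R) k%:R (g y)| <= 1 * `|g x - g y|.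
  by rewrite mul1r; exact: clamp_contr.
have Vk (k : nat) : ('V_mu[clamp (- k%:R) k%:R \o g] <=
    (K / 2)%:E * \int[lebesgue_measure]_x (local_slope g x ^+ 2 * n x)%:E)%E.
  have lk := locally_lipschitz_dominated lg ler01 (dom k).
  have gk x : `|(clamp (- k%:R) k%:R \o g) x| <= k%:R.
    by rewrite ler_norml; exact: clamp_itv.
  apply: (le_trans (poincare_of_logsob_bounded HK K0 q2 mn n0 lk gk)).
  apply: lee_wpmul2l; first by rewrite lee_fin ltW// divr_gt0.
  apply: ge0_le_integral => //.
  + by move=> x _; rewrite lee_fin mulr_ge0 ?sqr_ge0.
  + by apply/measurable_EFinP; exact: measurable_sqr_slope.
  + by apply/measurable_EFinP; exact: measurable_sqr_slope.
  + move=> x _; rewrite lee_fin ler_wpM2r// lerXn2r ?nnegrE ?local_slope_ge0//.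
    by rewrite -[leRHS]mul1r; exact: local_slope_dominated lg ler01 (dom k).
move: Vk; case: (_ * _)%E => [D||] Vk.
(* Here the values are clamped. Integrability comes first because |g| is the dominating function
   under which the means converge. *)
- have ig := integrable_of_variance_bound mg Vk.
  apply: (variance_cvg_le _ _ (integrable_abse ig) _ _ Vk) => //.
  + by move=> k; apply: measurable_maxr => //; exact: measurable_minr.
  + move=> k x /=; have := clamp_contr (- k%:R) k%:R (g x) 0.
    by rewrite (@clamp_id _ _ _ 0) ?subr0// oppr_le0 ler0n.
  + move=> x; apply: cvg_near_cst; near=> k; rewrite /= clamp_id// -ler_norml.
    by near: k; exact: nbhs_infty_ger.
- exact: leey.
- have := Vk 0; rewrite variance_integral leeNy_eq => /eqP V0.
  suff : (0 <= -oo :> \bar R)%E by [].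
  by rewrite -V0; apply: integral_ge0 => x _; rewrite lee_fin sqr_ge0.
Unshelve. all: by end_near. Qed.

(** * Primitives of a weight as test functions *)

Lemma derive_quotient_cvg (R : realType) (f : R -> R) (x d : R) : is_derive x 1 f d ->
  h^-1 * (f (h + x) - f x) @[h --> 0^'] --> d.
Proof.
move=> [/cvg_ex[l fl] fd].
have dl : 'D_1 f x = l by apply/cvg_lim.
have -> : d = l by rewrite -fd dl.
move: fl; set g := (X in X @ _ --> _); set g' := (X in _ -> X @ _ --> _).
by rewrite (_ : g = g')//; apply/funext => h; rewrite /g /g' /= /GRing.scale /= mulr1.
Qed.

Lemma local_slope_derive_le (R : realType) (f : R -> R) (x d : R) :
  locally_lipschitz f -> is_derive x 1 f d -> local_slope f x <= `|d|.
Proof.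
move=> lf /derive_quotient_cvg /cvgrPdist_le H.
apply/ler_addgt0Pr => e e0.
have [r /= r0 Hr] := H _ e0.
apply: (@local_slope_le _ _ _ _ (r / 2)) => //; first exact: divr_gt0.
move=> y /andP[xy yr].
have yx0 : y - x != 0 by rewrite -normr_gt0 distrC.
have := Hr (y - x); rewrite /= sub0r normrN distrC => /(_ _ yx0).
have -> : `|x - y| < r by apply: le_lt_trans yr _; lra.
move=> /(_ isT); rewrite subrK => H1.
have H2 : `|(y - x)^-1 * (f y - f x)| <= `|d| + e.
  rewrite -[X in `|X|](subrK d) (le_trans (ler_normD _ _))// addrC lerD2l.
  by rewrite distrC.
by rewrite distrC (distrC x y); move: H2; rewrite normrM normfV mulrC ler_pdivrMr ?normr_gt0.
Qed.

Definition primitive (R : realType) (w : R -> R) (m x : R) : R :=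
  (\int[lebesgue_measure]_(t in `[m, x]) w t)%R.

Lemma primitive_lo (R : realType) (w : R -> R) (m x : R) : x <= m -> primitive w m x = 0.
Proof.
rewrite /primitive le_eqVlt => /predU1P[->|xm]; first by rewrite set_itv1 Rintegral_set1.
by rewrite set_itv_ge ?Rintegral_set0// bnd_simp -ltNge.
Qed.

Lemma primitive_increment (R : realType) (w : R -> R) (k m x y : R) :
  measurable_fun [set: measurableTypeR R] w -> (forall t, 0 <= w t <= k) -> x <= y ->
  0 <= primitive w m y - primitive w m x <= k * (y - x).
Proof.
move=> mw wk.
have w0 t : 0 <= w t by case/andP: (wk t).
have wle t : w t <= k by case/andP: (wk t).
have k0 : 0 <= k := le_trans (w0 0) (wle 0).
have iw (a b : R) : lebesgue_measure.-integrable `[a, b] (EFin \o w).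
  apply: (@bounded_itv_integrable _ _ _ _ k) => //; first exact: measurable_funTS.
  by move=> t _; rewrite ger0_norm.
have main a b : m <= a -> a <= b -> 0 <= primitive w m b - primitive w m a <= k * (b - a).
  move=> ma ab; have iab : lebesgue_measure.-integrable `]a, b] (EFin \o w).
    by apply: integrableS (iw a b) => //; apply: subset_itvr; rewrite bnd_simp.
  have ik : lebesgue_measure.-integrable `]a, b] (EFin \o cst k).
    exact: (continuous_itv_integrable a b false false (@cst_continuous R R k)).
  rewrite /primitive Rintegral_itvB//.
  rewrite Rintegral_ge0//=.
  apply: (@le_trans _ _ (\int[lebesgue_measure]_(t in `]a, b]) cst k t)%R).
    by apply: le_Rintegral => // t _; exact: wle.
  rewrite Rintegral_cst//= lebesgue_measure_itv/= lte_fin.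
  move: ab; rewrite le_eqVlt => /predU1P[->|ab]; first by rewrite ltxx subrr mulr0.
  by rewrite ab.
move=> xy; have [mx|xm] := leP m x; first exact: main.
have [my|ym] := leP m y; last first.
  by rewrite !primitive_lo ?(ltW ym)// ?(ltW xm)// subrr lexx mulr_ge0 ?subr_ge0.
have := main m y (lexx m) my.
rewrite [primitive w m m]primitive_lo// [primitive w m x]primitive_lo ?(ltW xm)//.
move=> /andP[-> /le_trans]; apply; rewrite ler_wpM2l//; lra.
Qed.

Lemma primitive_dist (R : realType) (w : R -> R) (k m x y : R) :
  measurable_fun [set: measurableTypeR R] w -> (forall t, 0 <= w t <= k) ->
  `|primitive w m x - primitive w m y| <= k * `|x - y|.
Proof.
move=> mw wk; wlog xy : x y / y <= x.
  move=> H; have /orP[|] := le_total x y; last exact: H.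
  by move=> xy; rewrite distrC [`|x - y|]distrC; exact: H.
have /andP[h1 h2] := primitive_increment m mw wk xy.
by rewrite !ger0_norm// subr_ge0.
Qed.

Lemma primitive_locally_lipschitz (R : realType) (w : R -> R) (k m : R) :
  measurable_fun [set: measurableTypeR R] w -> (forall t, 0 <= w t <= k) ->
  locally_lipschitz (primitive w m).
Proof.
move=> mw wk; apply/locally_lipschitzP => a b; exists k.
  by have /andP[/le_trans h1 /h1] := wk 0.
by move=> x y _ _; exact: primitive_dist.
Qed.

Lemma primitive_gt0 (R : realType) (w : R -> R) (k m x : R) :
  measurable_fun [set: measurableTypeR R] w -> (forall t, 0 < w t <= k) -> m < x ->
  0 < primitive w m x.
Proof.
move=> mw wk mx; rewrite /primitive -lte_fin /Rintegral fineK.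
  apply: itv_integral_gt0 => //; first exact/measurable_EFinP.
  by move=> t; rewrite lte_fin; case/andP: (wk t).
apply: integrable_fin_num => //.
apply: (@bounded_itv_integrable _ _ _ _ k) => //; first exact: measurable_funTS.
by move=> t _; case/andP: (wk t) => w0 wl; rewrite gtr0_norm.
Qed.

Lemma primitive_derive (R : realType) (w : R -> R) (k m : R) :
  measurable_fun [set: measurableTypeR R] w -> (forall t, 0 <= w t <= k) ->
  {ae lebesgue_measure, forall x, m < x -> is_derive x 1 (primitive w m) (w x)}.
Proof.
move=> mw wk.
have iw (a b : R) : lebesgue_measure.-integrable `[a, b] (EFin \o w).
  apply: (@bounded_itv_integrable _ _ _ _ k) => //; first exact: measurable_funTS.
  by move=> t _; case/andP: (wk t) => w0 wl; rewrite ger0_norm.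
have lw : locally_integrable [set: R] w.
  split => //; first exact: openT.
  move=> K _ cK; have [M [_ HM]] := compact_bounded cK.
  have KM : K `<=` `[- (M + 1), M + 1]%classic.
    move=> t Kt; rewrite /= in_itv/= -ler_norml.
    by apply: (HM (M + 1)) => //; rewrite ltrDl.
  have mK := compact_measurable cK.
  have /integrableP[_ /le_lt_trans] := iw (- (M + 1)) (M + 1); apply => //.
  apply: ge0_subset_integral => //; apply: measurable_funTS.
  by do 2 apply: measurableT_comp => //; exact/measurable_EFinP.
have := FTC1 (fun y => iw m y) lw.
apply: filterS; first exact: (ae_filter_ringOfSetsType lebesgue_measure).
move=> x H mx; have := H; rewrite lte_fin => /(_ mx)[dx dE].
by rewrite -dE derive1E; exact: derivableP.
Qed.

Lemma powR_split1 (R : realType) (x p : R) : 0 < x -> x `^ p = x `^ (p - 1) * x.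
Proof.
move=> x0; rewrite -[in LHS](subrK 1 p) [x `^ (p - 1 + 1)]powRD.
  by rewrite powRr1// ltW.
by rewrite (gt_eqF x0) implybT.
Qed.

Lemma powR_sub_le (R : realType) (p a b : R) : 1 <= p -> 0 <= a -> 0 < b ->
  b `^ p - a `^ p <= p * b `^ (p - 1) * (b - a).
Proof.
move=> p1 a0 b0.
have bpE := powR_split1 p b0.
rewrite bpE.
have ab : 0 <= a / b by rewrite divr_ge0// ltW.
have bern : p * (a / b) - (p - 1) <= (a / b) `^ p.
  move: p1; rewrite le_eqVlt => /predU1P[<-|p1]; first by rewrite powRr1// mul1r subrr subr0.
  have p0 : 0 < p by lra.
  have := powR_young1 p1 ab; rewrite -mulrDl ler_pdivlMr// => H; lra.
have bp : 0 < b `^ (p - 1) by exact: powR_gt0.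
have -> : a `^ p = (a / b) `^ p * (b `^ (p - 1) * b).
  by rewrite -bpE -powRM ?(ltW b0)// divfK// gt_eqF.
have H : (p * (a / b) - (p - 1)) * (b `^ (p - 1) * b) <= (a / b) `^ p * (b `^ (p - 1) * b).
  by rewrite ler_wpM2r// mulr_ge0// ltW.
have e : a = a / b * b by rewrite divfK// gt_eqF.
rewrite [in leRHS]e; move: H; set u := a / b; set B := b `^ (p - 1); lra.
Qed.

Lemma powR_dist (R : realType) (p a b M : R) : 1 <= p -> 0 <= a <= M -> 0 <= b <= M ->
  `|b `^ p - a `^ p| <= p * M `^ (p - 1) * `|b - a|.
Proof.
move=> p1; have p0 : 0 <= p by lra.
wlog ab : a b / a <= b.
  move=> H aM bM; have /orP[|ba] := le_total a b; first by move=> ab; exact: H.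
  by rewrite distrC [`|b - a|]distrC; exact: H.
move=> /andP[a0 aM] /andP[b0 bM].
rewrite !ger0_norm ?subr_ge0 ?ge0_ler_powR ?nnegrE//.
have [b_0|bN0] := eqVneq b 0.
  have -> : a = 0 by lra.
  by rewrite b_0 !subrr mulr0.
have bp : 0 < b by rewrite lt_def bN0.
apply: (le_trans (powR_sub_le p1 a0 bp)).
rewrite ler_wpM2r ?subr_ge0// ler_wpM2l//.
by rewrite ge0_ler_powR ?nnegrE ?subr_ge0// (le_trans b0).
Qed.

Definition plateau (R : realType) (p : R) (w : R -> R) (m x1 x : R) : R :=
  primitive w m (clamp m x1 x) `^ p.

Lemma primitive_clamp_itv (R : realType) (w : R -> R) (k m x1 x : R) :
  measurable_fun [set: measurableTypeR R] w -> (forall t, 0 <= w t <= k) -> m <= x1 ->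
  0 <= primitive w m (clamp m x1 x) <= primitive w m x1.
Proof.
move=> mw wk mx1; have /andP[h1 h2] := clamp_itv x mx1.
have /andP[+ _] := primitive_increment m mw wk h1.
rewrite [primitive w m m]primitive_lo// subr0 => ->.
by have /andP[+ _] := primitive_increment m mw wk h2; rewrite subr_ge0.
Qed.

(** The exponent is at least 1, which for q - 1 means 2 <= q: this keeps V^p Lipschitz at [m], where
    V vanishes. *)
Lemma plateau_dist (R : realType) (p : R) (w : R -> R) (k m x1 x y : R) :
  measurable_fun [set: measurableTypeR R] w -> (forall t, 0 <= w t <= k) -> m <= x1 ->
  1 <= p -> `|plateau p w m x1 x - plateau p w m x1 y| <=
    p * primitive w m x1 `^ (p - 1) * k * `|x - y|.
Proof.
move=> mw wk mx1 p1.
apply: (le_trans (powR_dist p1 (primitive_clamp_itv y mw wk mx1) (primitive_clamp_itv x mw wk mx1))).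
rewrite -[leRHS]mulrA ler_wpM2l//.
  by rewrite mulr_ge0 ?powR_ge0//; lra.
apply: (le_trans (primitive_dist m _ _ mw wk)); rewrite ler_wpM2l ?clamp_contr//.
by have /andP[/le_trans h1 /h1] := wk 0.
Qed.

Lemma plateau_locally_lipschitz (R : realType) (p : R) (w : R -> R) (k m x1 : R) :
  measurable_fun [set: measurableTypeR R] w -> (forall t, 0 <= w t <= k) -> m <= x1 ->
  1 <= p -> locally_lipschitz (plateau p w m x1).
Proof.
move=> mw wk mx1 p1; apply/locally_lipschitzP => a b.
exists (p * primitive w m x1 `^ (p - 1) * k).
  have k0 : 0 <= k by have /andP[/le_trans h1 /h1] := wk 0.
  by rewrite !mulr_ge0 ?powR_ge0//; lra.
by move=> x y _ _; exact: plateau_dist.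
Qed.

Lemma plateau_lo (R : realType) (p : R) (w : R -> R) (m x1 x : R) :
  p != 0 -> x <= m -> plateau p w m x1 x = 0.
Proof. by move=> p0 xm; rewrite /plateau clamp_lo// primitive_lo// powR0. Qed.

Lemma plateau_hi (R : realType) (p : R) (w : R -> R) (m x1 x : R) :
  m <= x1 -> x1 <= x -> plateau p w m x1 x = primitive w m x1 `^ p.
Proof. by move=> mx1 xx; rewrite /plateau clamp_hi. Qed.

Lemma plateau_le (R : realType) (p : R) (w : R -> R) (k m x1 x y : R) :
  measurable_fun [set: measurableTypeR R] w -> (forall t, 0 <= w t <= k) -> m <= x1 ->
  0 <= p -> x <= y -> plateau p w m x1 x <= plateau p w m x1 y.
Proof.
move=> mw wk mx1 p0 xy.
have /andP[hx _] := primitive_clamp_itv x mw wk mx1.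
have /andP[hy _] := primitive_clamp_itv y mw wk mx1.
apply: ge0_ler_powR; rewrite ?nnegrE//.
have cxy : clamp m x1 x <= clamp m x1 y.
  rewrite /clamp ge_max le_max lexx/= le_max; apply/orP; right.
  by rewrite le_min !ge_min lexx xy orbT.
by have /andP[+ _] := primitive_increment m mw wk cxy; rewrite subr_ge0.
Qed.

Lemma plateau_derive (R : realType) (p : R) (w : R -> R) (k m x1 : R) :
  measurable_fun [set: measurableTypeR R] w -> (forall t, 0 < w t <= k) -> m <= x1 ->
  {ae lebesgue_measure, forall x, m < x < x1 ->
    is_derive x 1 (plateau p w m x1) (p * primitive w m x `^ (p - 1) * w x)}.
Proof.
move=> mw wk mx1.
have wk' t : 0 <= w t <= k by case/andP: (wk t) => /ltW -> ->.
have := primitive_derive m mw wk'.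
apply: filterS; first exact: (ae_filter_ringOfSetsType lebesgue_measure).
move=> x H /andP[mx xx1]; have {H}dP := H mx.
have P0 := primitive_gt0 mw wk mx.
have dc : is_derive x 1 (fun y => primitive w m y `^ p) (p * primitive w m x `^ (p - 1) * w x).
  exact: (@is_derive1_comp R (fun y => y `^ p) (primitive w m) x _ _ (is_derive1_powR p P0) dP).
apply: near_eq_is_derive dc.
have : x \in `]m, x1[ by rewrite in_itv/= mx.
move=> /near_in_itvoo; apply: filterS => y.
by rewrite in_itv/= => /andP[my yx]; rewrite /plateau clamp_id// !ltW.
Qed.

(** Difference quotients converge almost everywhere to the derivative and their integrals telescope
    to at most the height of the plateau. Fatou gives the inequality in the direction needed. *)
Lemma integral_plateau_derive_le (R : realType) (p : R) (w : R -> R) (k m x1 : R) :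
  measurable_fun [set: measurableTypeR R] w -> (forall t, 0 < w t <= k) -> m <= x1 ->
  1 <= p ->
  (\int[lebesgue_measure]_(x in `]m, x1[) (p * primitive w m x `^ (p - 1) * w x)%:E <=
    (primitive w m x1 `^ p)%:E)%E.
Proof.
move=> mw wk mx1 p1.
have wk' t : 0 <= w t <= k by case/andP: (wk t) => /ltW -> ->.
have p0 : 0 <= p by lra.
have lf := plateau_locally_lipschitz mw wk' mx1 p1.
have cf := locally_lipschitz_continuous lf.
set f := plateau p w m x1 in lf cf *.
have fle x y : x <= y -> f x <= f y by exact: plateau_le.
pose F j x := j.+1%:R * (f (x + j.+1%:R^-1) - f x).
have h0 j : 0 < (j.+1%:R^-1 : R) by rewrite invr_gt0.
have cF j : continuous (F j).
  by move=> x; apply: cvgM; [exact: cvg_cst|exact: continuous_increment].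
have mF j : measurable_fun [set: measurableTypeR R] (F j).
  exact: continuous_measurable_fun.
have F0 j x : 0 <= F j x.
  by rewrite mulr_ge0// subr_ge0 fle// lerDl ltW.
have mP : measurable_fun [set: measurableTypeR R] (primitive w m).
  exact: measurable_locally_lipschitz (primitive_locally_lipschitz m mw wk').
apply: (@fatou_cvg_le _ (measurableTypeR R) R lebesgue_measure `]m, x1[%classic F) => //.
- by move=> j; exact: measurable_funTS.
- have := plateau_derive p mw wk mx1.
  apply: filterS; first exact: (ae_filter_ringOfSetsType lebesgue_measure).
  move=> x H; rewrite /= in_itv/= => /H/derive_quotient_cvg/cvgrPdist_le dq.
  apply/cvgrPdist_le => e e0; have [r /= r0 Hr] := dq e e0.
  near=> j; rewrite /F -{1}[j.+1%:R]invrK (addrC x); apply: Hr; last by rewrite gt_eqF.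
  by rewrite /= sub0r normrN gtr0_norm//; near: j; exact: (near_infty_natSinv_lt (PosNum r0)).
- apply: measurable_funTS; apply: measurable_funM => //; apply: measurable_funM => //.
  exact: (measurableT_comp (f := fun y => y `^ (p - 1))).
- move=> j.
  apply: (@le_trans _ _ (\int[lebesgue_measure]_(x in `[m, x1]) (F j x)%:E)%E).
    apply: ge0_subset_integral => //.
    + by apply/measurable_EFinP; exact: measurable_funTS.
    + by move=> x _; rewrite lee_fin.
    + by apply: subset_itv; rewrite bnd_simp.
  have iF := continuous_itv_integrable m x1 true false (cF j).
  have -> : (\int[lebesgue_measure]_(x in `[m, x1]) (F j x)%:E =
     (\int[lebesgue_measure]_(x in `[m, x1]) F j x)%R%:E)%E.
    by rewrite /Rintegral fineK//; exact: integrable_fin_num.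
  rewrite lee_fin RintegralZl//; last first.
    exact: (continuous_itv_integrable m x1 true false (@continuous_increment R f j.+1%:R^-1 cf)).
  rewrite -ler_pdivlMl//; move: (h0 j); set h := _^-1 => hh.
  have f1 x : x1 <= x <= x1 + h -> f x <= primitive w m x1 `^ p.
    by move=> /andP[xx _]; rewrite /f plateau_hi.
  have f0 x : m <= x <= m + h -> 0 <= f x by move=> _; exact: powR_ge0.
  have H := Rintegral_increment_le cf mx1 (ltW hh) f1 f0.
  apply: (le_trans H).
  by rewrite subr0.
Unshelve. all: by end_near. Qed.

(** The quadratic branch is recovered from z^q = z^(q-2) z^2 and z >= e. *)
Lemma Hq_scaled_le (R : realType) (q e z : R) : 2 <= q -> 0 < e -> e <= z ->
  Num.min (e `^ (q - 2)) 1 * Hq q z <= z `^ q.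
Proof.
move=> q2 e0 ez; have z0 : 0 < z by exact: lt_le_trans ez.
have zq : z `^ q = z `^ (q - 2) * z ^+ 2.
  rewrite (powR_split1 q z0) (powR_split1 (q - 1) z0) -mulrA -expr2.
  by congr (_ `^ _ * _); ring.
have H1 : Num.min (e `^ (q - 2)) 1 * z ^+ 2 <= z `^ q.
  rewrite zq ler_wpM2r ?sqr_ge0// (@le_trans _ _ (e `^ (q - 2)))//.
    by rewrite ge_min lexx.
  by rewrite ge0_ler_powR ?nnegrE ?subr_ge0// ltW.
have H2 : Num.min (e `^ (q - 2)) 1 * z `^ q <= z `^ q.
  by rewrite -[leRHS]mul1r ler_wpM2r ?powR_ge0// ge_min lexx orbT.
by rewrite /Hq (gtr0_norm z0); case: (leP (z ^+ 2) (z `^ q)).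
Qed.

(** For f = V^(q-1) the quotient f'/f is z = (q - 1) w / V, at least e by assumption. Then z^q f^2 n
    = (q - 1)^(q-1) (z f) (w^(q-1) n), and z f is f' itself: the energy density is at most a
    constant times f', which integrates to the height of f. *)
Lemma power_energy_le (R : realType) (q e s V w nx : R) : 2 <= q -> 0 < e ->
  0 < V -> 0 < w -> 0 <= s -> 0 <= nx -> w `^ (q - 1) * nx <= 1 ->
  e * V <= (q - 1) * w -> s <= (q - 1) * V `^ (q - 1 - 1) * w ->
  Hq q (s / V `^ (q - 1)) * (V `^ (q - 1)) ^+ 2 * nx <=
  (q - 1) `^ (q - 1) / Num.min (e `^ (q - 2)) 1 * ((q - 1) * V `^ (q - 1 - 1) * w).
Proof.
move=> q2 e0 V0 w0 s0 nx0 wn eV sc.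
have q1 : 0 < q - 1 by lra.
have qn0 : 0 < q by lra.
set mn := Num.min _ _.
have mn0 : 0 < mn by rewrite lt_min ltr01 powR_gt0.
set z := (q - 1) * w / V.
have z0 : 0 < z by rewrite divr_gt0// mulr_gt0.
have ez : e <= z by rewrite ler_pdivlMr.
have Vq0 : 0 < V `^ (q - 1) by exact: powR_gt0.
have VE := powR_split1 (q - 1) V0.
have cE : (q - 1) * V `^ (q - 1 - 1) * w = z * V `^ (q - 1).
  by rewrite VE /z; field; rewrite gt_eqF.
rewrite cE in sc *.
have Hsz : Hq q (s / V `^ (q - 1)) <= Hq q z.
  apply: Hq_mono; first exact: ltW.
  by rewrite !ger0_norm ?(ltW z0) ?divr_ge0 ?(ltW Vq0)// ler_pdivrMr.
have zq : z `^ q = z * ((q - 1) `^ (q - 1) * w `^ (q - 1) / V `^ (q - 1)).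
  rewrite (powR_split1 q z0) mulrC; congr (_ * _).
  rewrite /z powRM ?invr_ge0 ?(ltW V0)//; last by rewrite mulr_ge0// ltW.
  rewrite powRM ?(ltW q1) ?(ltW w0)//; congr (_ * _).
  by rewrite -powR_inv1 ?(ltW V0)// -powRrM mulN1r powRN.
set h := Hq q (s / _) in Hsz *.
rewrite [leRHS]mulrAC ler_pdivlMr//.
apply: (@le_trans _ _ (z `^ q * (V `^ (q - 1)) ^+ 2 * nx)).
  rewrite [leLHS](_ : _ = mn * h * (V `^ (q - 1)) ^+ 2 * nx); last by ring.
  rewrite ler_wpM2r// ler_wpM2r ?sqr_ge0//.
  by apply: le_trans (Hq_scaled_le q2 e0 ez); rewrite ler_wpM2l// ltW.
have -> : z `^ q * (V `^ (q - 1)) ^+ 2 * nx =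
   (q - 1) `^ (q - 1) * (z * V `^ (q - 1)) * (w `^ (q - 1) * nx).
  by rewrite zq; field; rewrite gt_eqF.
rewrite ler_piMr//; apply: mulr_ge0; first exact: powR_ge0.
by apply: mulr_ge0; [exact: ltW|exact: powR_ge0].
Qed.

Lemma hq_energy_slope0 (R : realType) (q : R) (f n : R -> R) (x : R) : q != 0 ->
  local_slope f x = 0 -> hq_energy q f n x = 0.
Proof. by move=> q0 s0; rewrite /hq_energy s0 !(mul0r, Hq0). Qed.

Lemma plateau_energy_le (R : realType) (q e : R) (w n : R -> R) (k m x1 : R) :
  measurable_fun [set: measurableTypeR R] n -> (forall x, 0 <= n x) -> 2 <= q ->
  measurable_fun [set: measurableTypeR R] w -> (forall t, 0 < w t <= k) ->
  (forall x, w x `^ (q - 1) * n x <= 1) -> m <= x1 -> 0 < e ->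
  (forall x, m < x < x1 -> e * primitive w m x <= (q - 1) * w x) ->
  (\int[lebesgue_measure]_x (hq_energy q (plateau (q - 1) w m x1) n x)%:E <=
   ((q - 1) `^ (q - 1) / Num.min (e `^ (q - 2)) 1 * primitive w m x1 `^ (q - 1))%:E)%E.
Proof.
move=> mn n0 q2 mw wk wn mx1 e0 He.
have q11 : 1 <= q - 1 by lra.
have wk' t : 0 <= w t <= k by case/andP: (wk t) => /ltW -> ->.
have lf := plateau_locally_lipschitz mw wk' mx1 q11.
have df := plateau_derive (q - 1) mw wk mx1.
have fE0 x : plateau (q - 1) w m x1 (clamp m x1 x) = plateau (q - 1) w m x1 x.
  by rewrite /plateau (clamp_id (clamp_itv x mx1)).
have fx0 x : m < x < x1 -> plateau (q - 1) w m x1 x = primitive w m x `^ (q - 1).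
  by move=> /andP[mx xx1]; rewrite /plateau clamp_id// !ltW.
move: (plateau _ _ _ _) lf df fE0 fx0 => f lf df fE0 fx0.
have mE := measurable_hq_energy q lf mn.
have mEe (D : set (measurableTypeR R)) : measurable_fun D (EFin \o hq_energy q f n).
  by apply/measurable_EFinP; exact: measurable_funTS.
set c0 := _ / _.
have c00 : 0 <= c0 by rewrite divr_ge0 ?powR_ge0// le_min powR_ge0 ler01.
have mP : measurable_fun [set: measurableTypeR R] (primitive w m).
  exact: measurable_locally_lipschitz (primitive_locally_lipschitz m mw wk').
pose c x := (q - 1) * primitive w m x `^ (q - 1 - 1) * w x.
have mc : measurable_fun [set: measurableTypeR R] c.
  apply: measurable_funM => //; apply: measurable_funM => //.
  exact: (measurableT_comp (f := fun y => y `^ (q - 1 - 1))).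
have c_0 x : 0 <= c x.
  rewrite /c; apply: mulr_ge0; last by case/andP: (wk' x).
  by apply: mulr_ge0; [lra|exact: powR_ge0].
have -> : (\int[lebesgue_measure]_x (hq_energy q f n x)%:E =
   \int[lebesgue_measure]_(x in `]m, x1[) (hq_energy q f n x)%:E)%E.
  transitivity (\int[lebesgue_measure]_(x in `[m, x1]) (hq_energy q f n x)%:E)%E.
    rewrite [RHS]integral_mkcond; apply: eq_integral => x _; rewrite patchE.
    case: ifPn => //; rewrite notin_setE /= in_itv/= => /negP xo.
    have lfc := locally_lipschitz_clamp mx1 lf.
    have fE : f = f \o clamp m x1 by apply/funext => y /=; rewrite fE0.
    have s0 : local_slope f x = 0 by rewrite fE; exact: local_slope_clamp_out.
    by rewrite -[RHS]/(0%:E) hq_energy_slope0// gt_eqF//; lra.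
  by apply: integral_itv_bndoo; exact: mEe.
apply: (@le_trans _ _ (\int[lebesgue_measure]_(x in `]m, x1[) (c0 * c x)%:E)%E).
  apply: ae_ge0_le_integral => //.
  - by move=> x _; rewrite lee_fin hq_energy_ge0.
  - by move=> x _; rewrite lee_fin mulr_ge0.
  - by apply/measurable_EFinP; apply: measurable_funTS; exact: measurable_funM.
  move: df; apply: filterS; first exact: (ae_filter_ringOfSetsType lebesgue_measure).
  move=> x H; rewrite /= in_itv/= => mxx; have dx := H mxx; have /andP[mx xx1] := mxx.
  have P0 := primitive_gt0 mw wk mx.
  have sx : local_slope f x <= `|c x| := local_slope_derive_le lf dx.
  rewrite (ger0_norm (c_0 x)) in sx.
  rewrite lee_fin /hq_energy (fx0 _ mxx); apply: power_energy_le => //.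
  - by case/andP: (wk x).
  - exact: local_slope_ge0.
  - exact: He.
under eq_integral do rewrite EFinM.
rewrite ge0_integralZl//; last 2 first.
- by apply/measurable_EFinP; exact: measurable_funTS.
- by move=> x _; rewrite lee_fin.
rewrite (EFinM c0); apply: lee_wpmul2l; first by rewrite lee_fin.
exact: integral_plateau_derive_le mw wk mx1 q11.
Qed.

(** * The lower bound by B *)

Lemma mul_ln_dual (R : realType) (y z : R) : 0 <= y -> 0 < z ->
  y * ln z + y - z <= y * ln y.
Proof.
rewrite le_eqVlt => /predU1P[<-|y0] z0; first by rewrite !mul0r; lra.
have zy : 0 < z / y by rewrite divr_gt0.
have := ler_wpM2l (ltW y0) (ln_le_sub1 zy).
have yz : y * (z / y) = z by rewrite mulrC divfK// gt_eqF.
by rewrite lnM ?posrE ?invr_gt0// lnV ?posrE// (mulrBr y (z / y)) yz; lra.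
Qed.

(* The dual formula [Ent y >= \int y h] for [\int e^h <= 1], with [h] equal to
   [ln (1 + 1/(2p))] on [`[x0, +oo[] and to [0] on the rest of [`]m, +oo[]. *)
Lemma entropy_plateau_ge (R : realType) (mu : probability (measurableTypeR R) R)
    (y : R -> R) (m x0 a : R) :
  measurable_fun [set: measurableTypeR R] y -> (forall x, 0 <= y x <= a) -> 0 < a ->
  m < x0 -> (forall x, x <= m -> y x = 0) -> (forall x, x0 <= x -> y x = a) ->
  (mu `]m, +oo[%classic <= (2^-1)%:E)%E -> 0 < fine (mu `[x0, +oo[%classic) ->
  ((a * (fine (mu `[x0, +oo[%classic) *
      ln (1 + (2 * fine (mu `[x0, +oo[%classic))^-1)))%:E <= entropy mu y)%E.
Proof.
move=> my ya a0 mx0 ylo yhi hm; set A := `[x0, +oo[%classic; set D := `]m, +oo[%classic in hm *.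
have mA : measurable (A : set (measurableTypeR R)) by exact: measurable_itv.
have mD : measurable (D : set (measurableTypeR R)) by exact: measurable_itv.
set p := fine (mu A) => p0.
have muA : mu A = p%:E by rewrite /p fineK// fin_num_measure.
have muD : mu D = (fine (mu D))%:E by rewrite fineK// fin_num_measure.
have d2 : fine (mu D) <= 2^-1 by rewrite -lee_fin -muD.
set d := fine (mu D) in muD d2.
have y0 x : 0 <= y x by case/andP: (ya x).
have iy : mu.-integrable setT (EFin \o y).
  apply: (@bounded_integrable _ _ _ (a)) => // x.
  by case/andP: (ya x) => h1 h2; rewrite ger0_norm.
have fy : (\int[mu]_x (y x)%:E)%E \is a fin_num by exact: integrable_fin_num.
set c := fine (\int[mu]_x (y x)%:E)%E.
have cE : (\int[mu]_x (y x)%:E = c%:E)%E by rewrite fineK.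
have iA : mu.-integrable setT (EFin \o (\1_A : R -> R)).
  by apply: (@bounded_integrable _ _ _ (1)) => // x; rewrite ger0_norm// indicE lern1 leq_b1.
have iD : mu.-integrable setT (EFin \o (\1_D : R -> R)).
  by apply: (@bounded_integrable _ _ _ (1)) => // x; rewrite ger0_norm// indicE lern1 leq_b1.
have A1 : (\int[mu]_x (\1_A x)%:E = p%:E)%E by rewrite integral_indic// setIT.
have D1 : (\int[mu]_x (\1_D x)%:E = d%:E)%E by rewrite integral_indic// setIT.
have c0 : 0 < c.
  apply: (@lt_le_trans _ _ (a * p)); first exact: mulr_gt0.
  rewrite -lee_fin -cE EFinM -A1 -ge0_integralZl//; last 2 first.
  - exact/measurable_EFinP.
  - by rewrite lee_fin ltW.
  apply: ge0_le_integral => //.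
  - by move=> x _; rewrite -EFinM lee_fin mulr_ge0// ltW.
  - by apply: emeasurable_funM => //; exact/measurable_EFinP.
  - exact/measurable_EFinP.
  - move=> x _; rewrite -EFinM lee_fin indicE; case: (boolP (x \in A)) => [|_]; last by rewrite mulr0.
    by rewrite inE /A /= in_itv/= andbT => /yhi ->; rewrite mulr1.
rewrite /entropy cE leeBrDr//.
set L := ln _.
(* This is y ln z + y - z with z = c e^h, that is c (1 + 1/(2p)) on [A], c on the rest of [D] and 0
   elsewhere, where y vanishes too. *)
pose phi x := (ln c + 1) * y x + ((a * L - c / (2 * p)) * \1_A x + (- c) * \1_D x).
have p20 : 0 < 2 * p by exact: mulr_gt0.
have q0 : 0 < 1 + (2 * p)^-1 by rewrite ltr_pwDl// invr_ge0 ltW.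
have AD x : x \in A -> x \in D.
  by rewrite !inE /A /D /= !in_itv/= !andbT; exact: lt_le_trans.
have phiy x : phi x <= y x * ln (y x).
  rewrite /phi !indicE; have [xA|xA] := boolP (x \in A).
    rewrite (AD _ xA) !mulr1; have yx : y x = a.
      by apply: yhi; move: xA; rewrite inE /A /= in_itv/= andbT.
    rewrite yx; have := @mul_ln_dual _ a (c * (1 + (2 * p)^-1)) (ltW a0).
    rewrite mulr_gt0// => /(_ isT); apply: le_trans.
    by rewrite lnM ?posrE// -/L le_eqVlt; apply/orP; left; apply/eqP; ring.
  have [xD|xD] := boolP (x \in D).
    rewrite mulr0 add0r mulr1; apply: le_trans (mul_ln_dual (y0 x) c0).
    by rewrite le_eqVlt; apply/orP; left; apply/eqP; ring.
  rewrite ylo ?mulr0 ?mul0r ?addr0//.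
  by move: xD; rewrite notin_setE /D /= in_itv/= andbT => /negP; rewrite -leNgt.
have i1 : mu.-integrable setT (EFin \o (fun x => (ln c + 1) * y x)).
  exact: (integrableZl measurableT (ln c + 1) iy).
have i2 : mu.-integrable setT (EFin \o (fun x => (a * L - c / (2 * p)) * \1_A x)).
  exact: (integrableZl measurableT _ iA).
have i3 : mu.-integrable setT (EFin \o (fun x => (- c) * \1_D x)).
  exact: (integrableZl measurableT _ iD).
have iphi : mu.-integrable setT (EFin \o phi).
  exact: (integrableD measurableT i1 (integrableD measurableT i2 i3)).
have Iphi : (\int[mu]_x (phi x)%:E =
    ((ln c + 1) * c + ((a * L - c / (2 * p)) * p + (- c) * d))%:E)%E.
  rewrite (integralD measurableT i1 (integrableD measurableT i2 i3)).
  rewrite (integralD measurableT i2 i3).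
  rewrite (integralZl measurableT iy (ln c + 1)) (integralZl measurableT iA (a * L - c / (2 * p))).
  by rewrite (integralZl measurableT iD (- c)) cE A1 D1.
apply: (@le_trans _ _ (\int[mu]_x (phi x)%:E)%E).
  rewrite Iphi -EFinD lee_fin.
  have -> : (a * L - c / (2 * p)) * p = a * (p * L) - c / 2 by field; rewrite gt_eqF.
  have : c * d <= c / 2 by rewrite ler_wpM2l// ltW.
  lra.
have lb x : - (a + 1) ^+ 2 <= y x * ln (y x).
  apply: (le_trans _ (mul_ln_dual (y0 x) ltr01)); rewrite ln1 mulr0 add0r.
  have := y0 x; nra.
have ub x : y x * ln (y x) <= (a + 1) ^+ 2.
  have /andP[h1 h2] := ya x; move: (h1); rewrite le_eqVlt => /predU1P[<-|h3].
    by rewrite mul0r sqr_ge0.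
  have := ler_wpM2l h1 (ln_le_sub1 h3); nra.
apply: le_integral => //.
- apply: (@bounded_integrable _ _ _ ((a + 1) ^+ 2)).
    apply: measurable_funM => //; exact: measurableT_comp.
  by move=> x; rewrite ler_norml lb ub.
- by move=> x _; rewrite lee_fin.
Qed.

(** With z = 1/p this is z^3 <= (1 + z/2)^4, whose difference is a sum of nonnegative terms. Here
    the 3/4 of the lower bound arises. *)
Lemma ln_half_inv_ge (R : realType) (p : R) : 0 < p -> p <= 2^-1 ->
  3 / 4 * ln p^-1 <= ln (1 + (2 * p)^-1).
Proof.
move=> p0 p2; have z0 : 0 < p^-1 by rewrite invr_gt0.
rewrite (invfM 2 p) (mulrC 2^-1); set z := p^-1 in z0 *.
have w0 : 0 < 1 + z * 2^-1 by lra.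
suff : ln (z ^+ 3) <= ln ((1 + z * 2^-1) ^+ 4).
  by rewrite !lnXn// -![ln _ *+ _]mulr_natl; lra.
rewrite ler_ln ?posrE ?exprn_gt0// -subr_ge0.
have -> : (1 + z * 2^-1) ^+ 4 - z ^+ 3 = ((z * (z - 4)) ^+ 2 + 8 * z ^+ 2 + 32 * z + 16) / 16 by field.
by rewrite divr_ge0// !addr_ge0 ?sqr_ge0 ?mulr_ge0 ?sqr_ge0 ?(ltW z0).
Qed.

(** Truncating at [k.+1] keeps the weight finite and positive for every [k], also where n = 0 makes
    [density_pow] infinite. *)
Definition truncated_weight (R : realType) (q : R) (n : R -> R) (k : nat) (x : R) : R :=
  fine (Order.min (density_pow q n x) k.+1%:R%:E).

Lemma truncated_weightE (R : realType) (q : R) (n : R -> R) (k : nat) (x : R) :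
  0 <= n x ->
  ((truncated_weight q n k x)%:E = Order.min (density_pow q n x) k.+1%:R%:E)%E.
Proof.
move=> n0; have w0 := density_pow_gt0 q n0; rewrite /truncated_weight fineK//.
rewrite ge0_fin_numE; first by rewrite gt_min ltry orbT.
by rewrite le_min lee_fin ltW//=.
Qed.

Lemma truncated_weight_itv (R : realType) (q : R) (n : R -> R) (k : nat) (x : R) :
  0 <= n x -> 0 < truncated_weight q n k x <= k.+1%:R.
Proof.
move=> n0; rewrite -!lee_fin -lte_fin truncated_weightE//.
by rewrite lt_min density_pow_gt0//= lte_fin ltr0Sn ge_min lexx orbT.
Qed.

Lemma measurable_truncated_weight (R : realType) (q : R) (n : R -> R) (k : nat) :
  measurable_fun [set: measurableTypeR R] n ->
  measurable_fun [set: measurableTypeR R] (truncated_weight q n k).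
Proof.
move=> mn; apply: (measurableT_comp (f := fine)) => //.
by apply: measurable_mine => //; exact: measurable_density_pow.
Qed.

Lemma truncated_weight_powR_le (R : realType) (q : R) (n : R -> R) (k : nat) (x : R) :
  0 <= n x -> 1 < q -> truncated_weight q n k x `^ (q - 1) * n x <= 1.
Proof.
move=> n0 q1; have [->|nx] := eqVneq (n x) 0; first by rewrite mulr0.
have q10 : 0 < q - 1 by rewrite subr_gt0.
have np : 0 < n x by rewrite lt_def nx.
have /andP[t0 _] := truncated_weight_itv q k n0.
have tw : truncated_weight q n k x <= n x `^ (- (q - 1)^-1).
  rewrite -lee_fin truncated_weightE// ge_min /density_pow (negbTE nx) lexx//.
have H : truncated_weight q n k x `^ (q - 1) <= (n x)^-1.
  have -> : (n x)^-1 = (n x `^ (- (q - 1)^-1)) `^ (q - 1).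
    by rewrite -powRrM mulNr mulVf ?gt_eqF// powR_inv1// ltW.
  by rewrite ge0_ler_powR ?nnegrE ?powR_ge0 ?(ltW q10) ?(ltW t0).
apply: (le_trans (ler_wpM2r n0 H)); by rewrite mulVf.
Qed.

Lemma primitive_truncated_le (R : realType) (q m x : R) (n : R -> R) (k : nat) :
  measurable_fun [set: measurableTypeR R] n -> (forall x, 0 <= n x) ->
  ((primitive (truncated_weight q n k) m x)%:E =
    \int[lebesgue_measure]_(t in `[m, x]) Order.min (density_pow q n t) k.+1%:R%:E)%E.
Proof.
move=> mn n0; rewrite /primitive /Rintegral fineK.
  by apply: eq_integral => t _; rewrite truncated_weightE.
apply: integrable_fin_num => //.
apply: (@bounded_itv_integrable _ _ _ _ k.+1%:R).
  by apply: measurable_funTS; exact: measurable_truncated_weight.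
by move=> t _; have /andP[h1 h2] := truncated_weight_itv q k (n0 t); rewrite gtr0_norm.
Qed.

Lemma plateau_itv (R : realType) (p : R) (w : R -> R) (k m x1 x : R) :
  measurable_fun [set: measurableTypeR R] w -> (forall t, 0 <= w t <= k) -> m <= x1 ->
  0 <= p -> 0 <= plateau p w m x1 x <= primitive w m x1 `^ p.
Proof.
move=> mw wk mx1 p0; have /andP[h1 h2] := primitive_clamp_itv x mw wk mx1.
apply/andP; split; first exact: powR_ge0.
by apply: ge0_ler_powR; rewrite ?nnegrE//; exact: le_trans h1 h2.
Qed.

(** The height v = V(x_1)^(q-1) enters the entropy of f^2 squared but the energy only linearly;
    cancelling one factor leaves the bound on v. *)
Lemma logsob_plateau_le (R : realType) (mu : probability (measurableTypeR R) R)
    (q e K m x0 x1 : R) (w n : R -> R) (k : R) :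
  logsob_admissible q mu n K -> 0 <= K ->
  measurable_fun [set: measurableTypeR R] n -> (forall x, 0 <= n x) -> 2 <= q ->
  measurable_fun [set: measurableTypeR R] w -> (forall t, 0 < w t <= k) ->
  (forall x, w x `^ (q - 1) * n x <= 1) -> m < x1 -> x1 <= x0 -> 0 < e ->
  (forall x, m < x < x1 -> e * primitive w m x <= (q - 1) * w x) ->
  (mu `]m, +oo[%classic <= (2^-1)%:E)%E ->
  0 < fine (mu `[x0, +oo[%classic) <= 2^-1 ->
  3 * Num.min (e `^ (q - 2)) 1 / (4 * (q - 1) `^ (q - 1)) *
    (fine (mu `[x0, +oo[%classic) * ln (fine (mu `[x0, +oo[%classic))^-1) *
    primitive w m x1 `^ (q - 1) <= K.
Proof.
move=> HK K0 mn n0 q2 mw wk wn mx1 x10 e0 He hm; set p := fine _ => /andP[p0 p2].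
have q11 : 1 <= q - 1 by lra.
have qp : 0 < (q - 1) `^ (q - 1) by rewrite powR_gt0//; lra.
have wk' t : 0 <= w t <= k by case/andP: (wk t) => /ltW -> ->.
have lf := plateau_locally_lipschitz mw wk' (ltW mx1) q11.
have En := plateau_energy_le mn n0 q2 mw wk wn (ltW mx1) e0 He.
have q10 : 0 <= q - 1 by lra.
have flo x : x <= m -> plateau (q - 1) w m x1 x = 0.
  by move=> xm; rewrite plateau_lo// gt_eqF//; lra.
have fhi x : x0 <= x -> plateau (q - 1) w m x1 x = primitive w m x1 `^ (q - 1).
  by move=> xx; rewrite plateau_hi ?(ltW mx1)// (le_trans x10).
have fa x := plateau_itv x mw wk' (ltW mx1) q10.
have v0 : 0 < primitive w m x1 `^ (q - 1) by rewrite powR_gt0// (primitive_gt0 mw wk).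
move: (plateau _ _ _ _) lf En flo fhi fa => f lf En flo fhi fa.
move: (primitive _ _ _ `^ _) v0 En fhi fa => v v0 En fhi fa.
have flo2 x : x <= m -> f x ^+ 2 = 0 by move=> /flo ->; rewrite expr0n.
have fhi2 x : x0 <= x -> f x ^+ 2 = v ^+ 2 by move=> /fhi ->.
have fa2 x : 0 <= f x ^+ 2 <= v ^+ 2.
  by have /andP[h1 h2] := fa x; rewrite sqr_ge0/= lerXn2r ?nnegrE// ltW.
have mf2 : measurable_fun [set: measurableTypeR R] (fun x => f x ^+ 2).
  apply: measurable_funX.
  exact: measurable_locally_lipschitz lf.
have v20 : 0 < v ^+ 2 by exact: exprn_gt0.
have := entropy_plateau_ge mf2 fa2 v20 (lt_le_trans mx1 x10) flo2 fhi2 hm p0.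
move=> /le_trans/(_ (HK _ lf)).
have := lee_wpmul2l (_ : (0%:E <= K%:E)%E) En.
rewrite lee_fin => /(_ K0) H1 H2; have := le_trans H2 H1.
rewrite -EFinM lee_fin -/p => {H1 H2}.
have L := ln_half_inv_ge p0 p2.
set mn_ := Num.min _ _; have mn0 : 0 < mn_ by rewrite lt_min ltr01 powR_gt0.
set Q := (q - 1) `^ (q - 1) in qp *.
move=> H0; have H : v * (p * ln (1 + (2 * p)^-1)) <= K * (Q / mn_).
  rewrite -(ler_pM2l v0) [leLHS](_ : _ = v ^+ 2 * (p * ln (1 + (2 * p)^-1))); last by ring.
  by rewrite [leRHS](_ : _ = K * (Q / mn_ * v))//; ring.
have H2 : v * (p * (3 / 4 * ln p^-1)) <= K * (Q / mn_).
  apply: le_trans H; apply: ler_wpM2l; first exact: ltW.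
  by rewrite ler_wpM2l// ltW.
have -> : 3 * mn_ / (4 * Q) * (p * ln p^-1) * v = v * (p * (3 / 4 * ln p^-1)) / (Q / mn_).
  by field; rewrite !gt_eqF.
by rewrite ler_pdivrMr// divr_gt0.
Qed.

(** The plateau bound says that V(x_1) is at most [T']. It is turned into a bound on the truncated
    integrals up to [x0] by contradiction, and then [k] tends to infinity. *)
Lemma logsob_B_plus_le (R : realType) (mu : probability (measurableTypeR R) R)
    (q e K m x0 : R) (n : R -> R) :
  logsob_admissible q mu n K -> 0 <= K ->
  measurable_fun [set: measurableTypeR R] n -> (forall x, 0 <= n x) -> 2 <= q -> 0 < e ->
  (forall x, m < x -> (e%:E * \int[lebesgue_measure]_(t in `[m, x]) density_pow q n t <=
     (q - 1)%:E * density_pow q n x)%E) ->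
  (mu `]m, +oo[%classic <= (2^-1)%:E)%E -> m < x0 ->
  ((3 * Num.min (e `^ (q - 2)) 1 / (4 * (q - 1) `^ (q - 1)))%:E *
    (mass_log mu `[x0, +oo[%classic *
      (\int[lebesgue_measure]_(t in `[m, x0]) density_pow q n t) `^ (q - 1)) <= K%:E)%E.
Proof.
move=> HK K0 mn n0 q2 e0 He hm mx0.
have q10 : 0 < q - 1 by lra.
have q1 : 1 < q by lra.
rewrite /mass_log; set p := fine _.
have mA : measurable (`[x0, +oo[%classic : set (measurableTypeR R)) by exact: measurable_itv.
have pE : mu `[x0, +oo[%classic = p%:E by rewrite /p fineK// fin_num_measure.
have p_0 : 0 <= p by exact: fine_ge0.
have p2 : p <= 2^-1.
  rewrite -lee_fin -pE; apply: le_trans hm; apply: le_measure; rewrite ?inE//.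
  by apply: subset_itv; rewrite bnd_simp.
have [p00|pN0] := eqVneq p 0; first by rewrite p00 mul0r mul0e mule0 lee_fin.
have p0 : 0 < p by rewrite lt_def pN0.
set l := p * _.
have l0 : 0 < l.
  by rewrite mulr_gt0// (lt_le_trans _ (ln_inv_ge_1B p0))//; lra.
set c := 3 * _ / _.
have c0 : 0 < c by rewrite divr_gt0// mulr_gt0// ?lt_min ?ltr01 powR_gt0.
(* [T] is the largest value of W^(q-1) compatible with c l W^(q-1) <= K, and [T'] the corresponding
   W. *)
pose T := K / (c * l).
have cl0 : 0 < c * l by exact: mulr_gt0.
have T0 : 0 <= T by rewrite divr_ge0// ltW.
pose T' := T `^ (q - 1)^-1.
have TT : T' `^ (q - 1) = T by rewrite -powRrM mulVf ?gt_eqF// powRr1.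
have T'0 : 0 <= T' by exact: powR_ge0.
have mw := measurable_density_pow q mn.
have w0 x : (0 <= density_pow q n x)%E by rewrite ltW// density_pow_gt0.
pose w k := truncated_weight q n k.
have trunc k : T' < k.+1%:R * (q - 1) / e -> primitive (w k) m x0 <= T'.
  move=> Tk; rewrite leNgt; apply/negP => TP.
  have wk x := truncated_weight_itv q k (n0 x).
  have wk' x : 0 <= w k x <= k.+1%:R by case/andP: (wk x) => /ltW -> ->.
  have mwk := measurable_truncated_weight q k mn.
  have cP : continuous (primitive (w k) m).
    exact: locally_lipschitz_continuous (primitive_locally_lipschitz m mwk wk').
  (* Stopping V at this level is what saves the comparison: where the truncation is inactive, it
     follows from the assumption on w, and where w is cut to k + 1, from V <= (k + 1) (q - 1) /
     e. *)
  set t := Num.min (primitive (w k) m x0) (k.+1%:R * (q - 1) / e).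
  have tT : T' < t by rewrite lt_min TP.
  have t0 : 0 < t by exact: le_lt_trans tT.
  have Pm : primitive (w k) m m <= t by rewrite primitive_lo// ltW.
  have tP : t <= primitive (w k) m x0 by rewrite ge_min lexx.
  have [x1 [/andP[mx1 x10] Px1 Px]] := first_hitting cP Pm (ltW mx0) tP.
  have mx1' : m < x1.
    rewrite lt_def mx1 andbT; apply/negP => /eqP x1m.
    by move: t0; rewrite -Px1 x1m primitive_lo// ltxx.
  have Hx x : m < x < x1 -> e * primitive (w k) m x <= (q - 1) * w k x.
    move=> /andP[mx xx1]; rewrite -lee_fin [leRHS]EFinM truncated_weightE//.
    rewrite {1}/Order.min; case: ifPn => _.
      apply: le_trans (He x mx); rewrite EFinM; apply: lee_wpmul2l; first by rewrite lee_fin ltW.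
      rewrite primitive_truncated_le//; apply: ge0_le_integral => //.
      - by move=> y _; rewrite le_min (w0 y) /= lee_fin ler0n.
      - by apply: measurable_funTS; apply: measurable_mine.
      - exact: measurable_funTS.
      - by move=> y _; rewrite ge_min lexx.
    have ht : t <= k.+1%:R * (q - 1) / e by rewrite ge_min lexx orbT.
    have := le_trans (ltW (Px x (ltW mx) xx1)) ht.
    by rewrite ler_pdivlMr// mulrC [_ * (q - 1)]mulrC -EFinM lee_fin.
  have := logsob_plateau_le HK K0 mn n0 q2 mwk wk
    (fun x => truncated_weight_powR_le k (n0 x) q1) mx1' x10 e0 Hx hm.
  rewrite -/p p0 p2 Px1 => /(_ isT); rewrite -/l -/c leNgt => /negP; apply.
  rewrite mulrC -ltr_pdivrMr// -/T -TT.
  by apply: gt0_ltr_powR; rewrite ?nnegrE// ltW.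
(* Once (k + 1) (q - 1) / e exceeds [T'], every truncated integral is at most [T']. Monotone
   convergence passes this to the weight itself, whose integral is therefore finite. *)
have H : (\int[lebesgue_measure]_(t in `[m, x0]) density_pow q n t <= T'%:E)%E.
  pose g k t := Order.min (density_pow q n t) (k.+1%:R%:E : \bar R).
  have mg k : measurable_fun (`[m, x0]%classic : set (measurableTypeR R)) (g k).
    by apply: measurable_funTS; exact: measurable_mine.
  have := @cvg_monotone_convergence _ _ _ lebesgue_measure
    (`[m, x0]%classic : set (measurableTypeR R)) (measurable_itv _) g mg _ _.
  have g0 k x : (`[m, x0]%classic : set (measurableTypeR R)) x -> (0 <= g k x)%E.
    by move=> _; rewrite /g le_min (w0 x) /= lee_fin ler0n.
  have gnd x : (`[m, x0]%classic : set (measurableTypeR R)) x -> nondecreasing_seq (g ^~ x).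
    move=> _ i j ij; rewrite le_min !ge_min lexx/=; apply/orP; right.
    by rewrite lee_fin ler_nat ltnS.
  move=> /(_ g0 gnd).
  have -> : (\int[lebesgue_measure]_(x in `[m, x0]) limn (g ^~ x) =
      \int[lebesgue_measure]_(x in `[m, x0]) density_pow q n x)%E.
    apply: eq_integral => x _; apply/cvg_lim => //.
    rewrite /g; have := w0 x; case: (density_pow q n x) => [r||]// r0.
      apply: cvg_near_cst; near=> k; rewrite min_l// lee_fin.
      by rewrite (@le_trans _ _ k%:R)// ?ler_nat//; near: k; exact: nbhs_infty_ger.
    rewrite (_ : (fun k => _) = (fun k => k.+1%:R%:E)); last first.
      by apply/funext => k; rewrite min_r// leey.
    by apply/cvgeryP; rewrite (@cvg_shiftS _ (fun k => k%:R : R)); exact: cvgr_idn.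
  move=> cv; rewrite -(cvg_lim _ cv)//; apply: lime_le; first by apply/cvg_ex; eexists; exact: cv.
  near=> k; rewrite -primitive_truncated_le// lee_fin trunc//.
  rewrite ltr_pdivlMr// -ltr_pdivrMr//.
  rewrite (@lt_le_trans _ _ k%:R)// ?ler_nat//.
  by near: k; exact: nbhs_infty_gtr.
have Hq : ((\int[lebesgue_measure]_(t in `[m, x0]) density_pow q n t) `^ (q - 1) <= T%:E)%E.
  rewrite -TT -poweR_EFin; apply: gt0_ler_poweR; rewrite ?(ltW q10)//.
    by rewrite in_itv/= leey andbT; apply: integral_ge0.
  by rewrite in_itv/= leey andbT lee_fin.
apply: (@le_trans _ _ (c%:E * (l%:E * T%:E))%E).
  apply: lee_wpmul2l; first by rewrite lee_fin ltW.
  by apply: lee_wpmul2l => //; rewrite lee_fin ltW.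
by rewrite -!EFinM lee_fin mulrA /T mulrC divfK// gt_eqF.
Unshelve. all: by end_near. Qed.

(** * Reflection to the left half-line and conclusion *)

Lemma integral_reflection (R : realType) (mu : probability (measurableTypeR R) R)
    (g : R -> R) : measurable_fun [set: measurableTypeR R] g ->
  (\int[reflection mu]_x (g x)%:E = \int[mu]_x (g (- x)%R)%:E)%E.
Proof.
move=> mg; rewrite integralE [RHS]integralE; congr (_ - _)%E.
- rewrite ge0_integral_reflection ?preimage_setT//; first by apply: eq_integral => x _; rewrite !funeposE.
  exact: (measurable_funepos (proj2 (measurable_EFinP _ _) mg)).
- rewrite ge0_integral_reflection ?preimage_setT//; first by apply: eq_integral => x _; rewrite !funenegE.
  exact: (measurable_funeneg (proj2 (measurable_EFinP _ _) mg)).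
Qed.

Lemma entropy_reflection (R : realType) (mu : probability (measurableTypeR R) R)
    (g : R -> R) : measurable_fun [set: measurableTypeR R] g ->
  entropy (reflection mu) g = entropy mu (fun x => g (- x)).
Proof.
move=> mg; rewrite /entropy integral_reflection//.
rewrite (@integral_reflection _ _ (fun x => g x * ln (g x)))//.
by apply: measurable_funM => //; exact: measurableT_comp.
Qed.

Lemma logsob_admissible_reflection (R : realType) (q K : R)
    (mu : probability (measurableTypeR R) R) (n : R -> R) :
  measurable_fun [set: measurableTypeR R] n -> (forall x, 0 <= n x) ->
  logsob_admissible q mu n K ->
  logsob_admissible q (reflection mu) (fun x => n (- x)) K.
Proof.
move=> mn n0 HK f lf; have lN := locally_lipschitzN lf.
rewrite entropy_reflection; last first.
  apply: measurable_funX.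
  exact: measurable_locally_lipschitz lf.
apply: (le_trans (HK _ lN)); rewrite le_eqVlt; apply/orP; left; apply/eqP; congr (_ * _)%E.
have := @ge0_integral_oppr R (fun x => (hq_energy q (fun y => f (- y)) n x)%:E) setT
  measurableT _ _.
rewrite preimage_setT => <-.
- apply: eq_integral => x _; congr EFin; rewrite -hq_energyN//.
  by congr (hq_energy q _ _ x); apply/funext => y; rewrite opprK.
- by apply/measurable_EFinP; exact: measurable_hq_energy.
- by move=> x; rewrite lee_fin hq_energy_ge0.
Qed.

Lemma logsob_B_minus_le (R : realType) (mu : probability (measurableTypeR R) R)
    (q e K m x0 : R) (n : R -> R) :
  logsob_admissible q mu n K -> 0 <= K ->
  measurable_fun [set: measurableTypeR R] n -> (forall x, 0 <= n x) -> 2 <= q -> 0 < e ->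
  (forall x, x < m -> (e%:E * \int[lebesgue_measure]_(t in `[x, m]) density_pow q n t <=
     (q - 1)%:E * density_pow q n x)%E) ->
  (mu `]-oo, m[%classic <= (2^-1)%:E)%E -> x0 < m ->
  ((3 * Num.min (e `^ (q - 2)) 1 / (4 * (q - 1) `^ (q - 1)))%:E *
    (mass_log mu `]-oo, x0]%classic *
      (\int[lebesgue_measure]_(t in `[x0, m]) density_pow q n t) `^ (q - 1)) <= K%:E)%E.
Proof.
move=> HK K0 mn n0 q2 e0 He hm x0m.
have mnN : measurable_fun [set: measurableTypeR R] (fun x => n (- x)).
  exact: (measurableT_comp mn (@measurable_oppr R)).
have nN0 x : 0 <= n (- x) by [].
have HeN x : - m < x -> (e%:E * \int[lebesgue_measure]_(t in `[(- m)%R, x])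
    density_pow q (fun y => n (- y)%R) t <= (q - 1)%:E * density_pow q (fun y => n (- y)%R) x)%E.
  move=> mx; have xm : - x < m by rewrite ltrNl.
  have := integral_density_powN q (- x) m mn n0; rewrite opprK => ->.
  exact: He xm.
have rA (a : R) : -%R @^-1` `[(- a)%R, +oo[ = `]-oo, a]%classic :> set R.
  by apply/seteqP; split=> x /=; rewrite !in_itv/= andbT lerN2.
have rD : -%R @^-1` `](- m)%R, +oo[ = `]-oo, m[%classic :> set R.
  by apply/seteqP; split=> x /=; rewrite !in_itv/= andbT ltrN2.
have hmN : (reflection mu `](- m)%R, +oo[%classic <= (2^-1)%:E)%E.
  by rewrite reflectionE rD.
have := logsob_B_plus_le (logsob_admissible_reflection mn n0 HK) K0 mnN nN0 q2 e0 HeN hmN.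
move=> /(_ (- x0)); rewrite ltrN2 => /(_ x0m).
by rewrite integral_density_powN// /mass_log reflectionE rA.
Qed.

Lemma median_gt_le_half (R : realType) (mu : probability (measurableTypeR R) R) (m : R) :
  is_median mu m -> (mu `]m, +oo[%classic <= (2^-1)%:E)%E.
Proof.
move=> [+ _]; have mA : measurable (`]-oo, m]%classic : set (measurableTypeR R)).
  exact: measurable_itv.
have -> : `]m, +oo[%classic = ~` `]-oo, m]%classic :> set R by rewrite setCitvl.
rewrite probability_setC//; have fA : mu `]-oo, m]%classic \is a fin_num by exact: fin_num_measure.
by rewrite -(fineK fA) -EFinB !lee_fin; lra.
Qed.

Lemma median_lt_le_half (R : realType) (mu : probability (measurableTypeR R) R) (m : R) :
  is_median mu m -> (mu `]-oo, m[%classic <= (2^-1)%:E)%E.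
Proof.
move=> [_ +]; have mA : measurable (`[m, +oo[%classic : set (measurableTypeR R)).
  exact: measurable_itv.
have -> : `]-oo, m[%classic = ~` `[m, +oo[%classic :> set R by rewrite setCitvr.
rewrite probability_setC//; have fA : mu `[m, +oo[%classic \is a fin_num by exact: fin_num_measure.
by rewrite -(fineK fA) -EFinB !lee_fin; lra.
Qed.

Lemma mule_ereal_sup_le (R : realType) (c K : R) (S : set (\bar R)) : 0 < c ->
  (forall s, S s -> (c%:E * s <= K%:E)%E) -> (c%:E * ereal_sup S <= K%:E)%E.
Proof.
move=> c0 H; rewrite -lee_pdivlMl//; apply: ge_ereal_sup => s Ss.
by rewrite lee_pdivlMl// H.
Qed.

Lemma modified_logsob_constant_ge (R : realType)
    (mu : probability (measurableTypeR R) R) (m : R)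
    (nu : {measure set (measurableTypeR R) -> \bar R}) (n : R -> R) (q e : R) :
  is_median mu m -> is_density nu n -> 2 <= q -> 0 < e ->
  (forall x : R, x != m ->
    (e%:E * \int[lebesgue_measure]_(t in `[Num.min x m, Num.max x m]) density_pow q n t
      <= (q - 1)%:E * density_pow q n x)%E) ->
  (Order.max (2%:E * poincare_constant mu nu)
    ((3 * Num.min (e `^ (q - 2)) 1 / (4 * (q - 1) `^ (q - 1)))%:E
      * Order.max (B_plus q mu n m) (B_minus q mu n m))
    <= modified_logsob_constant q mu nu)%E.
Proof.
move=> med hn q2 e0 He; have [mn n0 _] := hn.
apply: le_ereal_inf_tmp => _ [K [K0 HK] <-].
have adm : logsob_admissible q mu n K.
  move=> f lf; apply: (le_trans (HK f lf)); rewrite (ge0_integral_density hn)//.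
  - exact: measurable_Hq_slope.
  - by move=> x; apply: mulr_ge0; [exact: Hq_ge0|exact: sqr_ge0].
rewrite ge_max; apply/andP; split.
  rewrite -lee_pdivlMl// -EFinM mulrC; apply: best_constant_le; first exact: divr_gt0.
  move=> f lf; rewrite (ge0_integral_density hn)//.
  - exact: poincare_of_logsob adm K0 q2 mn n0 f lf.
  - by apply: measurable_funX; exact: measurable_local_slope.
  - by move=> x; exact: sqr_ge0.
have c0 : 0 < 3 * Num.min (e `^ (q - 2)) 1 / (4 * (q - 1) `^ (q - 1)).
  by rewrite divr_gt0// mulr_gt0// ?lt_min ?ltr01 powR_gt0//; lra.
have Bp : ((3 * Num.min (e `^ (q - 2)) 1 / (4 * (q - 1) `^ (q - 1)))%:E *
    B_plus q mu n m <= K%:E)%E.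
  apply: (mule_ereal_sup_le c0) => s [x /=]; rewrite in_itv/= andbT => mx <-.
  apply: (logsob_B_plus_le adm (ltW K0)) => //; last exact: median_gt_le_half.
  move=> y my; have := He y; rewrite gt_eqF// => /(_ isT).
  by rewrite min_r ?(ltW my)// max_l ?(ltW my).
have Bm : ((3 * Num.min (e `^ (q - 2)) 1 / (4 * (q - 1) `^ (q - 1)))%:E *
    B_minus q mu n m <= K%:E)%E.
  apply: (mule_ereal_sup_le c0) => s [x /=]; rewrite in_itv/= => mx <-.
  apply: (logsob_B_minus_le adm (ltW K0)) => //; last exact: median_lt_le_half.
  move=> y my; have := He y; rewrite lt_eqF// => /(_ isT).
  by rewrite min_l ?(ltW my)// max_r ?(ltW my).
by rewrite /Order.max; case: ifP => _; [exact: Bm|exact: Bp].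
Qed.

Local Open Scope ereal_scope.

Theorem theorem10 (R : realType)
    (mu : probability (measurableTypeR R) R) (m : R)
    (hm : is_median mu m)
    (nu : {measure set (measurableTypeR R) -> \bar R}) (n : R -> R)
    (hn : is_density nu n)
    (q : R) (hq : (2 <= q)%R) :
  modified_logsob_constant q mu nu <=
    235%:E * poincare_constant mu nu
    + (2 `^ (q + 1))%:E * Order.max (B_plus q mu n m) (B_minus q mu n m)
  /\
  (forall eps : R, (0 < eps)%R ->
    (forall x : R, x != m ->
      eps%:E * \int[lebesgue_measure]_(t in `[Num.min x m, Num.max x m])
                 density_pow q n t
        <= (q - 1)%:E * density_pow q n x) ->
    Order.max (2%:E * poincare_constant mu nu)
      ((3 * Num.min (eps `^ (q - 2)) 1 / (4 * (q - 1) `^ (q - 1)))%:E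
        * Order.max (B_plus q mu n m) (B_minus q mu n m))
      <= modified_logsob_constant q mu nu).
Proof.
split; first exact: modified_logsob_constant_le.
by move=> eps eps0 Heps; exact: modified_logsob_constant_ge.
Qed.
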